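(* Let $\rho_1,\sigma_1$ be density operators on a finite-dimensional Hilbert space and $\rho_2,\sigma_2$ on another. Let $a\in(0,1)$, $\lambda>0$ and $\epsilon_n:=\exp(-\lambda n^a)$. If $[\rho_2,\sigma_2]=0$, then $$R^*_n(\epsilon_n)=\frac{D(\rho_1\|\sigma_1)-|1-\xi^{-1/2}|\sqrt{2\lambda V(\rho_1\|\sigma_1)n^{a-1}}}{D(\rho_2\|\sigma_2)}+o\bigl(\sqrt{n^{a-1}}\bigr),$$ $$R^*_n(1-\epsilon_n)=\frac{D(\rho_1\|\sigma_1)+\bigl[1+\xi^{-1/2}\bigr]\sqrt{2\lambda V(\rho_1\|\sigma_1)n^{a-1}}}{D(\rho_2\|\sigma_2)}+o\bigl(\sqrt{n^{a-1}}\bigr).$$ For general (not necessarily commuting) $\rho_2,\sigma_2$, the same two expressions hold as upper bounds on $R_n^*(\epsilon_n)$ and $R_n^*(1-\epsilon_n)$ respectively, up to $o(\sqrt{n^{a-1}})$.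
   Context: Trace distance $T(\rho,\sigma)=\frac12\|\rho-\sigma\|_1$. Write $(\rho,\sigma)\succeq_{(\epsilon_\rho,\epsilon_\sigma)}(\rho',\sigma')$ if some quantum channel $\mathcal E$ satisfies $T(\mathcal E(\rho),\rho')\le\epsilon_\rho$ and $T(\mathcal E(\sigma),\sigma')\le\epsilon_\sigma$. $R_n^*(\epsilon_n)$ is the largest $R_n$ such that $(\rho_1^{\otimes n},\sigma_1^{\otimes n})\succeq_{(\epsilon_n,0)}(\rho_2^{\otimes R_nn},\sigma_2^{\otimes R_nn})$. $D(\rho\|\sigma)=\mathrm{Tr}\,\rho(\log\rho-\log\sigma)$, $V(\rho\|\sigma)=\mathrm{Tr}\,\rho(\log\rho-\log\sigma)^2-D(\rho\|\sigma)^2$, and $\xi=\frac{V(\rho_1\|\sigma_1)}{D(\rho_1\|\sigma_1)}\Big/\frac{V(\rho_2\|\sigma_2)}{D(\rho_2\|\sigma_2)}$; $\exp$ and $\log$ are in the same base. *)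

(* Defs.v *)
From HB Require Import structures.
From mathcomp Require Import all_boot all_order all_algebra.
From mathcomp Require Import all_classical all_reals all_analysis.
From mathcomp Require Import complex mxtens.

Set Implicit Arguments.
Unset Strict Implicit.
Unset Printing Implicit Defensive.

Import Order.TTheory GRing.Theory Num.Theory.
Local Open Scope ring_scope.

Section QDefs.
Variable R : realType.
Local Notation C := (R[i]).

Definition adj m n (A : 'M[C]_(m, n)) : 'M[C]_(n, m) :=
  \matrix_(i, j) conjc (A j i).

Definition psd d (A : 'M[C]_d) : Prop :=
  A = adj A /\ forall v : 'cV[C]_d, 0 <= (adj v *m A *m v) 0 0.

Definition density d (A : 'M[C]_d) : Prop := psd A /\ \tr A = 1.

Definition unitary d (U : 'M[C]_d) : Prop := U *m adj U = 1%:M.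

Definition specdec d (A : 'M[C]_d) (p : 'M[C]_d * 'rV[R]_d) : Prop :=
  unitary p.1 /\ A = p.1 *m diag_mx (map_mx (real_complex R) p.2) *m adj p.1.

(* functional calculus f(A) for a Hermitian matrix A (via a chosen spectral
   decomposition; 0 if A has none, i.e. A is not Hermitian) *)
Definition mxfun d (f : R -> R) (A : 'M[C]_d) : 'M[C]_d :=
  match pselect (exists p, specdec A p) with
  | left h => let p := projT1 (cid h) in
      p.1 *m diag_mx (map_mx (fun x => real_complex R (f x)) p.2) *m adj p.1
  | right _ => 0
  end.

(* matrix logarithm (natural base); ln 0 = 0 in mathcomp-analysis, i.e. the
   logarithm is taken on the support *)
Definition mxlog d (A : 'M[C]_d) : 'M[C]_d := mxfun (@ln R) A.

Definition tnorm d (A : 'M[C]_d) : R :=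
  complex.Re (\tr (mxfun Num.sqrt (adj A *m A))).
Definition tdist d (rho sigma : 'M[C]_d) : R := tnorm (rho - sigma) / 2.

Definition relD d (rho sigma : 'M[C]_d) : R :=
  complex.Re (\tr (rho *m (mxlog rho - mxlog sigma))).
Definition relV d (rho sigma : 'M[C]_d) : R :=
  complex.Re (\tr (rho *m ((mxlog rho - mxlog sigma) *m (mxlog rho - mxlog sigma))))
  - relD rho sigma ^+ 2.

Definition blk k d (X : 'M[C]_(k * d)) (a b : 'I_k) : 'M[C]_d :=
  \matrix_(p, q) X (mxtens_index (a, p)) (mxtens_index (b, q)).

(* (id_k (x) Phi)(X) *)
Definition ampl k d1 d2 (Phi : 'M[C]_d1 -> 'M[C]_d2) (X : 'M[C]_(k * d1))
  : 'M[C]_(k * d2) :=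
  \matrix_(i, j) Phi (blk X (mxtens_unindex i).1 (mxtens_unindex j).1)
                     (mxtens_unindex i).2 (mxtens_unindex j).2.

Definition channel d1 d2 (Phi : {linear 'M[C]_d1 -> 'M[C]_d2}) : Prop :=
  (forall X, \tr (Phi X) = \tr X) /\
  (forall k (X : 'M[C]_(k * d1)), psd X -> psd (@ampl k d1 d2 Phi X)).

Definition convertible d1 d2 (rho sigma : 'M[C]_d1) (rho' sigma' : 'M[C]_d2)
  (erho esigma : R) : Prop :=
  exists Phi : {linear 'M[C]_d1 -> 'M[C]_d2}, channel Phi /\
    tdist (Phi rho) rho' <= erho /\ tdist (Phi sigma) sigma' <= esigma.

Definition Rstar d1 d2 (rho1 sigma1 : 'M[C]_d1) (rho2 sigma2 : 'M[C]_d2)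
  (n : nat) (eps : R) : R :=
  sup [set r : R | exists m : nat, r = m%:R / n%:R /\
        convertible (rho1 ^t n) (sigma1 ^t n) (rho2 ^t m) (sigma2 ^t m) eps 0].

End QDefs.

(* Main.v *)
(** Let P be the Nussbaum-Szkola distribution p_i |<v_j, u_i>|^2 built from
    eigenbases u of rho and v of sigma.  The log-likelihood ratio ln p - ln q has
    mean D and variance V under P, and is a sum of i.i.d. copies for tensor powers;
    its moment generating function alone yields, by exponential tilting, that a
    deviation x n^((1+a)/2) has probability exp(- n^a (x^2 / 2V + o(1))).

    Converse: pulling a test for the output pair back through the channel gives a
    test for the input pair with almost the same errors.  Both error trade-offs are
    controlled by tails of P: bounds of Nussbaum-Szkola type limit every test, and a
    test in the style of Li, the projection onto the span of suitably truncated
    eigenvectors of rho, attains them.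

    Achievability, for commuting rho2 and sigma2: nested tests of Li type on the
    input are turned into a measure-and-prepare channel.  The values of the output
    log-likelihood ratio are cut into bins of width of order n^((1+a)/2); the bins
    are filled greedily by the nested tests so that sigma is mapped exactly and only
    the mass that could not be filled contributes to the error on rho.

    With A1^2 = 2 lam V1 and A2^2 = 2 lam V2 D1 / D2, the fluctuations of input and
    output at level exp(- lam n^a) are A1 and A2 in units of n^((1+a)/2).  They
    compensate each other for small error and add up for large error, which gives
    the second-order terms - |A1 - A2| and A1 + A2. *)
Require Import Defs.
From HB Require Import structures.
From mathcomp Require Import all_boot all_order all_algebra.
From mathcomp Require Import all_classical all_reals all_analysis.
From mathcomp Require Import complex mxtens ring lra.
Import Order.TTheory GRing.Theory Num.Theory numFieldNormedType.Exports.
Local Open Scope classical_set_scope.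
Local Open Scope ring_scope.

Set Implicit Arguments.
Unset Strict Implicit.
Unset Printing Implicit Defensive.

(** Deviations of the log-likelihood ratio live at scale [Ns], their probabilities at speed [Ls],
    and [Ls / Ns] tends to zero. Hence a gap of [k * Ns n] between thresholds absorbs every factor
    expR (B * Ls n) in the errors on sigma, polynomial losses included, and only the rates of the
    errors on rho remain to be compared. Two one-shot converses are needed. A bound on 1 - ev rho T
    says nothing about tests that accept rho with exponentially small probability; these get a
    second bound, whose loss is the number of levels of eigenvalues of rho. The term |A1 - A2| comes
    from matching quantiles: an output deviation y and an input deviation y A1 / A2 have the same
    rate, so the thresholds must be offset by (A1 - A2) y / A2. Only |y| <= A2 counts, everything
    beyond being rarer than the error, and the worst y is an endpoint. For error 1 - eps it is
    enough to convert a rare part: the output near -A2 is filled from the input above A1. *)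

Local Notation re := (@complex.Re _).

(** * Positive matrices, spectral decompositions and the trace norm *)

Section Matrices.
Variable R : realType.
Local Notation C := (R[i]).
Local Notation "x %:C" := (real_complex R x) (at level 1, format "x %:C").

Lemma reD (x y : C) : re (x + y) = re x + re y.
Proof. by case: x y => [? ?] []. Qed.
Lemma reN (x : C) : re (- x) = - re x.
Proof. by case: x. Qed.
Lemma reB (x y : C) : re (x - y) = re x - re y.
Proof. by rewrite reD reN. Qed.
Lemma reZ (a : R) (x : C) : re (a%:C * x) = a * re x.
Proof. by case: x => u v /=; rewrite mul0r subr0. Qed.
Lemma re_sum I (r : seq I) (P : pred I) (F : I -> C) :
  re (\sum_(i <- r | P i) F i) = \sum_(i <- r | P i) re (F i).
Proof. by apply: (big_morph re reD). Qed.
Lemma re_ge0 (x : C) : 0 <= x -> 0 <= re x.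
Proof. by rewrite lecE /= => /andP[]. Qed.
Lemma ge0_re (x : C) : 0 <= x -> x = (re x)%:C.
Proof. by case: x => u v; rewrite lecE /= => /andP[/eqP -> _]. Qed.

Definition nsq (z : C) : R := re (conjc z * z).

Lemma nsqE (z : C) : nsq z = complex.Re z ^+ 2 + complex.Im z ^+ 2.
Proof. by case: z => u v; rewrite /nsq /=; ring. Qed.
Lemma nsq_ge0 z : 0 <= nsq z.
Proof. by rewrite nsqE addr_ge0 ?sqr_ge0. Qed.
Lemma nsqM z w : nsq (z * w) = nsq z * nsq w.
Proof. by case: z w => [a b] [c d]; rewrite !nsqE /=; ring. Qed.
Lemma nsq0 : nsq 0 = 0.
Proof. by rewrite nsqE /= expr0n addr0. Qed.
Lemma nsq1 : nsq 1 = 1.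
Proof. by rewrite nsqE /= expr0n expr1n addr0. Qed.
Lemma conjc_mul_nsq z : conjc z * z = (nsq z)%:C.
Proof. by apply: ge0_re; rewrite mulrC; exact: mulcJ_ge0. Qed.
Lemma nsqC_half (z w : C) : nsq (z + w) <= 2 * (nsq z + nsq w).
Proof.
case: z w => [a b] [c d]; rewrite !nsqE /=.
have : 0 <= (a - c) ^+ 2 + (b - d) ^+ 2 by rewrite addr_ge0 ?sqr_ge0.
nra.
Qed.

Lemma adjE m n (A : 'M[C]_(m, n)) i j : adj A i j = conjc (A j i).
Proof. by rewrite mxE. Qed.
Lemma adjK m n : cancel (@adj R m n) (@adj R n m).
Proof. by move=> A; apply/matrixP => i j; rewrite !mxE conjcK. Qed.
Lemma adjM m n p (A : 'M[C]_(m, n)) (B : 'M[C]_(n, p)) :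
  adj (A *m B) = adj B *m adj A.
Proof.
apply/matrixP => i j; rewrite !mxE rmorph_sum; apply: eq_bigr => k _.
by rewrite rmorphM !mxE mulrC.
Qed.
Lemma adjD m n (A B : 'M[C]_(m, n)) : adj (A + B) = adj A + adj B.
Proof. by apply/matrixP => i j; rewrite !mxE rmorphD. Qed.
Lemma adjN m n (A : 'M[C]_(m, n)) : adj (- A) = - adj A.
Proof. by apply/matrixP => i j; rewrite !mxE rmorphN. Qed.
Lemma adjB m n (A B : 'M[C]_(m, n)) : adj (A - B) = adj A - adj B.
Proof. by rewrite adjD adjN. Qed.
Lemma adj_scale m n c (A : 'M[C]_(m, n)) : adj (c *: A) = conjc c *: adj A.
Proof. by apply/matrixP => i j; rewrite !mxE rmorphM. Qed.
Lemma adj0 m n : adj (0 : 'M[C]_(m, n)) = 0.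
Proof. by apply/matrixP => i j; rewrite !mxE conjc0. Qed.
Lemma adj_id n : adj (1%:M : 'M[C]_n) = 1%:M.
Proof. by apply/matrixP => i j; rewrite !mxE eq_sym rmorph_nat. Qed.
Lemma unitaryC n (U : 'M[C]_n) : unitary U -> adj U *m U = 1%:M.
Proof. by move=> h; exact: mulmx1C. Qed.
Lemma unitary_adj n (U : 'M[C]_n) : unitary U -> unitary (adj U).
Proof. by move=> h; rewrite /unitary adjK; exact: unitaryC. Qed.
Lemma unitaryM n (U V : 'M[C]_n) : unitary U -> unitary V -> unitary (U *m V).
Proof.
move=> hU hV; rewrite /unitary adjM mulmxA -(mulmxA U) hV mulmx1; exact: hU.
Qed.

Lemma unitary_row_nsq n (W : 'M[C]_n) j : unitary W -> \sum_i nsq (W j i) = 1.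
Proof.
move=> hW; have := congr1 (fun M => re (fun_of_matrix M j j)) hW.
rewrite /= !mxE eqxx /= re_sum => <-; apply: eq_bigr => i _.
by rewrite adjE mulrC conjc_mul_nsq.
Qed.
Lemma unitary_col_nsq n (W : 'M[C]_n) i : unitary W -> \sum_j nsq (W j i) = 1.
Proof.
move=> /unitaryC hW; have := congr1 (fun M => re (fun_of_matrix M i i)) hW.
rewrite /= !mxE eqxx /= re_sum => <-; apply: eq_bigr => j _.
by rewrite adjE conjc_mul_nsq.
Qed.

Definition dg n (d : 'I_n -> R) : 'M[C]_n := diag_mx (\row_i (d i)%:C).

Lemma dgE n (d : 'I_n -> R) i j : dg d i j = (if i == j then d i else 0)%:C.
Proof. by rewrite !mxE; case: eqP => [->|_]; rewrite ?mulr1n ?mulr0n. Qed.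
Lemma adj_dg n (d : 'I_n -> R) : adj (dg d) = dg d.
Proof.
by apply/matrixP => i j; rewrite adjE !dgE conjc_real eq_sym; case: eqP => [->|].
Qed.
Lemma dg_mul n (d e : 'I_n -> R) : dg d *m dg e = dg (fun i => d i * e i).
Proof.
apply/matrixP => i j; rewrite mul_diag_mx dgE !mxE; case: eqP => [->|_].
  by rewrite mulr1n -rmorphM.
by rewrite mulr0n mulr0.
Qed.
Lemma dg1 n : dg (fun _ : 'I_n => 1) = 1%:M.
Proof. by apply/matrixP => i j; rewrite dgE mxE; case: eqP. Qed.
Lemma dgD n (d e : 'I_n -> R) : dg d + dg e = dg (fun i => d i + e i).
Proof.
by apply/matrixP => i j; rewrite mxE !dgE; case: eqP; rewrite -rmorphD ?addr0.
Qed.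
Lemma dgB n (d e : 'I_n -> R) : dg d - dg e = dg (fun i => d i - e i).
Proof.
by apply/matrixP => i j; rewrite !mxE -!mulrnBl -rmorphB.
Qed.
Lemma eq_dg n (d e : 'I_n -> R) : d =1 e -> dg d = dg e.
Proof. by move=> h; apply/matrixP => i j; rewrite !dgE h. Qed.
Lemma re_tr_dg n (d : 'I_n -> R) : re (\tr (dg d)) = \sum_i d i.
Proof. by rewrite /mxtrace re_sum; apply: eq_bigr => i _; rewrite dgE eqxx. Qed.

Definition eigdec n (A U : 'M[C]_n) (p : 'I_n -> R) :=
  unitary U /\ A = U *m dg p *m adj U.

Lemma specdecP n (A : 'M[C]_n) p : specdec A p -> eigdec A p.1 (p.2 0).
Proof.
move=> [h1 h2]; split => //; rewrite h2; congr (_ *m diag_mx _ *m _).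
by apply/rowP => i; rewrite !mxE.
Qed.

Lemma eigdec_exists n (A : 'M[C]_n) : A = adj A -> exists U p, eigdec A U p.
Proof.
move=> hA.
have hH : A \is hermsymmx.
  apply/is_hermitianmxP; rewrite expr0 scale1r {1}hA.
  by apply/matrixP => i j; rewrite !mxE.
have /orthomx_spectralP hs := hermitian_normalmx hH.
have hU := spectral_unitarymx A.
have hR := hermitian_spectral_diag_real hH.
exists (invmx (spectralmx A)), (fun i => re (spectral_diag A 0 i)); split.
  rewrite /unitary invmx_unitary //.
  have -> : adj (map_mx Num.conj (spectralmx A)^T) = spectralmx A.
    by apply/matrixP => i j; rewrite !mxE; exact: conjcK.
  by have /mulmx1C := unitarymxP hU.
have -> : adj (invmx (spectralmx A)) = spectralmx A.
  by rewrite invmx_unitary //; apply/matrixP => i j; rewrite !mxE; exact: conjcK.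
rewrite [LHS]hs; congr (_ *m diag_mx _ *m _).
apply/rowP => i; rewrite !mxE RRe_real //.
by move/mxOverP: hR; apply.
Qed.

(** Comparing the two decompositions entrywise gives (p i - m j) W i j = 0 for the change of basis
    W. This is what makes [mxfun] independent of the spectral decomposition chosen in it. *)
Lemma eigdec_overlap n (A U V : 'M[C]_n) p m i j : eigdec A U p -> eigdec A V m ->
  (adj U *m V) i j != 0 -> p i = m j.
Proof.
move=> [hU hA] [hV hm] hij.
have hc : dg p *m (adj U *m V) = (adj U *m V) *m dg m.
  have := congr1 (fun M => adj U *m M *m V) (etrans (esym hA) hm) => /=.
  rewrite !mulmxA (unitaryC hU) mul1mx -!mulmxA (unitaryC hV) mulmx1 !mulmxA.
  by rewrite -[_ *m adj U *m V]mulmxA.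
have := congr1 (fun M => fun_of_matrix M i j) hc.
rewrite /= mul_diag_mx mul_mx_diag [LHS]mxE [RHS]mxE.
rewrite [X in X * _ = _]mxE [X in _ = _ * X]mxE mulrC => /(mulfI hij).
exact: complexI.
Qed.

Lemma psd_adj n (A : 'M[C]_n) : psd A -> adj A = A.
Proof. by move=> [<-]. Qed.
Lemma psd0 n : psd (0 : 'M[C]_n).
Proof. by split; rewrite ?adj0 // => v; rewrite mulmx0 mul0mx mxE. Qed.
Lemma psdD n (A B : 'M[C]_n) : psd A -> psd B -> psd (A + B).
Proof.
move=> [hA1 hA2] [hB1 hB2]; split; first by rewrite adjD -hA1 -hB1.
by move=> v; rewrite mulmxDr mulmxDl mxE addr_ge0.
Qed.
Lemma psd_sum I (r : seq I) (P : pred I) n (F : I -> 'M[C]_n) :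
  (forall i, P i -> psd (F i)) -> psd (\sum_(i <- r | P i) F i).
Proof. by move=> h; elim/big_ind: _; [exact: psd0|move=> *; exact: psdD|exact: h]. Qed.
Lemma psdZ n (c : R) (A : 'M[C]_n) : 0 <= c -> psd A -> psd (c%:C *: A).
Proof.
move=> hc [hA1 hA2]; split; first by rewrite adj_scale conjc_real -hA1.
by move=> v; rewrite -scalemxAr -scalemxAl mxE mulr_ge0 // ler0c.
Qed.
Lemma psd_conj m n (B : 'M[C]_(m, n)) A : psd A -> psd (B *m A *m adj B).
Proof.
move=> [hA1 hA2]; split; first by rewrite !adjM adjK -hA1 mulmxA.
move=> v; have := hA2 (adj B *m v); rewrite adjM adjK.
by rewrite !mulmxA.
Qed.
Lemma psd_dg n (d : 'I_n -> R) : (forall i, 0 <= d i) -> psd (dg d).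
Proof.
move=> hd; split; first by rewrite adj_dg.
move=> v; rewrite !mxE sumr_ge0 // => j _; rewrite mul_mx_diag !mxE.
by rewrite mulrAC conjc_mul_nsq -rmorphM ler0c mulr_ge0 // nsq_ge0.
Qed.
Lemma psd1 n : psd (1%:M : 'M[C]_n).
Proof. by rewrite -dg1; apply: psd_dg. Qed.
Lemma psd_gram m n (B : 'M[C]_(m, n)) : psd (B *m adj B).
Proof. by rewrite -[B in B *m _]mulmx1; apply: psd_conj; exact: psd1. Qed.
Lemma psd_gramC m n (B : 'M[C]_(m, n)) : psd (adj B *m B).
Proof. by rewrite -[X in _ *m X]adjK; apply: psd_gram. Qed.
Lemma psd_diag n (A : 'M[C]_n) i : psd A -> 0 <= re (A i i).
Proof.
move=> [_ /(_ (delta_mx i 0))] /re_ge0.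
have -> : adj (delta_mx i 0 : 'cV[C]_n) = delta_mx 0 i.
  by apply/matrixP => k j; rewrite !mxE andbC rmorph_nat.
by rewrite -rowE -colE !mxE.
Qed.
Lemma psd_eigdec n (A : 'M[C]_n) : psd A ->
  exists U p, eigdec A U p /\ forall i, 0 <= p i.
Proof.
move=> hA; have [U [p hp]] := eigdec_exists (esym (psd_adj hA)).
exists U, p; split => // i; have := psd_diag i (psd_conj (adj U) hA).
case: hp => hU ->; rewrite adjK !mulmxA unitaryC // mul1mx -mulmxA unitaryC // mulmx1.
by rewrite dgE eqxx.
Qed.

(** The probability that the test [T] accepts the state [A]. *)
Definition ev n (A T : 'M[C]_n) : R := re (\tr (A *m T)).

Lemma evC n (A T : 'M[C]_n) : ev A T = ev T A.
Proof. by rewrite /ev mxtrace_mulC. Qed.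
Lemma evDr n (A T S : 'M[C]_n) : ev A (T + S) = ev A T + ev A S.
Proof. by rewrite /ev mulmxDr mxtraceD reD. Qed.
Lemma evBr n (A T S : 'M[C]_n) : ev A (T - S) = ev A T - ev A S.
Proof. by rewrite /ev mulmxBr linearB /= reB. Qed.
Lemma evBl n (A T S : 'M[C]_n) : ev (T - S) A = ev T A - ev S A.
Proof. by rewrite /ev mulmxBl linearB /= reB. Qed.
Lemma evZr n (A T : 'M[C]_n) c : ev A (c%:C *: T) = c * ev A T.
Proof. by rewrite /ev -scalemxAr mxtraceZ reZ. Qed.
Lemma ev_sumr I (r : seq I) (P : pred I) n (A : 'M[C]_n) (F : I -> 'M[C]_n) :
  ev A (\sum_(i <- r | P i) F i) = \sum_(i <- r | P i) ev A (F i).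
Proof.
apply: (big_morph (ev A) (@evDr n A)).
by rewrite /ev mulmx0 mxtrace0.
Qed.
Lemma ev1 n (A : 'M[C]_n) : ev A 1%:M = re (\tr A).
Proof. by rewrite /ev mulmx1. Qed.

Lemma ev_eigdec n (A U T : 'M[C]_n) p : A = U *m dg p *m adj U ->
  ev A T = \sum_i p i * re ((adj U *m T *m U) i i).
Proof.
move=> ->; rewrite /ev -!mulmxA mxtrace_mulC -mulmxA /mxtrace re_sum.
by apply: eq_bigr => i _; rewrite mul_diag_mx mxE [X in X * _]mxE reZ !mulmxA.
Qed.
Lemma ev_ge0 n (A T : 'M[C]_n) : psd A -> psd T -> 0 <= ev A T.
Proof.
move=> /psd_eigdec[U [p [[_ hA] hp]]] hT; rewrite (ev_eigdec _ hA).
apply: sumr_ge0 => i _; rewrite mulr_ge0 //; apply: psd_diag.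
by rewrite -{2}[U]adjK; apply: psd_conj.
Qed.
Lemma ev_le n (A S T : 'M[C]_n) : psd A -> psd (T - S) -> ev A S <= ev A T.
Proof. by move=> hA hT; rewrite -subr_ge0 -evBr; exact: ev_ge0. Qed.

(** The eigenvalues of [adj A *m A] are the squares of the x i, but [mxfun] picks them in an unknown
    order and basis. The squared overlaps form a doubly stochastic matrix between the two lists, and
    a nonzero overlap forces equal eigenvalues. *)
Lemma tnorm_eigdec n (A U : 'M[C]_n) x : eigdec A U x -> tnorm A = \sum_i `|x i|.
Proof.
move=> [hU hA]; rewrite /tnorm /mxfun.
have hadj : adj A = A by rewrite hA !adjM adjK adj_dg mulmxA.
have hA2 : adj A *m A = U *m dg (fun i => x i * x i) *m adj U.
  rewrite hadj hA -dg_mul !mulmxA -(mulmxA (U *m dg x)) (unitaryC hU).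
  by rewrite mulmx1.
case: pselect => [h|]; last first.
  case; have [V [p [hV hp]]] := eigdec_exists (esym (psd_adj (psd_gramC A))).
  exists (V, \row_i p i); split => //=; rewrite hp; congr (_ *m diag_mx _ *m _).
  by apply/rowP => i; rewrite !mxE.
case: (cid h) => -[V m] /= /specdecP[/= hV hm].
set mu := (m 0) in hm.
have -> : map_mx (fun t => (Num.sqrt t)%:C) m = \row_i (Num.sqrt (mu i))%:C.
  by apply/rowP => i; rewrite !mxE.
rewrite mxtrace_mulC mulmxA unitaryC // mul1mx -[diag_mx _]/(dg _) re_tr_dg.
pose W := adj U *m V.
have hW : unitary W by apply: unitaryM => //; exact: unitary_adj.
have key i j : nsq (W i j) * `|x i| = nsq (W i j) * Num.sqrt (mu j).
  have [->|hne] := eqVneq (W i j) 0; first by rewrite nsq0 !mul0r.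
  by rewrite -(eigdec_overlap (conj hU hA2) (conj hV hm) hne) -expr2 sqrtr_sqr.
transitivity (\sum_j \sum_i nsq (W i j) * Num.sqrt (mu j)).
  by apply: eq_bigr => j _; rewrite -mulr_suml unitary_col_nsq // mul1r.
rewrite exchange_big; apply: eq_bigr => i _.
rewrite -[RHS]mul1r -(unitary_row_nsq i hW) mulr_suml.
by apply: eq_bigr => j _; rewrite key.
Qed.

Lemma tdist_test n (A B T : 'M[C]_n) : adj A = A -> adj B = B ->
  \tr A = \tr B -> psd T -> psd (1%:M - T) -> ev A T <= ev B T + tdist A B.
Proof.
move=> hA hB hAB hT hT1; rewrite -lerBlDl -evBl.
have hX : A - B = adj (A - B) by rewrite adjB hA hB.
have [U [x hx]] := eigdec_exists hX.
rewrite /tdist (tnorm_eigdec hx); have [hU hUx] := hx.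
have hs : \sum_i x i = 0.
  have := congr1 (fun M => re (\tr M)) hUx => /=.
  rewrite linearB /= hAB subrr mxtrace_mulC mulmxA unitaryC // mul1mx re_tr_dg.
  by move=> <-.
rewrite (ev_eigdec _ hUx) ler_pdivlMr // mulr_suml.
(* The traces agree, so the eigenvalues sum to zero; adding them leaves twice the positive part,
   which bounds each term. *)
have -> : \sum_i `|x i| = \sum_i (`|x i| + x i).
  by rewrite big_split /= hs addr0.
apply: ler_sum => i _.
set t := re _.
have ht0 : 0 <= t by apply: psd_diag; rewrite -{2}[U]adjK; apply: psd_conj.
have ht1 : t <= 1.
  have := psd_diag i (psd_conj (adj U) hT1).
  rewrite adjK mulmxBr mulmxBl mulmx1 unitaryC // !mxE eqxx reB -/t /=.
  by rewrite subr_ge0 /t mxE.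
move: t ht0 ht1 => t ht0 ht1; case: (ger0P (x i)) => hx0.
  have : 0 <= x i * (1 - t) by apply: mulr_ge0 => //; rewrite subr_ge0.
  lra.
have : 0 <= - x i * t by rewrite mulr_ge0 // oppr_ge0 ltW.
lra.
Qed.

Lemma tdist_le0_eq n (A B : 'M[C]_n) : adj A = A -> adj B = B ->
  tdist A B <= 0 -> A = B.
Proof.
move=> hA hB; have hX : A - B = adj (A - B) by rewrite adjB hA hB.
have [U [x hx]] := eigdec_exists hX.
rewrite /tdist (tnorm_eigdec hx); have [hU hUx] := hx.
rewrite ler_pdivrMr // mul0r => h.
have h0 i : x i = 0.
  apply/eqP; rewrite -normr_le0; apply: le_trans h.
  by rewrite (bigD1 i) //= lerDl sumr_ge0.
apply/eqP; rewrite -subr_eq0 hUx (_ : dg x = 0) ?mulmx0 ?mul0mx //.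
by apply/matrixP => i j; rewrite dgE mxE h0; case: ifP.
Qed.

End Matrices.

(** * One-shot bounds on tests in eigenbasis coordinates *)

Section OneShot.
Variable R : realType.
Local Notation C := (R[i]).
Local Notation "x %:C" := (real_complex R x) (at level 1, format "x %:C").

Lemma gram_diag m n (B : 'M[C]_(m, n)) j :
  re ((B *m adj B) j j) = \sum_i nsq (B j i).
Proof.
by rewrite mxE re_sum; apply: eq_bigr => i _; rewrite adjE mulrC conjc_mul_nsq.
Qed.
Lemma gramC_diag m n (B : 'M[C]_(m, n)) i :
  re ((adj B *m B) i i) = \sum_j nsq (B j i).
Proof.
by rewrite mxE re_sum; apply: eq_bigr => j _; rewrite adjE conjc_mul_nsq.
Qed.

Lemma psd_conjC m n (B : 'M[C]_(n, m)) A : psd A -> psd (adj B *m A *m B).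
Proof. by move=> h; rewrite -{2}[B]adjK; exact: psd_conj. Qed.

Lemma psd_diag_le n (A B : 'M[C]_n) i : psd (B - A) -> re (A i i) <= re (B i i).
Proof. by move=> /(psd_diag i); rewrite !mxE reB subr_ge0. Qed.

Lemma test_sqr_le n (T : 'M[C]_n) : psd T -> psd (1%:M - T) -> psd (T - T *m T).
Proof.
move=> hT h1T; have hTa := psd_adj hT; have h1a := psd_adj h1T.
have -> : T - T *m T = T *m (1%:M - T) *m adj T
                       + (1%:M - T) *m T *m adj (1%:M - T).
  rewrite hTa h1a !(mulmxBl, mulmxBr) !mul1mx !mulmx1.
  move: (T *m T) (T *m T *m T) => a b.
  by apply/matrixP => i j; rewrite !mxE; ring.
by apply: psdD; exact: psd_conj.
Qed.

Lemma mulmx_polar n (A B X Y : 'M[C]_n) :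
  (A + B) *m (X + Y) + (A - B) *m (X - Y) =
  (A *m X + A *m X) + (B *m Y + B *m Y).
Proof.
rewrite mulmxDl mulmxBl !mulmxDr !mulmxN.
move: (A *m X) (A *m Y) (B *m X) (B *m Y) => a1 a2 a3 a4.
by apply/matrixP => u v; rewrite !mxE; ring.
Qed.

Let comb (u t x y X Y : R) : u * t <= u * (2 * y + 2 * x) ->
  u * x <= X -> u * y <= Y -> u * t <= 2 * X + 2 * Y.
Proof. lra. Qed.

Section Coordinates.
Variables (n : nat) (W : 'M[C]_n) (p q : 'I_n -> R).
Hypotheses (hW : unitary W) (hp : forall i, 0 <= p i) (hq : forall i, 0 <= q i).

(** With [W] the overlap matrix of the eigenbases of sigma and rho, and [T] written in the basis of
    sigma, this is the probability that [T] accepts the i-th eigenvector of rho. *)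
Definition tst (T : 'M[C]_n) i : R := re ((adj W *m T *m W) i i).

Lemma tst1B T i : tst (1%:M - T) i = 1 - tst T i.
Proof.
rewrite /tst mulmxBr mulmxBl mulmx1 unitaryC // mxE reD.
by rewrite [X in re X + _]mxE eqxx [X in _ + re X]mxE reN.
Qed.

Lemma tstD S T i : tst (S + T) i = tst S i + tst T i.
Proof. by rewrite /tst mulmxDr mulmxDl mxE reD. Qed.

Lemma tst_ge0 T i : psd T -> 0 <= tst T i.
Proof. by move=> hT; apply: psd_diag; exact: psd_conjC. Qed.

(** The parallelogram identity [mulmx_polar] writes 2 P T P + 2 Q T Q as T plus the positive matrix
    (P - Q) T (P - Q): dropping the off-diagonal blocks costs a factor two. *)
Lemma tst_split T P Q i : psd T -> adj P = P -> adj Q = Q -> P + Q = 1%:M ->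
  tst T i <= 2 * tst (P *m T *m P) i + 2 * tst (Q *m T *m Q) i.
Proof.
move=> hT hP hQ hPQ.
have hd : psd ((P - Q) *m T *m (P - Q)).
  by rewrite -{2}[P - Q]adjK adjB hP hQ; exact: psd_conj.
have hS : T + (P - Q) *m T *m (P - Q) =
    (P *m T *m P + P *m T *m P) + (Q *m T *m Q + Q *m T *m Q).
  rewrite -mulmx_polar -(mulmxDl P) -(mulmxBl P) hPQ mul1mx mulmx1.
  by congr (_ + _).
have := tst_ge0 i hd; have := congr1 (tst ^~ i) hS.
rewrite /= !tstD.
move: (tst T i) (tst ((P - Q) *m T *m (P - Q)) i) => t1 t2.
move: (tst (P *m T *m P) i) (tst (Q *m T *m Q) i) => t3 t4.
lra.
Qed.

Lemma sum_tst T : \sum_i tst T i = \sum_j re (T j j).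
Proof.
rewrite /tst -!re_sum -!/(mxtrace _).
by rewrite mxtrace_mulC mulmxA hW mul1mx.
Qed.

(** Each overlap splits as W = T W + (1 - T) W, whence the factor two. In the minimum, the first
    part is charged to c q and the second to p; T ^ 2 <= T then bounds the row sums of the first by
    T j j and the column sums of the second by 1 - tst T i. *)
Lemma coord_converse (T : 'M[C]_n) (c : R) : psd T -> psd (1%:M - T) -> 0 <= c ->
  (\sum_i \sum_j Num.min (p i) (c * q j) * nsq (W j i)) / 2 <=
  \sum_i p i * (1 - tst T i) + c * \sum_j q j * re (T j j).
Proof.
move=> hT h1T hc.
pose A := T *m W; pose B := (1%:M - T) *m W.
have hAB : A + B = W by rewrite /A /B -mulmxDl addrC subrK mul1mx.
have hTj j : \sum_i nsq (A j i) <= re (T j j).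
  rewrite -gram_diag /A adjM (psd_adj hT) mulmxA -(mulmxA T) hW mulmx1.
  exact/psd_diag_le/test_sqr_le.
have hTi i : \sum_j nsq (B j i) <= 1 - tst T i.
  rewrite -gramC_diag /B -tst1B /tst adjM (psd_adj h1T) mulmxA -(mulmxA (adj W)).
  apply: psd_diag_le; rewrite -mulmxBl -mulmxBr; apply: psd_conjC.
  apply: test_sqr_le; first exact: h1T.
  by rewrite opprB addrC subrK; exact: hT.
rewrite ler_pdivrMr // [X in _ <= X]mulrC mulrDr !mulr_sumr.
have -> : \sum_j 2 * (c * (q j * re (T j j))) =
          \sum_i 2 * (c * (q i * re (T i i))) by [].
apply: (@le_trans _ _ (\sum_i \sum_j 2 * (p i * nsq (B j i))
                       + \sum_j \sum_i 2 * (c * (q j * nsq (A j i))))).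
  rewrite [X in _ <= _ + X]exchange_big -big_split; apply: ler_sum => i _ /=.
  rewrite -big_split; apply: ler_sum => j _ /=.
  set m := Num.min _ _.
  have hm0 : 0 <= m by rewrite /m le_min hp mulr_ge0.
  have hm1 : m <= p i by rewrite /m ge_min lexx.
  have hm2 : m <= c * q j by rewrite /m ge_min lexx orbT.
  have hW2 : nsq (W j i) <= 2 * (nsq (A j i) + nsq (B j i)).
    by rewrite -hAB mxE; exact: nsqC_half.
  have h1 := ler_wpM2r (nsq_ge0 (B j i)) hm1.
  have h2 := ler_wpM2r (nsq_ge0 (A j i)) hm2.
  have h3 := ler_wpM2l hm0 hW2.
  lra.
apply: lerD; apply: ler_sum => i _; rewrite -!mulr_sumr.
  by do 2 (apply: ler_wpM2l => //).
by do 3 (apply: ler_wpM2l => //).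
Qed.

(* Eigenvectors with p-value in one level [h_l / kappa, h_l] are cut at a
   common threshold, so that their truncations to {c q >= h_l} contribute at most
   the trace of T on that subspace. *)
Lemma coord_strong (T : 'M[C]_n) (c kappa : R) L (lev : 'I_n -> 'I_L)
    (h : 'I_L -> R) :
  psd T -> psd (1%:M - T) -> 0 <= c -> (forall l, 0 <= h l) ->
  (forall i, 0 < p i -> p i <= h (lev i) <= kappa * p i) ->
  \sum_i p i * tst T i <= 2 * (L%:R * (c * \sum_j q j * re (T j j))) +
    2 * \sum_i \sum_(j | c * q j < kappa * p i) p i * nsq (W j i).
Proof.
move=> hT h1T hc hh hlev.
pose P (l : 'I_L) := dg (fun j : 'I_n => if c * q j < h l then 1 else 0 : R).
pose Q (l : 'I_L) := dg (fun j : 'I_n => if h l <= c * q j then 1 else 0 : R).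
have hPQ l : P l + Q l = 1%:M.
  rewrite dgD -dg1; apply: eq_dg => j; rewrite ltNge.
  by case: (h l <= _); rewrite ?addr0 ?add0r.
pose x l i := tst (Q l *m T *m Q l) i.
pose y l i := tst (P l *m T *m P l) i.
have adP l : adj (P l) = P l := adj_dg _.
have adQ l : adj (Q l) = Q l := adj_dg _.
have x0 l i : 0 <= x l i by apply: tst_ge0; rewrite -{2}adQ; exact: psd_conj.
(* The block below the threshold of the level is kept as a tail of overlaps; the block above it is
   charged to sigma, because h l <= c q there. *)
have split l i : tst T i <= 2 * y l i + 2 * x l i by exact: tst_split.
have ybd l i : y l i <= \sum_(j | c * q j < h l) nsq (W j i).
  apply: (@le_trans _ _ (tst (P l *m P l) i)).
    apply: psd_diag_le; rewrite -mulmxBl -mulmxBr.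
    apply: psd_conjC.
    rewrite -{1}[P l]mulmx1 -mulmxBl -mulmxBr -{2}adP; exact: psd_conj.
  rewrite /tst -{1}adP mulmxA -adjM -mulmxA gramC_diag [X in _ <= X]big_mkcond /=.
  apply: ler_sum => j _; rewrite mul_diag_mx !mxE nsqM.
  by case: (_ < _); rewrite ?nsq1 ?mul1r // nsq0 mul0r.
have xbd l : \sum_i h l * x l i <= c * \sum_j q j * re (T j j).
  rewrite -mulr_sumr sum_tst !mulr_sumr; apply: ler_sum => j _.
  rewrite mul_mx_diag mul_diag_mx !mxE.
  have hj := psd_diag j hT.
  rewrite mulrAC -rmorphM reZ mulrA.
  case: (leP (h l) (c * q j)) => hl /=; last by rewrite !mul0r mulr0 mul0r !mulr_ge0.
  by rewrite !mulr1 mulrA; apply: ler_wpM2r.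
have -> : L%:R * (c * \sum_j q j * re (T j j)) =
          \sum_(l < L) c * \sum_j q j * re (T j j).
  by rewrite sumr_const card_ord mulr_natl.
(* Each i needs only its own level; summing over all of them costs the factor [L]. *)
apply: (@le_trans _ _ (2 * \sum_l \sum_i h l * x l i +
   2 * \sum_i \sum_(j | c * q j < kappa * p i) p i * nsq (W j i))); last first.
  by rewrite lerD2r ler_pM2l //; apply: ler_sum => l _.
rewrite exchange_big !mulr_sumr -big_split; apply: ler_sum => i _ /=.
have := hp i; rewrite le_eqVlt => /orP[/eqP hi0|hi].
  rewrite -hi0 mul0r addr_ge0 // mulr_ge0 ?sumr_ge0 // => k _.
    by rewrite mulr_ge0.
  by rewrite mul0r.
have /andP[h1 h2] := hlev _ hi.
have hA : p i * x (lev i) i <= \sum_l h l * x l i.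
  rewrite (bigD1 (lev i)) //=.
  have : 0 <= \sum_(l | l != lev i) h l * x l i.
    by apply: sumr_ge0 => l _; rewrite mulr_ge0.
  have := ler_wpM2r (x0 (lev i) i) h1; lra.
have hB : p i * y (lev i) i <= \sum_(j | c * q j < kappa * p i) p i * nsq (W j i).
  rewrite -mulr_sumr ler_wpM2l //; apply: le_trans (ybd _ _) _.
  rewrite big_mkcond [X in _ <= X]big_mkcond /=; apply: ler_sum => j _.
  case: ifP => ha; case: ifP => hb //; rewrite ?nsq_ge0 //.
  by rewrite (lt_le_trans ha h2) in hb.
have hsp := ler_wpM2l (hp i) (split (lev i) i).
exact: comb hsp hA hB.
Qed.

(** Gram-Schmidt from the tail of [l], that is, in order of increasing [s]. A new vector then has
    the largest support so far, its component orthogonal to the earlier ones still lives on q <= s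
    x, and the normalised direction costs sigma at most s x. The clause on [Pi] says that the range
    of [S] is no larger than the span; it makes the projections of growing lists nested. *)
Lemma proj_span (I : eqType) (xi : I -> 'cV[C]_n) (s : I -> R) (l : seq I) :
  (forall x j, s x < q j -> xi x j 0 = 0) -> (forall x, 0 <= s x) ->
  sorted (fun x y => s y <= s x) l ->
  exists S : 'M[C]_n, [/\ S *m S = S, adj S = S,
    forall x, x \in l -> S *m xi x = xi x,
    forall Pi : 'M[C]_n, (forall x, x \in l -> Pi *m xi x = xi x) -> Pi *m S = S &
    (forall t, (forall x, x \in l -> s x <= t) ->
       forall j k, t < q j -> S j k = 0) /\
    \sum_j q j * re (S j j) <= \sum_(x <- l) s x].
Proof.
move=> hxi hs; elim: l => [_|x l IH].
  exists 0; split; rewrite ?mulmx0 ?adj0 //; first by move=> Pi _; rewrite mulmx0.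
  split=> [t _ j k _|]; first by rewrite mxE.
  by rewrite big_nil big1 // => j _; rewrite mxE mulr0.
rewrite /= => hpath.
have hle : {in l, forall y, s y <= s x}.
  move=> y hy; have tr : transitive (fun x y => s y <= s x).
    by move=> a b c h1 h2; exact: le_trans h2 h1.
  by have /allP/(_ y hy) := order_path_min tr hpath.
have [S [hSS hSa hSl hPi [hsup hsum]]] := IH (path_sorted hpath).
pose eta := xi x - S *m xi x.
have hSeta : S *m eta = 0 by rewrite mulmxBr mulmxA hSS subrr.
have hetaS : adj eta *m S = 0 by rewrite -{1}hSa -adjM hSeta adj0.
have hetax : adj eta *m xi x = adj eta *m eta.
  by rewrite {3}/eta mulmxBr mulmxA hetaS mul0mx subr0.
have heta_sup j : s x < q j -> eta j 0 = 0.
  move=> hj; rewrite mxE hxi // mxE add0r mxE big1 ?oppr0 // => k _.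
  by rewrite (hsup (s x)) ?mul0r.
pose nn := \sum_j nsq (eta j 0).
have hnn : adj eta *m eta = nn%:C%:M.
  apply/matrixP => a b; rewrite !ord1 mxE mxE eqxx mulr1n /nn rmorph_sum.
  by apply: eq_bigr => j _; rewrite adjE conjc_mul_nsq.
have nn_ge0 : 0 <= nn by apply: sumr_ge0 => j _; exact: nsq_ge0.
have [nn0|nn_neq0] := eqVneq nn 0.
  have eta0 : eta = 0.
    have hj := psumr_eq0P (fun j _ => nsq_ge0 (eta j 0)) nn0.
    apply/matrixP => j b; rewrite ord1 [RHS]mxE; have := hj j isT.
    move/eqP; rewrite nsqE paddr_eq0 ?sqr_ge0 // !sqrf_eq0.
    by case: (eta j 0) => u v /= /andP[/eqP -> /eqP ->].
  have hSx : S *m xi x = xi x by apply/esym/eqP; rewrite -subr_eq0 -/eta eta0.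
  exists S; split => //.
  - by move=> y; rewrite inE => /orP[/eqP ->|/hSl].
  - by move=> Pi h; apply: hPi => y hy; apply: h; rewrite inE hy orbT.
  - split; last by rewrite big_cons; apply: le_trans hsum _; rewrite lerDr.
    by move=> t ht; apply: hsup => y hy; apply: ht; rewrite inE hy orbT.
pose E := eta *m adj eta.
have hEE : E *m E = nn%:C *: E.
  by rewrite /E mulmxA -(mulmxA eta) hnn mul_mx_scalar -scalemxAl.
have nnC : nn^-1%:C * nn%:C = 1 :> C by rewrite -rmorphM mulVf.
exists (S + nn^-1%:C *: E); split.
- rewrite mulmxDl !mulmxDr -!scalemxAl -!scalemxAr hEE hSS.
  have -> : S *m E = 0 by rewrite mulmxA hSeta mul0mx.
  have -> : E *m S = 0 by rewrite -mulmxA hetaS mulmx0.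
  by rewrite !scaler0 addr0 add0r [X in _ *: X]scalerA nnC scale1r.
- by rewrite adjD adj_scale conjc_real hSa adjM adjK.
- move=> y; rewrite mulmxDl -scalemxAl -mulmxA inE => /orP[/eqP ->|hy].
    rewrite hetax hnn mul_mx_scalar scalerA nnC scale1r.
    by rewrite /eta addrC subrK.
  have -> : adj eta *m xi y = 0 by rewrite -(hSl y hy) mulmxA hetaS mul0mx.
  by rewrite mulmx0 scaler0 addr0 hSl.
- move=> Pi h; have hS : Pi *m S = S.
    by apply: hPi => y hy; apply: h; rewrite inE hy orbT.
  rewrite mulmxDr hS -scalemxAr mulmxA.
  suff -> : Pi *m eta = eta by [].
  by rewrite mulmxBr mulmxA hS h // mem_head.
- have hEjj j : re ((nn^-1%:C *: E) j j) = nn^-1 * nsq (eta j 0).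
    rewrite mxE reZ; congr (_ * _).
    by rewrite gram_diag big_ord1.
  split=> [t ht j k hj|].
    have hxt : s x <= t by apply: ht; rewrite mem_head.
    rewrite mxE (hsup t) ?add0r //; last first.
      by move=> y hy; apply: ht; rewrite inE hy orbT.
    by rewrite !mxE big1 ?mulr0 // => b _; rewrite ord1 heta_sup ?mul0r // (le_lt_trans hxt).
  rewrite big_cons addrC.
  under eq_bigr do rewrite mxE reD mulrDr hEjj.
  rewrite big_split /=; apply: lerD => //.
  have -> : s x = \sum_j s x * (nn^-1 * nsq (eta j 0)).
    by rewrite -mulr_sumr -mulr_sumr mulVf // mulr1.
  apply: ler_sum => j _; have [hj|hj] := leP (q j) (s x).
    by apply: ler_wpM2r => //; rewrite mulr_ge0 ?invr_ge0 ?nsq_ge0.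
  by rewrite heta_sup // nsq0 !mulr0.
Qed.

(* Li's test with thresholds c_0, ..., c_r taken jointly, which makes the tests
   nested. *)
Lemma coord_li (c : nat -> R) : (forall s, 0 < c s) -> \sum_i p i = 1 ->
  exists S : nat -> 'M[C]_n,
  [/\ forall r, S r *m S r = S r /\ adj (S r) = S r,
      forall r r', (r <= r')%N -> S r' *m S r = S r,
      forall r, \sum_i \sum_(j | c r * q j <= p i) p i * nsq (W j i) <=
                \sum_i p i * tst (S r) i &
      forall r, \sum_j q j * re (S r j j) <= \sum_(0 <= s < r.+1) (c s)^-1].
Proof.
move=> hc hp1.
pose xi (x : 'I_n * nat) : 'cV[C]_n :=
  \col_j (if c x.2 * q j <= p x.1 then W j x.1 else 0).
pose s (x : 'I_n * nat) := p x.1 / c x.2.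
have hs x : 0 <= s x by rewrite /s divr_ge0 // ltW.
have hxi x j : s x < q j -> xi x j 0 = 0.
  by rewrite /s ltr_pdivrMr // mxE mulrC ltNge => /negbTE ->.
pose en r := [seq (i, t) | i <- enum 'I_n, t <- iota 0 r.+1].
pose l r := sort (fun x y => s y <= s x) (en r).
have hl r : sorted (fun x y => s y <= s x) (l r).
  by apply: sort_sorted => x y; exact: le_total.
have hmem r i t : ((i, t) \in l r) = (t <= r)%N.
  rewrite mem_sort; apply/allpairsP/idP => [[[a b] [_ + [_ ->]]]|ht].
    by rewrite mem_iota.
  by exists (i, t); split; rewrite // ?mem_enum // mem_iota.
have /choice[S hS] r := proj_span hxi hs (hl r).
exists S; split.
- by move=> r; have [] := hS r.
- move=> r r' hr; have [_ _ _ h _] := hS r; apply: h => -[i t]; rewrite hmem => ht.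
  by have [_ _ h _ _] := hS r'; apply: h; rewrite hmem (leq_trans ht hr).
- move=> r; apply: ler_sum => i _; rewrite -mulr_sumr; apply: ler_wpM2l => //.
  have [hSS hSa hSl _ _] := hS r.
  have hSx : S r *m xi (i, r) = xi (i, r) by apply: hSl; rewrite hmem.
  (* The truncation xi is fixed by the projection S and orthogonal to the rest d of the eigenvector
     w, so 0 <= <d, S d> = <w, S w> - |xi|^2. *)
  pose w := col i W; pose d := w - xi (i, r).
  have hSpsd : psd (S r) by rewrite -hSS -{2}hSa; exact: psd_gram.
  have := psd_diag 0 (psd_conjC d hSpsd).
  have hwx : adj w *m xi (i, r) = adj (xi (i, r)) *m xi (i, r).
    apply/matrixP => a b; rewrite !mxE; apply: eq_bigr => j _.
    by rewrite !mxE; case: ifP; rewrite ?mulr0.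
  have hxw : adj (xi (i, r)) *m w = adj (xi (i, r)) *m xi (i, r).
    by rewrite -[LHS]adjK adjM adjK hwx adjM adjK.
  have hxS : adj (xi (i, r)) *m S r = adj (xi (i, r)).
    by rewrite -{1}hSa -adjM hSx.
  have -> : adj d *m S r *m d =
            adj w *m S r *m w - adj (xi (i, r)) *m xi (i, r).
    rewrite adjB mulmxBl !mulmxBr !mulmxBl hxS hxw -[adj w *m S r *m xi _]mulmxA hSx hwx.
    by rewrite -[RHS]subr0; congr (_ - _); exact: subrr.
  rewrite mxE reD [X in _ + re X]mxE reN subr_ge0 gramC_diag => hle.
  have -> : tst (S r) i = re ((adj w *m S r *m w) 0 0).
    rewrite /tst /w (_ : adj (col i W) = row i (adj W)); last first.
      by apply/matrixP => a b; rewrite !mxE.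
    rewrite -row_mul [in LHS]mxE [in RHS]mxE; congr (re _).
    by apply: eq_bigr => k _; rewrite [row _ _ _ _]mxE [col _ _ _ _]mxE.
  apply: le_trans hle; rewrite big_mkcond /=; apply: ler_sum => j _.
  by rewrite mxE /=; case: ifP; rewrite ?nsq0.
- move=> r; have [_ _ _ _ [_ h]] := hS r; apply: le_trans h _.
  rewrite (perm_big (en r)) ?perm_sort //= big_allpairs /=.
  rewrite exchange_big /= /index_iota subn0; rewrite le_eqVlt; apply/predU1l.
  apply: eq_bigr => t _; rewrite /s /= -mulr_suml.
  by rewrite big_enum hp1 mul1r.
Qed.

End Coordinates.
End OneShot.

(** * Nussbaum-Szkola distributions *)

Section NussbaumSzkola.
Variable R : realType.
Local Notation C := (R[i]).
Local Notation "x %:C" := (real_complex R x) (at level 1, format "x %:C").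

Lemma mxfun_eigdec n (f : R -> R) (A U : 'M[C]_n) p :
  eigdec A U p -> mxfun f A = U *m dg (fun i => f (p i)) *m adj U.
Proof.
move=> [hU hA]; rewrite /mxfun; case: pselect => [h|]; last first.
  case; exists (U, \row_i p i); split => //=; rewrite hA; congr (_ *m diag_mx _ *m _).
  by apply/rowP => i; rewrite !mxE.
case: (cid h) => -[V m] /= /specdecP[/= hV hm].
set mu := (m 0) in hm.
have -> : map_mx (fun t => (f t)%:C) m = \row_i (f (mu i))%:C.
  by apply/rowP => i; rewrite !mxE.
rewrite -[diag_mx _]/(dg (fun i => f (mu i))).
have key : dg (fun i => f (p i)) *m (adj U *m V) = (adj U *m V) *m dg (fun j => f (mu j)).
  apply/matrixP => i j; rewrite mul_diag_mx mul_mx_diag [LHS]mxE [RHS]mxE.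
  rewrite [X in X * _ = _]mxE [X in _ = _ * X]mxE mulrC.
  have [->|hne] := eqVneq ((adj U *m V) i j) 0; first by rewrite !mul0r.
  by rewrite (eigdec_overlap (conj hU hA) (conj hV hm) hne).
have := congr1 (fun M => U *m M *m adj V) key => /=.
rewrite !mulmxA hU mul1mx => <-.
by rewrite -!mulmxA hV mulmx1.
Qed.

(** Commuting matrices are made triangular by a common unitary, and a triangular Hermitian matrix is
    diagonal with real entries. *)
Lemma codiag n (A B : 'M[C]_n) : adj A = A -> adj B = B -> A *m B = B *m A ->
  exists U p q, eigdec A U p /\ eigdec B U q.
Proof.
move=> hA hB /cotrigonalization2[P hP /andP[tA tB]].
have hPu : P *m adj P = 1%:M.
  by rewrite -[RHS](unitarymxP hP); congr (_ *m _); apply/matrixP => i j; rewrite !mxE.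
have key X : adj X = X -> similar_trig P X ->
    X = adj P *m dg (fun i => re ((P *m X *m adj P) i i)) *m adj (adj P).
  move=> hX; rewrite /similar_to conjymx // => /is_trig_mxP ht.
  have hE : P *m X *m map_mx Num.conj P^T = P *m X *m adj P.
    by congr (_ *m _); apply/matrixP => i j; rewrite !mxE.
  rewrite hE in ht.
  have hH : adj (P *m X *m adj P) = P *m X *m adj P.
    by rewrite !adjM adjK hX mulmxA.
  rewrite adjK (_ : dg _ = P *m X *m adj P).
    by rewrite !mulmxA unitaryC // mul1mx -mulmxA unitaryC // mulmx1.
  apply/matrixP => i j; rewrite dgE; case: eqP => [<-|/eqP hij].
    have := congr1 (fun M => fun_of_matrix M i i) hH; rewrite /= adjE.
    by case: (_ i i) => u v [] /= /eqP; rewrite eq_sym -addr_eq0 -mulr2n mulrn_eq0 /= => /eqP ->.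
  have [hlt|hge] := ltnP i j; first by rewrite ht.
  rewrite -hH adjE ht ?conjc0 // ltn_neqAle hge andbT.
  by rewrite eq_sym.
exists (adj P), (fun i => re ((P *m A *m adj P) i i)),
  (fun i => re ((P *m B *m adj P) i i)).
by split; split; by [exact: unitary_adj | exact: key].
Qed.

(** [ns_supp] is the inclusion of supports in coordinates. Pairs with a zero eigenvalue get weight
    zero, so the default value ln 0 = 0 never contributes to the moments of the log-likelihood
    ratio. The bases are part of the data so that tensor powers can be given product bases. *)
Record nsdata n (rho sigma : 'M[C]_n) := NSData {
  nsU : 'M[C]_n; nsV : 'M[C]_n; nsp : 'I_n -> R; nsr : 'I_n -> R;
  ns_rho : eigdec rho nsU nsp;
  ns_sigma : eigdec sigma nsV nsr;
  nsp_ge0 : forall i, 0 <= nsp i;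
  nsr_ge0 : forall j, 0 <= nsr j;
  nsp_sum : \sum_i nsp i = 1;
  nsr_sum : \sum_j nsr j = 1;
  ns_supp : forall i j, nsr j = 0 -> nsp i * nsq ((adj nsV *m nsU) j i) = 0 }.

Section OnePair.
Variables (n : nat) (rho sigma : 'M[C]_n) (d : nsdata rho sigma).

(* nsw is the Nussbaum-Szkola distribution p_i |<v_j, u_i>|^2 on pairs of
   eigenvectors; under it the log-likelihood ratio nsy has mean relD and variance
   relV, also when rho and sigma do not commute. *)
Definition nsW := adj (nsV d) *m nsU d.
Definition nsw (x : 'I_n * 'I_n) : R := nsp d x.1 * nsq (nsW x.2 x.1).
Definition nsy (x : 'I_n * 'I_n) : R := ln (nsp d x.1) - ln (nsr d x.2).
Definition pr (E : pred R) : R := \sum_(x | E (nsy x)) nsw x.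
Definition mgf (u : R) : R := \sum_x nsw x * expR (u * nsy x).

Lemma nsW_unitary : unitary nsW.
Proof.
have [hU _] := ns_rho d; have [hV _] := ns_sigma d.
by apply: unitaryM => //; exact: unitary_adj.
Qed.

Lemma nsw_ge0 x : 0 <= nsw x.
Proof. by rewrite mulr_ge0 ?nsp_ge0 ?nsq_ge0. Qed.

Lemma nsw_sum : \sum_x nsw x = 1.
Proof.
rewrite -(pair_bigA _ (fun i j => nsw (i, j))) -(nsp_sum d) /=.
apply: eq_bigr => i _; rewrite /nsw /= -mulr_sumr unitary_col_nsq ?mulr1 //.
exact: nsW_unitary.
Qed.

Lemma nsw_pos x : nsw x != 0 -> 0 < nsp d x.1 /\ 0 < nsr d x.2.
Proof.
move=> hx; split; rewrite lt_neqAle ?nsp_ge0 ?nsr_ge0 andbT eq_sym.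
  by apply: contraNneq hx => h; rewrite /nsw h mul0r.
by apply: contraNneq hx => h; rewrite /nsw ns_supp.
Qed.

Lemma nsw_expR x : nsw x != 0 -> nsp d x.1 = expR (nsy x) * nsr d x.2.
Proof.
by move=> /nsw_pos[h1 h2]; rewrite /nsy expRB !lnK ?posrE // divfK // gt_eqF.
Qed.

Lemma ev_rho T : ev rho T = \sum_i nsp d i * tst nsW (adj (nsV d) *m T *m nsV d) i.
Proof.
have [hU hr] := ns_rho d; have [hV hs] := ns_sigma d.
rewrite (ev_eigdec _ hr); apply: eq_bigr => i _; congr (_ * re (fun_of_matrix _ _ _)).
rewrite /nsW adjM adjK !mulmxA -[adj (nsU d) *m nsV d *m adj _]mulmxA hV mulmx1.
by rewrite -[_ *m nsV d *m adj _]mulmxA hV mulmx1.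
Qed.

Lemma ev_sigma T : ev sigma T = \sum_j nsr d j * re ((adj (nsV d) *m T *m nsV d) j j).
Proof. by have [hV hs] := ns_sigma d; rewrite (ev_eigdec _ hs). Qed.

Let p1 := nsp_ge0 d.
Let q1 := nsr_ge0 d.

Lemma psd_1B_conj (T : 'M[C]_n) (V : 'M[C]_n) : unitary V -> psd (1%:M - T) ->
  psd (1%:M - adj V *m T *m V).
Proof.
move=> hV hT; rewrite -{1}(unitaryC hV) -{1}[adj V]mulmx1 -mulmxBl -mulmxBr.
exact: psd_conjC.
Qed.

(** Where the log-likelihood ratio is at most ln c, one has p <= c q, so the minimum in
    [coord_converse] gives the full Nussbaum-Szkola weight. *)
Lemma test_converse T (c : R) : psd T -> psd (1%:M - T) -> 0 < c ->
  pr (fun y => y <= ln c) / 2 <= 1 - ev rho T + c * ev sigma T.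
Proof.
move=> hT h1T hc; have [hV _] := ns_sigma d.
have hT' := psd_conjC (nsV d) hT; have h1T' := psd_1B_conj hV h1T.
have := coord_converse nsW_unitary p1 q1 hT' h1T' (ltW hc).
rewrite -ev_sigma; under [in X in _ <= X]eq_bigr do rewrite mulrBr mulr1.
rewrite sumrB (nsp_sum d) -ev_rho; apply: le_trans.
apply: ler_wpM2r; first by rewrite invr_ge0.
rewrite /pr pair_bigA big_mkcond /=; apply: ler_sum => x _.
have hm : 0 <= Num.min (nsp d x.1) (c * nsr d x.2).
  by rewrite le_min p1 mulr_ge0 // ltW.
have hm2 := mulr_ge0 hm (nsq_ge0 (nsW x.2 x.1)).
case: ifP => // hy; have [->//|hx] := eqVneq (nsw x) 0.
apply: ler_wpM2r; first exact: nsq_ge0.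
have [h1 h2] := nsw_pos hx.
rewrite le_min lexx (nsw_expR hx) /= ler_pM2r //.
by rewrite -[X in _ <= X](lnK hc) ler_expR.
Qed.

(** The levels are the integer parts of -ln p, with kappa = e: positive eigenvalues lie in
    [expR (- L), 1], which makes [L.+1] levels, and the factor kappa lowers the threshold by one. *)
Lemma test_strong T (c : R) (L : nat) : psd T -> psd (1%:M - T) -> 0 < c ->
  (forall i, 0 < nsp d i -> expR (- L%:R) <= nsp d i) ->
  ev rho T <= 2 * (L.+1%:R * (c * ev sigma T)) + 2 * pr (fun y => ln c - 1 < y).
Proof.
move=> hT h1T hc hL; have [hV _] := ns_sigma d.
have hT' := psd_conjC (nsV d) hT; have h1T' := psd_1B_conj hV h1T.
pose lev i : 'I_L.+1 := inord (Num.truncn (- ln (nsp d i))).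
pose h (l : 'I_L.+1) : R := expR (- l%:R).
have hh l : 0 <= h l by exact: expR_ge0.
have hlev i : 0 < nsp d i -> nsp d i <= h (lev i) <= expR 1 * nsp d i.
  move=> hi; have hi1 : nsp d i <= 1.
    rewrite -(nsp_sum d) (bigD1 i) //= lerDl; apply: sumr_ge0 => k _; exact: p1.
  have hln : 0 <= - ln (nsp d i) by rewrite oppr_ge0 ln_le0.
  have := truncn_itv hln; set t := Num.truncn _ => /andP[h1 h2].
  have hLi := hL _ hi; rewrite -[X in _ <= X](lnK hi) ler_expR in hLi.
  have ht : (t < L.+1)%N.
    by rewrite -(ltr_nat R) (le_lt_trans h1) // (le_lt_trans (_ : _ <= L%:R)) ?ltr_nat //; lra.
  have e : nsp d i = expR (ln (nsp d i)) by rewrite lnK.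
  rewrite -natr1 in h2; rewrite /h /lev -/t inordK //; apply/andP; split.
    by rewrite {1}e ler_expR; lra.
  by rewrite [X in _ * X]e -expRD ler_expR; lra.
have := coord_strong nsW_unitary p1 q1 hT' h1T' (ltW hc) hh hlev.
rewrite -ev_sigma -ev_rho => /le_trans; apply; rewrite lerD2l ler_pM2l //.
under eq_bigr do rewrite big_mkcond.
rewrite pair_bigA /pr [X in _ <= X]big_mkcond /=; apply: ler_sum => x _.
have hw := nsw_ge0 x.
case: ifP => hc1; last by case: ifP.
rewrite -/(nsw x); have [->//|hx] := eqVneq (nsw x) 0; first by case: ifP.
have [h1 h2] := nsw_pos hx.
rewrite (nsw_expR hx) mulrA -expRD ltr_pM2r // in hc1.
rewrite -{1}(lnK hc) ltr_expR in hc1.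
by rewrite ifT //; lra.
Qed.

Lemma nested_tests (c : nat -> R) : (forall s, 0 < c s) ->
  exists S : nat -> 'M[C]_n,
  [/\ forall r, psd (S r) /\ psd (1%:M - S r),
      forall r r', (r <= r')%N -> psd (S r' - S r),
      forall r, pr (fun y => ln (c r) <= y) <= ev rho (S r) &
      forall r, ev sigma (S r) <= \sum_(0 <= s < r.+1) (c s)^-1].
Proof.
move=> hc; have [hV _] := ns_sigma d.
have [S [hS1 hS2 hS3 hS4]] := coord_li nsW (nsr d) p1 hc (nsp_sum d).
have hpsd r : psd (S r).
  by have [hSS hSa] := hS1 r; rewrite -hSS -{2}hSa; exact: psd_gram.
have hcan T : adj (nsV d) *m (nsV d *m T *m adj (nsV d)) *m nsV d = T.
  by rewrite !mulmxA unitaryC // mul1mx -mulmxA unitaryC // mulmx1.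
exists (fun r => nsV d *m S r *m adj (nsV d)); split.
- move=> r; split; first exact: psd_conj.
  rewrite -{1}hV -{1}[nsV d]mulmx1 -mulmxBl -mulmxBr; apply: psd_conj.
  have [hSS hSa] := hS1 r.
  have -> : 1%:M - S r = (1%:M - S r) *m adj (1%:M - S r).
    rewrite adjB adj_id hSa mulmxBr mulmx1 mulmxBl mul1mx hSS.
    by rewrite subrr subr0.
  exact: psd_gram.
- move=> r r' hr; rewrite -mulmxBl -mulmxBr; apply: psd_conj.
  have h := hS2 _ _ hr; have [hSS hSa] := hS1 r; have [hSS' hSa'] := hS1 r'.
  have h' : S r *m S r' = S r by rewrite -[LHS]adjK adjM hSa hSa' h.
  have -> : S r' - S r = (S r' - S r) *m adj (S r' - S r).
    rewrite adjB hSa hSa' mulmxBr !mulmxBl hSS hSS' h h'.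
    by rewrite subrr subr0.
  exact: psd_gram.
- move=> r; rewrite ev_rho hcan; apply: le_trans (hS3 r).
  under [X in _ <= X]eq_bigr do rewrite big_mkcond.
  rewrite pair_bigA /pr big_mkcond /=; apply: ler_sum => x _.
  case: ifP => hy; last by case: ifP => // _; rewrite -/(nsw x) nsw_ge0.
  rewrite -/(nsw x); have [->//|hx] := eqVneq (nsw x) 0; first by case: ifP.
  have [h1 h2] := nsw_pos hx.
  rewrite ifT // (nsw_expR hx) ler_pM2r //.
  by rewrite -[X in X <= _](lnK (hc r)) ler_expR.
- by move=> r; rewrite ev_sigma hcan.
Qed.

Lemma relD_ns : relD rho sigma = \sum_x nsw x * nsy x.
Proof.
have [hU hr] := ns_rho d; have [hV hs] := ns_sigma d.
rewrite /relD /mxlog (mxfun_eigdec _ (ns_rho d)) (mxfun_eigdec _ (ns_sigma d)).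
rewrite -/(ev _ _) evBr !(ev_eigdec _ hr) -sumrB.
rewrite -(pair_bigA _ (fun i j => nsw (i, j) * nsy (i, j))) /=.
apply: eq_bigr => i _.
have -> : adj (nsU d) *m (nsU d *m dg (fun i => ln (nsp d i)) *m adj (nsU d)) *m nsU d
   = dg (fun i => ln (nsp d i)).
  by rewrite !mulmxA unitaryC // mul1mx -mulmxA unitaryC // mulmx1.
have -> : adj (nsU d) *m (nsV d *m dg (fun i => ln (nsr d i)) *m adj (nsV d)) *m nsU d
   = adj nsW *m dg (fun i => ln (nsr d i)) *m nsW.
  by rewrite /nsW adjM adjK !mulmxA.
rewrite dgE eqxx mxE re_sum /=.
under [in LHS]eq_bigr => j _.
  rewrite mul_mx_diag !mxE -mulrA [_%:C * _]mulrC mulrA conjc_mul_nsq mulrC reZ.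
  over.
under [in RHS]eq_bigr => j _ do rewrite /nsw /nsy /= mulrBr -!mulrA.
rewrite sumrB -!mulr_sumr -mulr_suml (unitary_col_nsq _ nsW_unitary) mul1r.
by congr (_ - _ * _); apply: eq_bigr => j _; rewrite mulrC /nsW mxE.
Qed.

(** The logarithms need not commute, but between the i-th eigenvector of rho and the j-th of sigma
    their difference has the matrix element ln p i - ln r j times the overlap; the second moment is
    therefore a sum over pairs. *)
Lemma relV_ns : relV rho sigma =
  \sum_x nsw x * nsy x ^+ 2 - (\sum_x nsw x * nsy x) ^+ 2.
Proof.
have [hU hr] := ns_rho d; have [hV hs] := ns_sigma d.
rewrite -relD_ns /relV; congr (_ - _).
rewrite /mxlog (mxfun_eigdec _ (ns_rho d)) (mxfun_eigdec _ (ns_sigma d)).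
set A := _ *m _ *m adj (nsU d); set B := _ *m _ *m adj (nsV d).
rewrite -/(ev _ _) (ev_eigdec _ hr).
rewrite -(pair_bigA _ (fun i j => nsw (i, j) * nsy (i, j) ^+ 2)) /=.
apply: eq_bigr => i _.
pose X := adj (nsU d) *m (A - B) *m nsV d.
have -> : adj (nsU d) *m ((A - B) *m (A - B)) *m nsU d = X *m adj X.
  rewrite /X !adjM adjK adjB.
  have -> : adj A = A by rewrite /A !adjM adjK adj_dg mulmxA.
  have -> : adj B = B by rewrite /B !adjM adjK adj_dg mulmxA.
  by rewrite !mulmxA -[_ *m nsV d *m adj _]mulmxA hV mulmx1.
rewrite gram_diag mulr_sumr; apply: eq_bigr => j _; rewrite /nsw /nsy /= -mulrA.
congr (_ * _).
have -> : X = dg (fun i => ln (nsp d i)) *m adj nsW - adj nsW *m dg (fun i => ln (nsr d i)).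
  rewrite /X mulmxBr mulmxBl /nsW adjM adjK; congr (_ - _).
    by rewrite /A !mulmxA (unitaryC hU) mul1mx.
  by rewrite /B !mulmxA -(mulmxA _ (adj (nsV d))) (unitaryC hV) mulmx1.
rewrite mul_diag_mx mul_mx_diag !mxE [X in _ - X]mulrC -mulrBl -rmorphB nsqM mulrC.
congr (_ * _); rewrite !nsqE /= ?oppr0.
  by rewrite -/(adj _) -/(nsU d); case: (\sum_ _ _) => u v /=; rewrite sqrrN.
by rewrite expr0n addr0.
Qed.

(** The mean of exp(-y) is at most one, hence D >= 0 by exp(-y) >= 1 - y. This inequality is strict
    for y != 0, so D = 0 would force y = 0 on the support and a vanishing variance. *)
Lemma relD_gt0 : 0 < relV rho sigma -> 0 < relD rho sigma.
Proof.
rewrite relV_ns relD_ns => hV; set D := \sum_x nsw x * nsy x in hV *.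
have h1 : \sum_x nsw x * expR (- nsy x) <= 1.
  have -> : 1 = \sum_(x : 'I_n * 'I_n) nsr d x.2 * nsq (nsW x.2 x.1).
    rewrite -(pair_bigA _ (fun i j => nsr d j * nsq (nsW j i))) exchange_big /=.
    rewrite -(nsr_sum d); apply: eq_bigr => j _.
    by rewrite -mulr_sumr (unitary_row_nsq _ nsW_unitary) mulr1.
  apply: ler_sum => x _; have [->|hx] := eqVneq (nsw x) 0.
    by rewrite mul0r mulr_ge0 ?q1 ?nsq_ge0.
  by rewrite {1}/nsw (nsw_expR hx) mulrC !mulrA -expRD addNr expR0 mul1r.
rewrite lt_neqAle; apply/andP; split; last first.
  suff : 1 - D <= 1 by lra.
  apply: le_trans h1; rewrite -{1}nsw_sum -sumrB; apply: ler_sum => x _.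
  rewrite -{1}[nsw x]mulr1 -mulrBr ler_wpM2l ?nsw_ge0 //.
  exact: expR_ge1Dx.
apply: contraTneq hV => hD; rewrite -leNgt -hD expr0n subr0.
have h2 x : 0 <= nsw x * (expR (- nsy x) - 1 + nsy x).
  rewrite mulr_ge0 ?nsw_ge0 //; have := expR_ge1Dx (- nsy x); lra.
have h3 : \sum_x nsw x * (expR (- nsy x) - 1 + nsy x) = 0.
  apply/eqP; rewrite eq_le sumr_ge0 // andbT.
  under eq_bigr do rewrite mulrDr mulrBr mulr1.
  by rewrite big_split sumrB /= -/D -hD nsw_sum addr0 subr_le0.
have h4 := psumr_eq0P (fun x _ => h2 x) h3.
rewrite big1 // => x _; have /eqP := h4 x isT; rewrite mulf_eq0 => /orP[/eqP ->|].
  by rewrite mul0r.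
move=> /eqP hx; have [->|hy] := eqVneq (nsy x) 0; first by rewrite expr0n mulr0.
have := expR_gt1Dx (_ : - nsy x != 0); rewrite oppr_eq0 => /(_ hy); lra.
Qed.

End OnePair.
End NussbaumSzkola.

(** * Tensor powers *)

Section Tensor.
Variable R : realType.
Local Notation C := (R[i]).
Local Notation "x %:C" := (real_complex R x) (at level 1, format "x %:C").

Lemma adj_tens m n p q (A : 'M[C]_(m, n)) (B : 'M[C]_(p, q)) :
  adj (A *t B) = adj A *t adj B.
Proof. by apply/matrixP => i j; rewrite !mxE rmorphM. Qed.

Lemma mxtens_unindex_inj m n : injective (@mxtens_unindex m n).
Proof. exact: can_inj (@mxtens_unindexK m n). Qed.

Lemma tens_dg m n (p : 'I_m -> R) (q : 'I_n -> R) :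
  dg p *t dg q = dg (fun i => p (mxtens_unindex i).1 * q (mxtens_unindex i).2).
Proof.
apply/matrixP => i j; rewrite mxE !dgE -rmorphM; congr (_%:C).
rewrite -(inj_eq (@mxtens_unindex_inj m n)).
case: (mxtens_unindex i) (mxtens_unindex j) => [a b] [c e] /=.
by rewrite xpair_eqE; case: eqP; case: eqP; rewrite ?mulr0 ?mul0r.
Qed.

Lemma tens1 m n : (1%:M : 'M[C]_m) *t (1%:M : 'M[C]_n) = 1%:M.
Proof. by rewrite -!dg1 tens_dg; apply: eq_dg => i; rewrite mulr1. Qed.

Lemma unitary_tens m n (U : 'M[C]_m) (V : 'M[C]_n) :
  unitary U -> unitary V -> unitary (U *t V).
Proof.
by move=> hU hV; rewrite /unitary adj_tens tensmx_mul hU hV tens1.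
Qed.

Lemma eigdec_tens m n (A U : 'M[C]_m) (B V : 'M[C]_n) p q :
  eigdec A U p -> eigdec B V q ->
  eigdec (A *t B) (U *t V)
    (fun i => p (mxtens_unindex i).1 * q (mxtens_unindex i).2).
Proof.
move=> [hU hA] [hV hB]; split; first exact: unitary_tens.
by rewrite -tens_dg adj_tens !tensmx_mul -hA -hB.
Qed.

(** The exponents of this floor for the positive eigenvalues add up under tensor products, so
    [test_strong] needs a number of levels only linear in the number of copies. *)
Definition nsmin n (rho sigma : 'M[C]_n) (d : nsdata rho sigma) (k : R) :=
  forall i, 0 < nsp d i -> expR (- k) <= nsp d i.

Lemma nsmin_exists n (rho sigma : 'M[C]_n) (d : nsdata rho sigma) :
  exists k : nat, nsmin d k%:R.
Proof.
exists (\sum_i (Num.truncn `|ln (nsp d i)|).+1)%N => i hi.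
rewrite -[X in _ <= X](lnK hi) ler_expR lerNl.
apply: le_trans (_ : (Num.truncn `|ln (nsp d i)|).+1%:R <= _); last first.
  by rewrite ler_nat (bigD1 i) //= leq_addr.
apply: le_trans (ltW (truncnS_gt _)).
by rewrite -normrN ler_norm.
Qed.

Section Product.
Variables (n1 n2 : nat) (rho1 sigma1 : 'M[C]_n1) (rho2 sigma2 : 'M[C]_n2).
Variables (d1 : nsdata rho1 sigma1) (d2 : nsdata rho2 sigma2).

Let W_tens i j :
  (adj (nsV d1 *t nsV d2) *m (nsU d1 *t nsU d2)) j i =
  nsW d1 (mxtens_unindex j).1 (mxtens_unindex i).1 *
  nsW d2 (mxtens_unindex j).2 (mxtens_unindex i).2.
Proof. by rewrite adj_tens tensmx_mul mxE. Qed.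

Lemma nsdata_tens_supp i j :
  nsr d1 (mxtens_unindex j).1 * nsr d2 (mxtens_unindex j).2 = 0 ->
  nsp d1 (mxtens_unindex i).1 * nsp d2 (mxtens_unindex i).2 *
  nsq ((adj (nsV d1 *t nsV d2) *m (nsU d1 *t nsU d2)) j i) = 0.
Proof.
rewrite W_tens nsqM mulrACA => /eqP; rewrite mulf_eq0 => /orP[]/eqP h.
  by rewrite ns_supp // mul0r.
by rewrite [X in _ * X]ns_supp // mulr0.
Qed.

Definition nsdata_tens : nsdata (rho1 *t rho2) (sigma1 *t sigma2).
Proof.
refine (NSData (eigdec_tens (ns_rho d1) (ns_rho d2))
               (eigdec_tens (ns_sigma d1) (ns_sigma d2)) _ _ _ _ nsdata_tens_supp).
- by move=> i; rewrite mulr_ge0 ?nsp_ge0.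
- by move=> i; rewrite mulr_ge0 ?nsr_ge0.
- by rewrite -mulr_sum !nsp_sum mulr1.
- by rewrite -mulr_sum !nsr_sum mulr1.
Defined.

Lemma mgf_tens u : mgf nsdata_tens u = mgf d1 u * mgf d2 u.
Proof.
rewrite /mgf big_distrlr pair_bigA /=.
pose h (x : 'I_(n1 * n2) * 'I_(n1 * n2)) :=
  (((mxtens_unindex x.1).1, (mxtens_unindex x.2).1),
   ((mxtens_unindex x.1).2, (mxtens_unindex x.2).2)).
pose g (y : ('I_n1 * 'I_n1) * ('I_n2 * 'I_n2)) :=
  (mxtens_index (y.1.1, y.2.1), mxtens_index (y.1.2, y.2.2)).
rewrite [RHS](reindex h); last first.
  exists g => [[i j] _|[[a b] [c e]] _].
    by congr (_, _); exact: mxtens_unindexK.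
  by rewrite /h /g !mxtens_indexK.
apply: eq_bigr => -[i j] _; set x1 := (h _).1; set x2 := (h _).2.
have hw : nsw nsdata_tens (i, j) = nsw d1 x1 * nsw d2 x2.
  by rewrite [RHS]mulrACA -nsqM -W_tens.
(* The logarithm of a product splits only for positive factors, so pairs of weight zero are treated
   apart. *)
have [h0|hne] := eqVneq (nsw nsdata_tens (i, j)) 0.
  by rewrite h0 mul0r [RHS]mulrACA -hw h0 mul0r.
have := hne; rewrite hw mulf_eq0 negb_or => /andP[hw1 hw2].
have [p1 q1] := nsw_pos hw1; have [p2 q2] := nsw_pos hw2.
rewrite [RHS]mulrACA -hw -expRD -mulrDr; congr (_ * expR (_ * _)).
have -> : nsy nsdata_tens (i, j) =
  ln (nsp d1 x1.1 * nsp d2 x2.1) - ln (nsr d1 x1.2 * nsr d2 x2.2) by [].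
rewrite /nsy !lnM ?posrE //; ring.
Qed.

Lemma nsmin_tens k1 k2 : nsmin d1 k1 -> nsmin d2 k2 -> nsmin nsdata_tens (k1 + k2).
Proof.
move=> h1 h2 i /=; set a := nsp d1 _; set b := nsp d2 _ => hab.
have a0 : 0 <= a := nsp_ge0 d1 _; have b0 : 0 <= b := nsp_ge0 d2 _.
have ha : 0 < a by rewrite lt_neqAle a0 andbT; apply: contraTneq hab => <-; rewrite mul0r ltxx.
have hb : 0 < b by rewrite lt_neqAle b0 andbT; apply: contraTneq hab => <-; rewrite mulr0 ltxx.
by rewrite opprD expRD ler_pM ?expR_ge0 ?h1 ?h2.
Qed.

End Product.

Lemma eigdec1 n : eigdec (1%:M : 'M[C]_n) 1%:M (fun=> 1).
Proof. by split; rewrite /unitary ?dg1 ?adj_id ?mulmx1. Qed.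

Definition nsdata1 : nsdata (1%:M : 'M[C]_1) 1%:M.
Proof.
refine (NSData (eigdec1 1) (eigdec1 1) _ _ _ _ _) => //; rewrite ?big_ord1 //.
by move=> i j /eqP; rewrite oner_eq0.
Defined.

Lemma mgf1 u : mgf nsdata1 u = 1.
Proof.
have hy x : nsy nsdata1 x = 0 by exact: subrr.
rewrite /mgf; under eq_bigr do rewrite hy mulr0 expR0 mulr1.
exact: nsw_sum.
Qed.

Lemma nsdata_pow n (rho sigma : 'M[C]_n) (d : nsdata rho sigma) k : nsmin d k ->
  forall m, exists dm : nsdata (rho ^t m) (sigma ^t m),
  [/\ forall u, mgf dm u = mgf d u ^+ m, nsmin dm (m%:R * k) &
      nsU d = nsV d -> nsU dm = nsV dm].
Proof.
(* The zeroth power is the one-dimensional identity and the first power is the matrix itself, so the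
   induction starts at one copy. *)
move=> hk; case=> [|m].
  exists nsdata1; split => //; first by move=> u; rewrite mgf1.
  by move=> i _ /=; rewrite mul0r oppr0 expR0.
elim: m => [|m [dm [h1 h2 h3]]].
  by exists d; split => //; rewrite mul1r.
exists (nsdata_tens d dm); split.
- by move=> u; rewrite mgf_tens h1 [RHS]exprS.
- have -> : m.+2%:R * k = k + m.+1%:R * k by rewrite -[m.+2%:R]natr1 mulrDl mul1r addrC.
  exact: nsmin_tens.
- by move=> h; rewrite /= h h3.
Qed.

Lemma density_eig_sum n (A U : 'M[C]_n) p : density A -> eigdec A U p ->
  \sum_i p i = 1.
Proof.
move=> [_ htr] [hU hA]; have := congr1 (fun z => re z) htr.
by rewrite hA mxtrace_mulC mulmxA (unitaryC hU) mul1mx re_tr_dg.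
Qed.

Lemma psd_eig_ge0 n (A U : 'M[C]_n) p : psd A -> eigdec A U p -> forall i, 0 <= p i.
Proof.
move=> hA [hU hE] i; have := psd_diag i (psd_conjC U hA).
by rewrite hE !mulmxA (unitaryC hU) mul1mx -mulmxA (unitaryC hU) mulmx1 dgE eqxx.
Qed.

Lemma nsdata_of n (rho sigma U V : 'M[C]_n) p q : density rho -> density sigma ->
  (forall v : 'cV[C]_n, sigma *m v = 0 -> rho *m v = 0) ->
  eigdec rho U p -> eigdec sigma V q ->
  exists d : nsdata rho sigma, nsU d = U /\ nsV d = V.
Proof.
move=> hr hs hsupp er es.
have supp i j : q j = 0 -> p i * nsq ((adj V *m U) j i) = 0.
  move=> hq; have [hU hrE] := er; have [hV hsE] := es.
  have h0 : rho *m (V *m delta_mx j 0) = 0 :> 'cV_n.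
    apply: hsupp; rewrite hsE -!mulmxA (mulmxA (adj V)) (unitaryC hV) mul1mx.
    rewrite (_ : dg q *m delta_mx j 0 = 0) ?mulmx0 //.
    apply/matrixP => a b; rewrite mul_diag_mx !mxE.
    by case: eqP => [->|_]; rewrite ?hq ?mul0r //= mulr0.
  have h1 : dg p *m adj (adj V *m U) *m delta_mx j 0 = 0 :> 'cV_n.
    have := congr1 (mulmx (adj U)) h0; rewrite mulmx0 => <-.
    by rewrite hrE adjM adjK !mulmxA (unitaryC hU) mul1mx.
  have := congr1 (fun M : 'cV_n => nsq (M i 0)) h1.
  rewrite [X in _ = nsq X]mxE nsq0 -colE [X in nsq X]mxE mul_diag_mx.
  rewrite [X in nsq X]mxE [X in nsq (X * _)]mxE adjE nsqM.
  have -> : nsq (conjc ((adj V *m U) j i)) = nsq ((adj V *m U) j i).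
    by rewrite !nsqE; case: (_ j i) => a b /=; rewrite sqrrN.
  by move/eqP; rewrite mulf_eq0 nsqE /= expr0n addr0 sqrf_eq0 => /orP[]/eqP ->;
    rewrite ?mul0r ?mulr0.
by exists (NSData er es (psd_eig_ge0 hr.1 er) (psd_eig_ge0 hs.1 es)
  (density_eig_sum hr er) (density_eig_sum hs es) supp).
Qed.

Lemma nsdata_exists n (rho sigma : 'M[C]_n) : density rho -> density sigma ->
  (forall v : 'cV[C]_n, sigma *m v = 0 -> rho *m v = 0) ->
  inhabited (nsdata rho sigma).
Proof.
move=> hr hs hsupp; have [hr1 hs1] := (hr.1, hs.1).
have [U [p er]] := eigdec_exists (esym (psd_adj hr1)).
have [V [q es]] := eigdec_exists (esym (psd_adj hs1)).
by have [d _] := nsdata_of hr hs hsupp er es; split.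
Qed.

Lemma nsdata_comm n (rho sigma : 'M[C]_n) : density rho -> density sigma ->
  (forall v : 'cV[C]_n, sigma *m v = 0 -> rho *m v = 0) ->
  rho *m sigma = sigma *m rho ->
  exists d : nsdata rho sigma, nsU d = nsV d.
Proof.
move=> hr hs hsupp hc.
have [U [p [q [er es]]]] := codiag (psd_adj hr.1) (psd_adj hs.1) hc.
by have [d [h1 h2]] := nsdata_of hr hs hsupp er es; exists d; rewrite h1 h2.
Qed.

End Tensor.

(** * Moment generating functions *)

Section Moderate.
Variable R : realType.

(** The mean value theorem, used twice from 0, reduces the remainder to |exp c - 1| <= 2 |c|. *)
Lemma expR_taylor2 (x : R) : `|x| <= 2^-1 ->
  `|expR x - (1 + x + x ^+ 2 / 2)| <= 2 * `|x| ^+ 3.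
Proof.
move=> hx.
have hx' : - 2^-1 <= x <= 2^-1 by rewrite -ler_norml.
have hg (c : R) : `|c| <= `|x| -> `|expR c - 1| <= 2 * `|x|.
  move=> hc; have hc' : `|c| <= 2^-1 := le_trans hc hx.
  apply: le_trans (_ : 2 * `|c| <= _); last by rewrite ler_pM2l.
  have h1 := expR_ge1Dx c; have h2 := expR_ge1Dx (- c).
  have h3 : expR c * expR (- c) = 1 by rewrite -expRD subrr expR0.
  have h4 := expR_gt0 c; have h5 := expR_gt0 (- c).
  move: hc'; rewrite ler_norml => /andP[hc1 hc2].
  rewrite ler_norml; have [c0|c0] := ger0P c; apply/andP; split; nra.
have D1 (y : R) : is_derive y (1 : R) (fun t : R => expR t - (1 + t)) (expR y - 1).
  by apply: is_derive_eq; rewrite ?add0r.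
have D2 (y : R) : is_derive y (1 : R) (fun t : R => expR t - (1 + t + t ^+ 2 / 2)) (expR y - (1 + y)).
  by apply: is_derive_eq; rewrite /GRing.scale /= ?mulr0 ?addr0 ?add0r; field.
have mvt (f df : R -> R) (b : R) : (forall y : R, is_derive y (1 : R) f (df y)) -> f 0 = 0 ->
    exists2 c, `|c| <= `|b| & `|f b| = `|df c| * `|b|.
  move=> hD f0.
  have hcont : continuous f.
    by move=> t; apply/differentiable_continuous/derivable1_diffP; have [] := hD t.
  have [b0|b0] := leP 0 b.
    have [c hc1 hc2] := MVT_segment b0 (fun y _ => hD y) (continuous_subspaceT hcont).
    exists c; last by rewrite -normrM -[b in RHS]subr0 -hc2 f0 subr0.
    move: hc1; rewrite in_itv /= => /andP[c0 cb].
    by rewrite !ger0_norm.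
  have [c hc1 hc2] := MVT_segment (ltW b0) (fun y _ => hD y) (continuous_subspaceT hcont).
  exists c; last by rewrite -normrM -normrN -[RHS]normrN -mulrN -[- b]sub0r -hc2 f0 sub0r.
  move: hc1; rewrite in_itv /= => /andP[c0 cb].
  by rewrite !ler0_norm ?lerN2 // ltW.
have e2 : expR 0 - (1 + 0 + 0 ^+ 2 / 2) = 0 :> R by rewrite expR0; ring.
have e1 : expR 0 - (1 + 0) = 0 :> R by rewrite expR0; ring.
have [c hc ->] := mvt _ _ x D2 e2.
have [c2 hc2 ->] := mvt _ _ c D1 e1.
rewrite exprSr expr2 !mulrA; apply: ler_wpM2r => //.
apply: ler_pM => //; apply: hg; exact: le_trans hc2 hc.
Qed.

Definition mom (I : finType) (P X : I -> R) (t : R) : R :=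
  \sum_x P x * expR (t * X x).

Section OneSpace.
Variables (I : finType) (P X : I -> R).
Hypotheses (P0 : forall x, 0 <= P x) (P1 : \sum_x P x = 1).

(* Applied with W the weights of an exponentially tilted measure. *)
Lemma tilted_tail (W : I -> R) (E : pred I) (t z : R) :
  (forall x, 0 <= W x) -> (forall x, E x -> 0 <= t * (X x - z)) ->
  \sum_(x | E x) W x <= expR (- (t * z)) * \sum_x W x * expR (t * X x).
Proof.
move=> W0 hE; rewrite mulr_sumr big_mkcond /=; apply: ler_sum => x _.
rewrite mulrCA -expRD; case: ifP => [/hE h|_].
  rewrite -[X in X <= _]mulr1; apply: ler_wpM2l => //.
  by rewrite -expR0 ler_expR; move: h; rewrite mulrBr addrC.
by rewrite mulr_ge0 // expR_ge0.
Qed.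

Lemma mom_local (D V : R) : \sum_x P x * X x = D ->
  \sum_x P x * X x ^+ 2 - D ^+ 2 = V -> 0 < V ->
  forall eta, 0 < eta -> exists2 u0, 0 < u0 & forall u, `|u| <= u0 ->
    expR (u ^+ 2 * (V / 2 - eta)) <= mom P X u * expR (- (u * D))
      <= expR (u ^+ 2 * (V / 2 + eta)).
Proof.
move=> hD hV V0.
(* For eta <= V / 2 the exponent of the lower bound is nonnegative, as the final comparison of the
   exponential with a polynomial requires. *)
suff H eta : 0 < eta -> eta <= V / 2 -> exists2 u0, 0 < u0 & forall u, `|u| <= u0 ->
    expR (u ^+ 2 * (V / 2 - eta)) <= mom P X u * expR (- (u * D))
      <= expR (u ^+ 2 * (V / 2 + eta)).
  move=> eta eta0; have [||u0 u00 hu0] := H (Num.min eta (V / 2)).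
  - by rewrite lt_min eta0 divr_gt0.
  - by rewrite ge_min lexx orbT.
  exists u0 => // u /hu0/andP[h1 h2].
  have hm : Num.min eta (V / 2) <= eta by rewrite ge_min lexx.
  apply/andP; split; [apply: le_trans h1|apply: le_trans h2 _];
    rewrite ler_expR ler_wpM2l ?sqr_ge0 //; lra.
move=> eta0 etaV.
pose c x := X x - D.
pose B := \sum_x `|c x| + 1.
have B1 : 1 <= B by rewrite /B lerDr sumr_ge0.
have hcB x : `|c x| <= B.
  rewrite /B (bigD1 x) //= -addrA lerDl addr_ge0 // sumr_ge0 //.
have mE u : mom P X u * expR (- (u * D)) = \sum_x P x * expR (u * c x).
  rewrite /mom mulr_suml; apply: eq_bigr => x _.
  by rewrite -mulrA -expRD /c mulrBr.
have c1 : \sum_x P x * c x = 0.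
  under eq_bigr do rewrite mulrBr.
  by rewrite sumrB hD -mulr_suml P1 mul1r subrr.
have c2 : \sum_x P x * c x ^+ 2 = V.
  transitivity (\sum_x (P x * X x ^+ 2 - 2 * D * (P x * X x) + D ^+ 2 * P x)).
    by apply: eq_bigr => x _; rewrite /c; ring.
  rewrite big_split sumrB /= -!mulr_sumr hD P1 -hV; ring.
pose K := 2 * B ^+ 3.
have K0 : 0 < K by rewrite mulr_gt0 // exprn_gt0 //; lra.
(* The four bounds serve in turn: u c x stays in the range of [expR_taylor2]; the cubic remainder is
   at most u ^ 2 eta / 2; the exponent z below is at most 1/2; its error 2 z ^ 2 is at most u ^ 2
   eta / 2. *)
pose u0 := Num.min (Num.min (2^-1 / B) (eta / (2 * K)))
                   (Num.min (1 / (V + 1)) (eta / (V + 1) ^+ 2)).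
have V1 : 0 < V + 1 by lra.
have V2 : 0 < (V + 1) ^+ 2 by rewrite exprn_gt0.
have B0 : 0 < B by lra.
exists u0.
  by rewrite !lt_min !divr_gt0 ?mulr_gt0.
move=> u; rewrite !le_min => /andP[/andP[h1 h2] /andP[h3 h5]].
have hu := normr_ge0 u.
rewrite ler_pdivlMr // in h1.
rewrite ler_pdivlMr ?mulr_gt0 // in h2.
rewrite ler_pdivlMr // in h3.
rewrite ler_pdivlMr // in h5.
have main : `|mom P X u * expR (- (u * D)) - (1 + u ^+ 2 * V / 2)| <= K * `|u| ^+ 3.
  rewrite mE.
  have -> : \sum_x P x * expR (u * c x) - (1 + u ^+ 2 * V / 2) =
      \sum_x P x * (expR (u * c x) - (1 + u * c x + (u * c x) ^+ 2 / 2)).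
    transitivity (\sum_x (P x * expR (u * c x) -
       (P x + u * (P x * c x) + u ^+ 2 / 2 * (P x * c x ^+ 2)))); last first.
      by apply: eq_bigr => x _; field.
    rewrite sumrB !big_split /= -!mulr_sumr P1 c1 c2; by field.
  apply: le_trans (ler_norm_sum _ _ _) _.
  have -> : K * `|u| ^+ 3 = \sum_x P x * (K * `|u| ^+ 3).
    by rewrite -mulr_suml P1 mul1r.
  apply: ler_sum => x _.
  rewrite normrM ger0_norm //; apply: ler_wpM2l => //.
  have hcu : `|u * c x| <= `|u| * B by rewrite normrM ler_wpM2l.
  apply: le_trans (expR_taylor2 (le_trans hcu h1)) _.
  have -> : K * `|u| ^+ 3 = 2 * (`|u| * B) ^+ 3 by rewrite /K; ring.
  by rewrite ler_pM2l //; apply: lerXn2r; rewrite // nnegrE mulr_ge0 // ltW.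
have u2 : u ^+ 2 = `|u| ^+ 2 by rewrite real_normK // num_real.
move: main; rewrite u2 ler_norml => /andP[m1 m2].
set a := `|u| in hu h1 h2 h3 h5 m1 m2 *.
set m := mom _ _ _ * _ in m1 m2 *.
have a3 : K * a ^+ 3 <= a ^+ 2 * (eta / 2).
  rewrite exprSr mulrCA; apply: ler_wpM2l; first exact: sqr_ge0.
  rewrite ler_pdivlMr //; apply: le_trans h2; rewrite le_eqVlt; apply/predU1l.
  by ring.
have a1 : a <= 1 by nra.
have y0 : 0 <= a ^+ 2 by exact: sqr_ge0.
have ya : a ^+ 2 <= a by rewrite expr2 -[X in _ <= X]mulr1; apply: ler_wpM2l.
move: a3 y0 ya m1 m2; move: (a ^+ 2) (K * a ^+ 3) => y k3 a3 y0 ya m1 m2.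
apply/andP; split; last first.
  apply: le_trans (expR_ge1Dx _); nra.
have yV : y * (V + 1) <= 1 by nra.
have hyV : y * (V + 1) ^+ 2 <= eta by nra.
set z := y * (V / 2 - eta).
have z0 : 0 <= z by rewrite mulr_ge0 // subr_ge0.
have zh : z <= 2^-1 by rewrite /z; nra.
have zz : 2 * z ^+ 2 <= y * (eta / 2).
  have hA : (V / 2 - eta) ^+ 2 <= (V + 1) ^+ 2 / 4 by nra.
  have : y * (V / 2 - eta) ^+ 2 <= eta / 4.
    by have := ler_wpM2l y0 hA; lra.
  move=> h; have := ler_wpM2l y0 h; rewrite /z exprMn expr2; lra.
(* exp z <= 1 / (1 - z) <= 1 + z + 2 z^2 *)
have h6 := expR_ge1Dx (- z).
have h7 : expR z * expR (- z) = 1 by rewrite -expRD subrr expR0.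
have h8 := expR_gt0 z.
have h9 : expR z <= 1 + z + 2 * z ^+ 2 by nra.
apply: le_trans h9 _; rewrite {1}/z; lra.
Qed.

End OneSpace.
End Moderate.

(** * Moderate deviations *)

Lemma near_and (A B : nat -> Prop) : (\forall n \near \oo, A n) ->
  (\forall n \near \oo, B n) -> \forall n \near \oo, A n /\ B n.
Proof. exact: filterI. Qed.

Section Mdev.
Variable R : realType.

Let if3_ge (b1 b2 b3 : bool) (w : R) : 0 <= w -> [|| b1, b2 | b3] ->
  w <= (if b1 then w else 0) + ((if b2 then w else 0) + (if b3 then w else 0)).
Proof. by move=> w0; case: b1; case: b2; case: b3 => //= _; lra. Qed.

(* The Gartner-Ellis hypothesis at speed L, with the Gaussian limit of variance s. *)
Definition mdev (I : nat -> finType) (P X : forall n, I n -> R) (L : nat -> R) (s : R) :=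
  forall v eta, 0 < eta -> \forall n \near \oo,
    expR (L n * (v ^+ 2 * s / 2 - eta)) <= mom (P n) (X n) (v * L n)
      <= expR (L n * (v ^+ 2 * s / 2 + eta)).

Lemma mdevN (I : nat -> finType) (P X : forall n, I n -> R) L s :
  mdev P X L s -> mdev P (fun n x => - X n x) L s.
Proof.
move=> h v eta eta0; apply: filterS (h (- v) eta eta0) => n.
rewrite sqrrN (_ : mom _ _ (- v * L n) = mom (P n) (fun x => - X n x) (v * L n)) //.
by apply: eq_bigr => x _; rewrite mulrN !mulNr.
Qed.

(** Chernoff's bound at the optimal parameter z / s. *)
Lemma md_upper (I : nat -> finType) (P X : forall n, I n -> R) L s z eta :
  (forall n x, 0 <= P n x) -> (forall A : R, \forall n \near \oo, A <= L n) ->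
  mdev P X L s -> 0 < s -> 0 <= z -> 0 < eta -> \forall n \near \oo,
  \sum_(x | z <= X n x) P n x <= expR (- (L n * (z ^+ 2 / (2 * s) - eta))).
Proof.
move=> P0 hL hM s0 z0 eta0; apply: filterS2 (hL 0) (hM (z / s) eta eta0) => n L0 /andP[_ hm].
have ht x : z <= X n x -> 0 <= z / s * L n * (X n x - z).
  by move=> hx; rewrite mulr_ge0 ?subr_ge0 // mulr_ge0 // divr_ge0 // ltW.
apply: le_trans (tilted_tail (P0 n) ht) _.
apply: le_trans (ler_wpM2l (expR_ge0 _) hm) _.
rewrite -expRD ler_expR le_eqVlt; apply/predU1l; field.
by rewrite gt_eqF.
Qed.

(** Tilting by v = z / s centres the distribution at z. The tilted tails beyond z - delta and z +
    delta are bounded by a further tilt of size delta / s, so enough mass stays in the window; there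
    the tilt is undone at a cost of |v| delta in the exponent. *)
Lemma md_lower (I : nat -> finType) (P X : forall n, I n -> R) L s z z1 z2 eta :
  (forall n x, 0 <= P n x) -> (forall A : R, \forall n \near \oo, A <= L n) ->
  mdev P X L s -> 0 < s -> z1 < z < z2 -> 0 < eta -> \forall n \near \oo,
  expR (- (L n * (z ^+ 2 / (2 * s) + eta))) <=
  \sum_(x | (z1 < X n x) && (X n x < z2)) P n x.
Proof.
move=> P0 hL hM s0 /andP[hz1 hz2] eta0.
(* The window must lie in (z1, z2), and undoing the tilt may cost at most eta / 2. *)
pose delta := Num.min (Num.min (z - z1) (z2 - z)) (eta * s / (2 * (`|z| + 1))).
have zz : 0 < `|z| + 1 by rewrite ltr_wpDl.
have d0 : 0 < delta.
  by rewrite !lt_min !subr_gt0 hz1 hz2 divr_gt0 // mulr_gt0.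
have [d1 d2 d3] : [/\ delta <= z - z1, delta <= z2 - z &
    delta <= eta * s / (2 * (`|z| + 1))].
  by rewrite /delta; split; rewrite !ge_min lexx ?orbT.
pose v := z / s; pose r := delta / s.
have r0 : 0 < r by rewrite divr_gt0.
(* The further tilt gains delta ^ 2 / (2 s) in the exponent; two errors e' leave at least half of
   it, enough for a factor 1/4. *)
pose e' := Num.min (delta ^+ 2 / (8 * s)) (eta / 4).
have e'0 : 0 < e' by rewrite lt_min !divr_gt0 // ?mulr_gt0 // exprn_gt0.
have [e1 e2] : e' <= delta ^+ 2 / (8 * s) /\ e' <= eta / 4.
  by rewrite /e'; split; rewrite !ge_min lexx ?orbT.
have hA := hL (4 * ln 4 * s / delta ^+ 2); have hA2 := hL (4 * ln 2 / eta).
apply: filterS (near_and (near_and hA (near_and hA2 (hL 0)))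
  (near_and (hM v e' e'0) (near_and (hM (v + r) e' e'0) (hM (v - r) e' e'0)))).
move=> n [[L1 [L2 L0]] [/andP[m1 _] [/andP[_ m2] /andP[_ m3]]]].
pose W x := P n x * expR (v * L n * X n x).
have W0 x : 0 <= W x by rewrite mulr_ge0 // expR_ge0.
have tailE t (w := v + t) z' : expR (- (t * L n * z')) * mom (P n) (X n) (w * L n) =
    expR (- (t * L n * z')) * \sum_x W x * expR (t * L n * X n x).
  congr (_ * _); apply: eq_bigr => x _.
  by rewrite /W -mulrA -expRD /w; congr (_ * expR _); ring.
pose T := expR (L n * (v ^+ 2 * s / 2 - e')).
have T0 : 0 < T by exact: expR_gt0.
have small t z' : (v + t) ^+ 2 * s / 2 - t * z' <= v ^+ 2 * s / 2 - delta ^+ 2 / (2 * s) ->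
    mom (P n) (X n) ((v + t) * L n) <= expR (L n * ((v + t) ^+ 2 * s / 2 + e')) ->
    expR (- (t * L n * z')) * mom (P n) (X n) ((v + t) * L n) <= T / 4.
  move=> ht hm; apply: le_trans (ler_wpM2l (expR_ge0 _) hm) _.
  have -> : T / 4 = expR (L n * (v ^+ 2 * s / 2 - e') - ln 4).
    by rewrite expRD expRN lnK // posrE.
  rewrite -expRD ler_expR.
  have h1 : ln 4 <= L n * (delta ^+ 2 / (4 * s)).
    move: L1; rewrite ler_pdivrMr ?exprn_gt0 // => L1.
    rewrite mulrA ler_pdivlMr ?mulr_gt0 //; move: L1; clear; lra.
  have h2 := ler_wpM2l L0 ht.
  have h3 := ler_wpM2l L0 e1.
  have e84 : delta ^+ 2 / (8 * s) = (delta ^+ 2 / s) / 8 by field; rewrite gt_eqF.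
  have e44 : delta ^+ 2 / (4 * s) = (delta ^+ 2 / s) / 4 by field; rewrite gt_eqF.
  have e24 : delta ^+ 2 / (2 * s) = (delta ^+ 2 / s) / 2 by field; rewrite gt_eqF.
  move: h1 h2 h3; rewrite e84 e44 e24; move: (delta ^+ 2 / s); clear=> D.
  lra.
have hup : \sum_(x | z + delta <= X n x) W x <= T / 4.
  have ht x : z + delta <= X n x -> 0 <= r * L n * (X n x - (z + delta)).
    by move=> hx; rewrite mulr_ge0 ?subr_ge0 // mulr_ge0 // ltW.
  apply: le_trans (tilted_tail W0 ht) _.
  rewrite -tailE; apply: small => //; rewrite /v /r le_eqVlt; apply/predU1l; field.
  by rewrite gt_eqF.
have hlo : \sum_(x | X n x <= z - delta) W x <= T / 4.
  have ht x : X n x <= z - delta -> 0 <= - r * L n * (X n x - (z - delta)).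
    by move=> hx; rewrite !mulNr -mulrN opprB mulr_ge0 ?subr_ge0 // mulr_ge0 // ltW.
  apply: le_trans (tilted_tail W0 ht) _.
  rewrite -tailE; apply: small => //; rewrite /v /r le_eqVlt; apply/predU1l; field.
  by rewrite gt_eqF.
pose E x := (z - delta < X n x) && (X n x < z + delta).
have hmid : T / 2 <= \sum_(x | E x) W x.
  have hsum : T <= \sum_x W x by exact: m1.
  have : \sum_x W x <= \sum_(x | E x) W x + (\sum_(x | z + delta <= X n x) W x
                        + \sum_(x | X n x <= z - delta) W x).
    rewrite [\sum_(x | E x) W x]big_mkcond [\sum_(x | z + delta <= X n x) W x]big_mkcond.
    rewrite [\sum_(x | X n x <= z - delta) W x]big_mkcond.
    rewrite -!big_split /=; apply: ler_sum => x _; rewrite /E.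
    apply: if3_ge => //; case: (leP (X n x) (z - delta)) => //= _; first by rewrite !orbT.
    by case: leP.
  by move: hsum hup hlo; clear; lra.
apply: le_trans (_ : \sum_(x | E x) P n x <= _); last first.
  rewrite big_mkcond [X in _ <= X]big_mkcond; apply: ler_sum => x _ /=.
  rewrite /E; case: ifP => [/andP[h1 h2]|_]; last by case: ifP.
  by rewrite ifT //; move: h1 h2 d1 d2; clear=> h1 h2 d1 d2; apply/andP; split; lra.
pose M := expR (L n * (v * z + `|v| * delta)).
have M0 : 0 < M by exact: expR_gt0.
have hEM : \sum_(x | E x) W x <= M * \sum_(x | E x) P n x.
  rewrite mulr_sumr; apply: ler_sum => x /andP[h1 h2].
  rewrite /W mulrC; apply: ler_wpM2r => //.
  rewrite ler_expR mulrAC mulrC; apply: ler_wpM2l => //.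
  rewrite -lerBlDl -mulrBr; apply: le_trans (ler_norm _) _.
  rewrite normrM; apply: ler_wpM2l => //.
  by move: h1 h2; clear=> h1 h2; rewrite ler_norml; apply/andP; split; lra.
rewrite -(ler_pM2l M0); apply: le_trans (le_trans hmid hEM).
have -> : T / 2 = expR (L n * (v ^+ 2 * s / 2 - e') - ln 2).
  by rewrite expRD expRN lnK // posrE.
rewrite -expRD ler_expR.
have h1 : ln 2 <= L n * (eta / 4).
  by move: L2; rewrite ler_pdivrMr // => L2; rewrite mulrA ler_pdivlMr //; move: L2; clear; lra.
have h2 := ler_wpM2l L0 e2.
have hvd : `|v| * delta <= eta / 2.
  rewrite /v normrM normfV (gtr0_norm s0) mulrAC ler_pdivrMr //.
  move: d3; rewrite ler_pdivlMr ?mulr_gt0 // => d3.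
  have : `|z| * delta <= (`|z| + 1) * delta by apply: ler_wpM2r; [exact: ltW|rewrite lerDl].
  by move: d3; clear; lra.
have h3 := ler_wpM2l L0 hvd.
have e4 : v * z = z ^+ 2 / s by rewrite /v; ring.
have e5 : v ^+ 2 * s = z ^+ 2 / s by rewrite /v; field; rewrite gt_eqF.
have e6 : z ^+ 2 / (2 * s) = (z ^+ 2 / s) / 2 by field; rewrite gt_eqF.
rewrite e5 e6 mulrDr e4; move: h1 h2 h3; move: (z ^+ 2 / s) (`|v| * delta); clear=> A B; lra.
Qed.

Lemma md_upperN (I : nat -> finType) (P X : forall n, I n -> R) L s z eta :
  (forall n x, 0 <= P n x) -> (forall A : R, \forall n \near \oo, A <= L n) ->
  mdev P X L s -> 0 < s -> 0 <= z -> 0 < eta -> \forall n \near \oo,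
  \sum_(x | X n x <= - z) P n x <= expR (- (L n * (z ^+ 2 / (2 * s) - eta))).
Proof.
move=> P0 hL hM s0 z0 eta0.
apply: filterS (md_upper P0 hL (mdevN hM) s0 z0 eta0) => n; apply: le_trans.
by under eq_bigl do rewrite lerNr.
Qed.

(** At v L / N the centred cumulant of m copies is about m (v L / N) ^ 2 V / 2. Since L / N tends to
    zero, the local expansion for one copy suffices, and the hypothesis on m turns the value into L
    v ^ 2 r V / 2: m n copies, measured at the scales of n, have variance r V. *)
Lemma mdev_iid (I0 : finType) (P0 y : I0 -> R) (D V : R)
    (I : nat -> finType) (P Y : forall n, I n -> R) (m : nat -> nat) (L N : nat -> R) (r : R) :
  (forall x, 0 <= P0 x) -> \sum_x P0 x = 1 -> \sum_x P0 x * y x = D ->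
  \sum_x P0 x * y x ^+ 2 - D ^+ 2 = V -> 0 < V ->
  (forall n u, mom (P n) (Y n) u = mom P0 y u ^+ m n) ->
  (forall e, 0 < e ->
     \forall n \near \oo, `|(m n)%:R * (L n / N n) ^+ 2 / L n - r| <= e) ->
  (forall e, 0 < e -> \forall n \near \oo, `|L n / N n| <= e) ->
  (\forall n \near \oo, 0 < L n) -> 0 < r ->
  mdev P (fun n x => (Y n x - (m n)%:R * D) / N n) L (r * V).
Proof.
move=> hP0 hP1 hD hV V0 hmom hr hLN hL r0 v eta eta0.
pose v2 := v ^+ 2.
have v20 : 0 <= v2 by exact: sqr_ge0.
pose eta1 := eta / (2 * (v2 + 1) * (r + 1)).
have eta10 : 0 < eta1 by rewrite divr_gt0 // !mulr_gt0 //; lra.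
have [u0 u00 hu0] := mom_local hP0 hP1 hD hV V0 eta10.
pose e2 := Num.min 1 (eta / (v2 * V + 1)).
have vV : 0 < v2 * V + 1 by rewrite ltr_wpDl // mulr_ge0 // ltW.
have e20 : 0 < e2 by rewrite lt_min ltr01 divr_gt0.
have v10 : 0 < `|v| + 1 by rewrite ltr_wpDl.
have u0v : 0 < u0 / (`|v| + 1) by rewrite divr_gt0.
apply: filterS3 hL (hLN _ u0v) (hr _ e20) => n L0 hln hrho.
set u := v * (L n / N n); set rho := _ / L n in hrho.
have hu : `|u| <= u0.
  rewrite /u normrM; move: hln; rewrite ler_pdivlMr // => hln.
  apply: le_trans hln; rewrite mulrC; apply: ler_wpM2l => //; lra.
have e21 : e2 <= 1 by rewrite /e2 ge_min lexx.
have e22 : e2 * (v2 * V + 1) <= eta.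
  by rewrite -ler_pdivlMr // /e2 ge_min lexx orbT.
have hE : mom (P n) (fun x => (Y n x - (m n)%:R * D) / N n) (v * L n) =
    (mom P0 y u * expR (- (u * D))) ^+ m n.
  rewrite exprMn -hmom -expRM_natl /mom mulr_suml; apply: eq_bigr => x _.
  by rewrite -[RHS]mulrA -expRD /u; congr (_ * expR _); ring.
have hmu : (m n)%:R * u ^+ 2 = L n * (v2 * rho).
  rewrite /u /rho /v2; move: (L n / N n) => w; field.
  by rewrite gt_eqF.
have hmuA A : (m n)%:R * (u ^+ 2 * A) = L n * (v2 * rho * A).
  by rewrite [LHS]mulrA hmu; ring.
have [hr1 hr2] : r - e2 <= rho /\ rho <= r + e2.
  by move: hrho; clear; rewrite ler_norml => /andP[h1 h2]; split; lra.
have h1 : v2 * V * e2 <= eta by move: e20 e22; clear; lra.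
have h2 : v2 * eta1 * (r + 1) <= eta / 2.
  rewrite /eta1 (_ : v2 * _ * _ = eta / 2 * (v2 / (v2 + 1))); last first.
    by field; apply/andP; split; rewrite gt_eqF // ltr_wpDl // ltW.
  rewrite -[X in _ <= X]mulr1; apply: ler_wpM2l; first by rewrite divr_ge0 // ltW.
  by rewrite ler_pdivrMr ?mul1r ?lerDl // ltr_wpDl.
have h3 : 0 <= v2 * eta1 by rewrite mulr_ge0 // ltW.
have h4 : v2 * V * (rho - r) <= eta.
  apply: le_trans h1; apply: ler_wpM2l; [by rewrite mulr_ge0 // ltW|by rewrite lerBlDl].
have h5 : - eta <= v2 * V * (rho - r).
  rewrite lerNl -mulrN; apply: le_trans h1; apply: ler_wpM2l; first by rewrite mulr_ge0 // ltW.
  by rewrite opprB lerBlDl -lerBlDr.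
have h6 : v2 * eta1 * rho <= eta / 2.
  by apply: le_trans h2; apply: ler_wpM2l => //; apply: le_trans hr2 _; rewrite lerD2l.
have /andP[b1 b2] := hu0 u hu.
rewrite hE; apply/andP; split.
  apply: le_trans (_ : expR (u ^+ 2 * (V / 2 - eta1)) ^+ m n <= _); last first.
    by apply: lerXn2r; rewrite // nnegrE ?(le_trans _ b1) ?expR_ge0.
  rewrite -expRM_natl hmuA ler_expR ler_pM2l // -/v2; move: h4 h5 h6; clear; lra.
apply: le_trans (_ : expR (u ^+ 2 * (V / 2 + eta1)) ^+ m n <= _).
  by apply: lerXn2r; rewrite // nnegrE ?(le_trans _ b1) ?expR_ge0.
rewrite -expRM_natl hmuA ler_expR ler_pM2l // -/v2; move: h4 h5 h6; clear; lra.
Qed.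

End Mdev.

(** * Channels and tests *)

Section Channels.
Variable R : realType.
Local Notation C := (R[i]).
Local Notation "x %:C" := (real_complex R x) (at level 1, format "x %:C").

Lemma psd_tens m n (A : 'M[C]_m) (B : 'M[C]_n) : psd A -> psd B -> psd (A *t B).
Proof.
move=> /psd_eigdec[U [p [hA hp]]] /psd_eigdec[V [q [hB hq]]].
have [_ ->] := eigdec_tens hA hB; apply: psd_conj; apply: psd_dg => i.
exact: mulr_ge0.
Qed.

Lemma mxtrace_tens m n (A : 'M[C]_m) (B : 'M[C]_n) :
  \tr (A *t B) = \tr A * \tr B.
Proof. by rewrite /mxtrace mulr_sum; apply: eq_bigr => i _; rewrite mxE. Qed.

Lemma psd_mxsub m n (f : 'I_m -> 'I_n) (A : 'M[C]_n) : psd A -> psd (mxsub f f A).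
Proof.
move=> hA; have -> : mxsub f f A = rowsub f 1%:M *m A *m adj (rowsub f 1%:M).
  rewrite -rowsubE; apply/matrixP => i j; rewrite !mxE.
  rewrite (bigD1 (f j)) //= !mxE eqxx rmorph1 mulr1 big1 ?addr0 // => k hk.
  by rewrite !mxE eq_sym (negbTE hk) rmorph0 mulr0.
exact: psd_conj.
Qed.

Lemma psd_diagC n (A : 'M[C]_n) i : psd A -> 0 <= A i i.
Proof.
move=> hA; have := psd_diag i hA; have := congr1 (fun M => fun_of_matrix M i i) (psd_adj hA).
rewrite /= adjE; case: (A i i) => a b [/eqP]; rewrite eq_sym -addr_eq0 -mulr2n mulrn_eq0 /=.
by move=> /eqP ->; rewrite lecE /= eqxx.
Qed.

Lemma tr_psd_ge0 n (A B : 'M[C]_n) : psd A -> psd B -> 0 <= \tr (A *m B).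
Proof.
move=> /psd_eigdec[U [p [[_ ->] hp]]] hB.
rewrite -!mulmxA mxtrace_mulC -mulmxA /mxtrace sumr_ge0 // => i _.
rewrite mul_diag_mx mxE [X in X * _]mxE mulr_ge0 ?ler0c //.
by apply: psd_diagC; rewrite -mulmxA mulmxA; exact: psd_conjC.
Qed.

Lemma tr_ev n (A B : 'M[C]_n) : psd A -> psd B -> \tr (A *m B) = (ev A B)%:C.
Proof. by move=> hA hB; apply/ge0_re/tr_psd_ge0. Qed.

Lemma channel_psd d1 d2 (Phi : {linear 'M[C]_d1 -> 'M[C]_d2}) X :
  channel Phi -> psd X -> psd (Phi X).
Proof.
move=> [_ h] hX; have := h 1%N (1%:M *t X) (psd_tens (@psd1 R 1) hX).
have -> : ampl Phi (1%:M *t X) = (1%:M : 'M[C]_1) *t Phi X.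
  apply/matrixP => i j; rewrite [LHS]mxE [RHS]mxE !ord1 mxE eqxx mul1r.
  congr (fun_of_matrix (Phi _) _ _); apply/matrixP => a b.
  by rewrite [LHS]mxE tensmxE mxE eqxx mul1r.
move=> /(psd_mxsub (fun i : 'I_d2 => mxtens_index (0 : 'I_1, i))).
congr psd; apply/matrixP => i j.
by rewrite [LHS]mxE tensmxE mxE eqxx mul1r.
Qed.

(** Passing to the Hermitian part changes no expectation in a Hermitian matrix, so in
    [test_pullback] it is enough to control the real part of a quadratic form. *)
Lemma psd_herm_part n (E : 'M[C]_n) :
  (forall v : 'cV[C]_n, 0 <= re ((adj v *m E *m v) 0 0)) ->
  psd (2^-1%:C *: (E + adj E)).
Proof.
move=> h; split; first by rewrite adj_scale conjc_real adjD adjK addrC.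
move=> v; rewrite -scalemxAr -scalemxAl mulmxDr mulmxDl.
have -> : adj v *m adj E *m v = adj (adj v *m E *m v).
  by rewrite !adjM adjK mulmxA.
rewrite mxE [X in _ * X]mxE adjE; have := h v.
case: ((_ : 'M[C]_1) 0 0) => a b /= ha.
by rewrite lecE /=; apply/andP; split; [apply/eqP; ring|lra].
Qed.

Lemma ev_herm_part n (A E : 'M[C]_n) : adj A = A ->
  ev A (2^-1%:C *: (E + adj E)) = ev A E.
Proof.
move=> hA; rewrite evZr evDr.
have -> : ev A (adj E) = ev A E; last by lra.
rewrite /ev -{1}hA -adjM mxtrace_mulC /mxtrace !re_sum; apply: eq_bigr => i _.
by rewrite adjE; case: (_ i i).
Qed.

(** [E0] is the dual map of the channel applied to [Q], defined through the matrix units; positivity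
    of the channel gives the lower bound and preservation of the trace the upper one. *)
Lemma test_pullback d1 d2 (Phi : {linear 'M[C]_d1 -> 'M[C]_d2}) (Q : 'M[C]_d2) :
  channel Phi -> psd Q -> psd (1%:M - Q) ->
  exists E : 'M[C]_d1, [/\ psd E, psd (1%:M - E) &
    forall X, adj X = X -> ev X E = ev (Phi X) Q].
Proof.
move=> hPhi hQ h1Q.
pose E0 : 'M[C]_d1 := \matrix_(j, i) \tr (Q *m Phi (delta_mx i j)).
have hE X : \tr (X *m E0) = \tr (Q *m Phi X).
  rewrite {2}[X]matrix_sum_delta linear_sum mulmx_sumr linear_sum /=.
  apply: eq_bigr => i _; rewrite mxE linear_sum mulmx_sumr linear_sum /=.
  by apply: eq_bigr => j _; rewrite linearZ -scalemxAr linearZ /= mxE.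
have hquad (v : 'cV[C]_d1) : (adj v *m E0 *m v) 0 0 = \tr (Q *m Phi (v *m adj v)).
  by rewrite -hE -[in RHS]mulmxA [RHS]mxtrace_mulC trace_mx11.
have hvv (v : 'cV[C]_d1) : psd (Phi (v *m adj v)).
  by apply: channel_psd => //; exact: psd_gram.
exists (2^-1%:C *: (E0 + adj E0)); split.
- apply: psd_herm_part => v; rewrite hquad; exact: ev_ge0.
- have -> : 1%:M - 2^-1%:C *: (E0 + adj E0) =
            2^-1%:C *: ((1%:M - E0) + adj (1%:M - E0)).
    rewrite adjB adj_id addrACA -opprD scalerBr; congr (_ - _).
    have half : 2^-1%:C * (1 + 1) = 1 :> C.
      by apply/eqP; rewrite eq_complex /=; apply/andP; split; apply/eqP; field.
    apply/matrixP => i j; rewrite !mxE; case: (i == j); first by rewrite half.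
    by rewrite addr0 mulr0.
  apply: psd_herm_part => v; rewrite mulmxBr mulmxBl mulmx1 mxE reD [X in _ + re X]mxE reN hquad.
  have -> : (adj v *m v) 0 0 = \tr (Phi (v *m adj v)).
    by rewrite hPhi.1 mxtrace_mulC trace_mx11.
  rewrite -reB -linearB /= -{1}[Phi _]mul1mx -mulmxBl.
  exact: ev_ge0.
- move=> X hX; rewrite ev_herm_part // [RHS]evC /ev hE //.
Qed.

Lemma convertible_test d1 d2 (rho sigma : 'M[C]_d1) (rho' sigma' Q : 'M[C]_d2) eps :
  psd rho -> psd sigma -> density rho' -> density sigma' -> \tr rho = 1 ->
  convertible rho sigma rho' sigma' eps 0 ->
  psd Q -> psd (1%:M - Q) ->
  exists E : 'M[C]_d1, [/\ psd E, psd (1%:M - E),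
    ev rho' Q - eps <= ev rho E & ev sigma E = ev sigma' Q].
Proof.
move=> hr hs [hr' tr'] [hs' _] tr1 [Phi [hPhi [h1 h2]]] hQ h1Q.
have [E [hE h1E hev]] := test_pullback hPhi hQ h1Q.
have pr := channel_psd hPhi hr; have ps := channel_psd hPhi hs.
exists E; split=> //; rewrite hev ?(psd_adj hr) ?(psd_adj hs) //; last first.
  by rewrite (tdist_le0_eq (psd_adj ps) (psd_adj hs') h2).
(* [tdist_test] bounds an acceptance from above, so it is applied to the complement of Q. *)
have hn : psd (1%:M - (1%:M - Q)) by rewrite opprB addrC subrK.
have := tdist_test (psd_adj pr) (psd_adj hr') _ h1Q hn.
rewrite hPhi.1 tr1 tr' => /(_ erefl).
rewrite !evBr !ev1 hPhi.1 tr1 tr' => h.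
move: h h1; move: (ev _ _) (ev _ _) (tdist _ _) => a b t; lra.
Qed.

Lemma density_tens m n (A : 'M[C]_m) (B : 'M[C]_n) :
  density A -> density B -> density (A *t B).
Proof.
by move=> [hA tA] [hB tB]; split; [exact: psd_tens|rewrite mxtrace_tens tA tB mulr1].
Qed.

Lemma density_pow n (A : 'M[C]_n) m : density A -> density (A ^t m).
Proof.
move=> hA; case: m => [|m].
  by split; [exact: (@psd1 R 1)|rewrite trace_mx11 mxE].
elim: m => [//|m IH]; exact: density_tens.
Qed.

Lemma tens_test m n (Q : 'M[C]_n) : psd Q -> psd (1%:M - Q) ->
  psd ((1%:M : 'M[C]_m) *t Q) /\ psd (1%:M - (1%:M : 'M[C]_m) *t Q).
Proof.
move=> hQ h1Q; split; first by apply: psd_tens => //; exact: psd1.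
have -> : 1%:M - (1%:M : 'M[C]_m) *t Q = 1%:M *t (1%:M - Q).
  rewrite -tens1; apply/matrixP => i j; rewrite !mxE -mulrBr.
  by congr (_ * _); rewrite !mxE.
by apply: psd_tens => //; exact: psd1.
Qed.

(** The extra copies are ignored. A converse for one number of copies thereby excludes every larger
    number, as a bound on a supremum requires. *)
Lemma test_extend n (rho sigma : 'M[C]_n) m k (Q : 'M[C]_(n ^ m.+1)) :
  density rho -> density sigma -> psd Q -> psd (1%:M - Q) ->
  exists Q' : 'M[C]_(n ^ (k + m).+1), [/\ psd Q', psd (1%:M - Q'),
    ev (rho ^t (k + m).+1) Q' = ev (rho ^t m.+1) Q &
    ev (sigma ^t (k + m).+1) Q' = ev (sigma ^t m.+1) Q].
Proof.
move=> hr hs hQ h1Q; elim: k => [|k [Q' [h1 h2 h3 h4]]]; first by exists Q.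
have hev (A : 'M[C]_n) (X Y : 'M[C]_(n ^ (k + m).+1)) : \tr A = 1 ->
    ev (A *t X) (1%:M *t Y) = ev X Y.
  by move=> tA; rewrite /ev tensmx_mul mulmx1 mxtrace_tens tA mul1r.
have [g1 g2] := tens_test n h1 h2.
have hS (A : 'M[C]_n) : A ^t (k.+1 + m).+1 = A *t (A ^t (k + m).+1).
  by [].
exists ((1%:M : 'M[C]_n) *t Q'); split; [exact: g1|exact: g2| |].
  by rewrite hS hev ?hr.2.
by rewrite hS hev ?hs.2.
Qed.

End Channels.

(** * Measure-and-prepare channels *)

Section MeasurePrepare.
Variable R : realType.
Local Notation C := (R[i]).
Local Notation "x %:C" := (real_complex R x) (at level 1, format "x %:C").

(** The partial expectation of T on the second factor: the unnormalised state that the outcome T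
    leaves on the reference system. *)
Definition outcome_mx k d (T : 'M[C]_d) (X : 'M[C]_(k * d)) : 'M[C]_k :=
  \matrix_(a, b) \tr (T *m blk X a b).

Lemma psd_outcome k d (T : 'M[C]_d) (X : 'M[C]_(k * d)) :
  psd T -> psd X -> psd (outcome_mx T X).
Proof.
move=> hT hX; split.
  apply/matrixP => a b; rewrite adjE !mxE.
  transitivity (\tr (adj (T *m blk X b a))).
    rewrite adjM (psd_adj hT) mxtrace_mulC; congr (\tr (_ *m _)).
    by apply/matrixP => i j; rewrite adjE !mxE -[in LHS](psd_adj hX) adjE.
  by rewrite /mxtrace rmorph_sum; apply: eq_bigr => i _; rewrite adjE.
move=> v.
(* [B] is the tensor product of v with the identity; it compresses X to the second factor. *)
pose B : 'M[C]_(k * d, d) :=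
  \matrix_(j, i) (v (mxtens_unindex j).1 0 * ((mxtens_unindex j).2 == i)%:R).
have -> : (adj v *m outcome_mx T X *m v) 0 0 = \tr (T *m (adj B *m X *m B)).
  have -> : adj B *m X *m B = \sum_a \sum_b (conjc (v a 0) * v b 0) *: blk X a b.
    apply/matrixP => i j; rewrite summxE; under [RHS]eq_bigr do rewrite summxE.
    have hB x (F : 'I_(k * d) -> C) :
        \sum_y F y * B y x = \sum_b F (mxtens_index (b, x)) * v b 0.
      transitivity (\sum_b \sum_c F (mxtens_index (b, c)) * B (mxtens_index (b, c)) x).
        rewrite pair_bigA (reindex (@mxtens_index k d)) /=.
          by apply: eq_bigr => -[b c] _.
        by exists (@mxtens_unindex k d) => y _; rewrite ?mxtens_indexK ?mxtens_unindexK.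
      apply: eq_bigr => b _; rewrite (bigD1 x) //= big1 ?addr0 => [|c hc].
        by rewrite mxE mxtens_indexK eqxx mulr1.
      by rewrite mxE mxtens_indexK /= (negbTE hc) !mulr0.
    rewrite mxE hB [RHS]exchange_big; apply: eq_bigr => b _ /=.
    rewrite mxE; under [X in X * _]eq_bigr do rewrite adjE mulrC.
    have -> : \sum_y X y (mxtens_index (b, j)) * conjc (B y i) =
              conjc (\sum_y conjc (X y (mxtens_index (b, j))) * B y i).
      by rewrite rmorph_sum; apply: eq_bigr => y _; rewrite rmorphM /= conjcK.
    rewrite hB rmorph_sum mulr_suml; apply: eq_bigr => a _.
    by rewrite rmorphM /= conjcK !mxE [RHS]mulrC mulrA.
  rewrite mulmx_sumr linear_sum /=.
  under [RHS]eq_bigr => a _ do rewrite mulmx_sumr linear_sum.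
  rewrite mxE [RHS]exchange_big; apply: eq_bigr => b _ /=.
  rewrite mxE mulr_suml; apply: eq_bigr => a _.
  by rewrite adjE mxE -scalemxAr mxtraceZ mulrAC.
by apply: tr_psd_ge0; [exact: hT|exact: psd_conjC].
Qed.

Section Channel.
Variables (d1 d2 K : nat) (T : 'I_K -> 'M[C]_d1) (tau : 'I_K -> 'M[C]_d2).

Definition meas_prep (X : 'M[C]_d1) : 'M[C]_d2 :=
  \sum_k \tr (T k *m X) *: tau k.

Lemma meas_prep_linear : linear meas_prep.
Proof.
move=> c X Y; rewrite /meas_prep scaler_sumr -big_split; apply: eq_bigr => k _ /=.
by rewrite mulmxDr -scalemxAr mxtraceD mxtraceZ scalerDl scalerA.
Qed.
HB.instance Definition _ :=
  GRing.isLinear.Build C 'M[C]_d1 'M[C]_d2 *:%R meas_prep meas_prep_linear.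

Lemma meas_prep_channel : (forall k, psd (T k)) -> \sum_k T k = 1%:M ->
  (forall k, density (tau k)) -> channel meas_prep.
Proof.
move=> hT hT1 htau; split=> [X|k X hX].
  rewrite /= /meas_prep linear_sum /=.
  rewrite -[in RHS](mul1mx X) -hT1 mulmx_suml linear_sum /=; apply: eq_bigr => k _.
  by rewrite mxtraceZ (htau k).2 mulr1.
have -> : ampl meas_prep X = \sum_j outcome_mx (T j) X *t tau j.
  apply/matrixP => a b; rewrite [LHS]mxE /= /meas_prep !summxE.
  by apply: eq_bigr => j _; rewrite !mxE.
by apply: psd_sum => j _; apply: psd_tens; [exact: psd_outcome|exact: (htau j).1].
Qed.

End Channel.

(* Fill the bins one after the other from the nested tests, each bin with as much
   mass as is still available. *)
Lemma greedy_povm n (rho : 'M[C]_n) (S : nat -> 'M[C]_n) (t : nat -> R) (E : R) :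
  psd rho -> (forall r, psd (S r)) ->
  (forall r, psd (S r.+1 - S r)) -> (forall r, 0 <= t r) -> 0 <= E ->
  forall K, (forall r, (r < K)%N ->
               \sum_(0 <= s < r.+1) t s <= ev rho (S r) + E) ->
  exists Y : nat -> 'M[C]_n,
  [/\ forall r, psd (Y r), forall r, (r < K)%N -> psd (S r - Y r),
      forall r, (r < K)%N -> ev rho (Y r) <= t r,
      psd (S K.-1 - \sum_(0 <= r < K) Y r) &
      \sum_(0 <= r < K) (t r - ev rho (Y r)) <= E].
Proof.
move=> hr hS hSS ht hE; elim=> [|K IH] hK.
  exists (fun=> 0); split; [by move=> _; exact: psd0| by [] | by [] | |].
  - by rewrite big_geq ?subr0; [exact: hS|].
  - by rewrite big_geq.
have [Y [h1 h2 h3 h4 h5]] := IH (fun r hrK => hK r (ltnW hrK)).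
pose B := \sum_(0 <= r < K) Y r.
have hA : psd (S K - B).
  have -> : S K - B = (S K - S K.-1) + (S K.-1 - B) by rewrite addrA subrK.
  apply: psdD h4; case: (K) => [|k]; last exact: hSS.
  by rewrite subrr; exact: psd0.
have hB : psd B by apply: psd_sum => r _; exact: h1.
pose av := ev rho (S K - B).
have av0 : 0 <= av by exact: ev_ge0.
have evB : ev rho B = \sum_(0 <= r < K) ev rho (Y r) by exact: ev_sumr.
pose c := if av <= t K then 1 else t K / av.
have hc : 0 <= c <= 1.
  rewrite /c; case: (leP av (t K)) => h; first by rewrite ler01 lexx.
  have h0 : 0 < av := le_lt_trans (ht K) h.
  by rewrite divr_ge0 //= ler_pdivrMr // mul1r ltW.
have /andP[c0 c1] := hc.
pose Z := c%:C *: (S K - B).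
have hZ : psd Z by exact: psdZ.
have hZ' : psd (S K - B - Z).
  have -> : S K - B - Z = (1 - c)%:C *: (S K - B).
    by rewrite rmorphB scalerBl scale1r.
  by apply: psdZ; rewrite ?subr_ge0.
pose Y' r := if r == K then Z else Y r.
exists Y'; split.
- by move=> r; rewrite /Y'; case: eqP => _; [exact: hZ|exact: h1].
- move=> r; rewrite /Y'; case: eqP => [->|hr0 hrK].
    move=> _; have -> : S K - Z = (S K - B - Z) + B.
      by rewrite addrAC subrK.
    exact: psdD.
  apply: h2; rewrite ltnS leq_eqVlt in hrK.
  by case/orP: hrK => // /eqP /hr0.
- move=> r; rewrite /Y'; case: eqP => [-> _|hr0 hrK].
    rewrite evZr -/av /c; case: (leP av (t K)) => h; first by rewrite mul1r.
    by rewrite divfK // gt_eqF // (le_lt_trans (ht K)).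
  apply: h3; rewrite ltnS leq_eqVlt in hrK.
  by case/orP: hrK => // /eqP /hr0.
- have -> : \sum_(0 <= r < K.+1) Y' r = B + Z.
    rewrite big_nat_recr; last by []; congr (_ + _); last by rewrite /Y' eqxx.
    by apply: eq_big_nat => r /andP[_ hrK]; rewrite /Y' ltn_eqF.
  rewrite opprD addrA; exact: hZ'.
- rewrite big_nat_recr //= {2}/Y' eqxx.
  have -> : \sum_(0 <= r < K) (t r - ev rho (Y' r)) = \sum_(0 <= r < K) (t r - ev rho (Y r)).
    by apply: eq_big_nat => r /andP[_ hrK]; rewrite /Y' ltn_eqF.
  (* If the last bin takes all that is left, the total shortfall is the sum of the t s minus ev rho
     (S K), which the hypothesis bounds; otherwise that bin is full and adds nothing. *)
  rewrite evZr -/av /c; case: (leP av (t K)) => h.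
    have := hK K (ltnSn K); rewrite big_nat_recr //= sumrB -evB.
    rewrite /av evBr mul1r.
    move: (\sum_(0 <= i < K) t i) (ev rho B) (ev rho (S K)) (t K) => a1 a2 a3 a4; lra.
  rewrite divfK ?subrr ?addr0 // gt_eqF // (le_lt_trans (ht K)) //.
Qed.

(** Outcome r prepares p conditioned on bin r; an x with [bin x] at least [K] lies in no bin. The
    remaining outcome prepares [om], the normalised part of q not yet produced, so that sigma is
    mapped exactly. The factor 1/2 in the hypothesis keeps at least half of q for it, so [om] is a
    distribution; the error on rho is the mass missing from the bins. *)
Lemma convert_bins n d (rho sigma : 'M[C]_n) (V : 'M[C]_d) (p q : 'I_d -> R)
    (K : nat) (Y : nat -> 'M[C]_n) (bin : 'I_d -> nat) (eps : R) :
  density rho -> density sigma -> unitary V ->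
  (forall x, 0 <= p x) -> (forall x, 0 <= q x) -> \sum_x p x = 1 -> \sum_x q x = 1 ->
  (forall r, psd (Y r)) -> psd (1%:M - \sum_(0 <= r < K) Y r) ->
  let t r := \sum_(x | bin x == r) p x in
  (forall r, (r < K)%N -> 0 < t r) ->
  (forall r, (r < K)%N -> ev rho (Y r) <= t r) ->
  (forall x, (bin x < K)%N -> ev sigma (Y (bin x)) * p x <= 2^-1 * t (bin x) * q x) ->
  1 - \sum_(0 <= r < K) ev rho (Y r) <= eps ->
  convertible rho sigma (V *m dg p *m adj V) (V *m dg q *m adj V) eps 0.
Proof.
move=> [hr tr1] [hs ts1] hV p0 q0 p1 q1 hY h1Y t t0 hyt hh heps.
pose y r := ev rho (Y r); pose h r := ev sigma (Y r).
have y0 r : 0 <= y r by apply: ev_ge0; [exact: hr|exact: hY].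
have h0 r : 0 <= h r by apply: ev_ge0; [exact: hs|exact: hY].
pose u (c : nat -> R) x := if (bin x < K)%N then c (bin x) / t (bin x) * p x else 0.
have u0 c x : (forall r, 0 <= c r) -> 0 <= u c x.
  move=> c0; rewrite /u; case: ifP => // hx.
  by rewrite mulr_ge0 // divr_ge0 // ltW // t0.
have usum c : \sum_x u c x = \sum_(0 <= r < K) c r.
  have e x : u c x = \sum_(0 <= r < K) (if r == bin x then c r / t r * p x else 0).
    by rewrite -big_mkcond big_nat1_eq.
  under eq_bigr do rewrite e.
  rewrite exchange_big; apply: eq_big_nat => r /andP[_ hrK] /=.
  transitivity (\sum_(x | bin x == r) c r / t r * p x).
    by rewrite [RHS]big_mkcond; apply: eq_bigr => x _; rewrite eq_sym.
  by rewrite -mulr_sumr divfK // gt_eqF // t0.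
have uhq x : u h x <= 2^-1 * q x.
  rewrite /u; case: ifP => hx; last by rewrite mulr_ge0.
  by rewrite mulrAC ler_pdivrMr ?t0 // mulrAC; exact: hh.
pose T0 := 1%:M - \sum_(0 <= r < K) Y r.
pose h' := ev sigma T0; pose y' := ev rho T0.
have eh' : h' = 1 - \sum_(0 <= r < K) h r by rewrite /h' evBr ev1 ts1 ev_sumr.
have ey' : y' = 1 - \sum_(0 <= r < K) y r by rewrite /y' evBr ev1 tr1 ev_sumr.
have h'half : 2^-1 <= h'.
  have : \sum_(0 <= r < K) h r <= \sum_x 2^-1 * q x.
    by rewrite -usum; apply: ler_sum => x _.
  rewrite -mulr_sumr q1 mulr1.
  by rewrite eh'; lra.
have h'0 : 0 < h' by lra.
pose om x := (q x - u h x) / h'.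
have om0 x : 0 <= om x.
  by apply: divr_ge0; [have := uhq x; have := q0 x; lra|exact: ltW].
have om1 : \sum_x om x = 1.
  by rewrite -mulr_suml sumrB q1 usum -eh' divff // gt_eqF.
pose w r x := if (r < K)%N then (if r == bin x then p x / t r else 0) else om x.
have w0 r x : 0 <= w r x.
  rewrite /w; case: ifP => // hrK; case: ifP => // _.
  by rewrite divr_ge0 // ltW // t0.
have w1 r : \sum_x w r x = 1.
  rewrite /w; case hrK: (r < K)%N; last exact: om1.
  transitivity (\sum_(x | bin x == r) p x / t r).
    by rewrite [RHS]big_mkcond; apply: eq_bigr => x _; rewrite eq_sym.
  by rewrite -mulr_suml divff // gt_eqF // t0.
have wsum c x : \sum_(0 <= r < K) c r * w r x = u c x.
  transitivity (\sum_(0 <= r < K) (if r == bin x then c r / t r * p x else 0)).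
    apply: eq_big_nat => r /andP[_ hrK]; rewrite /w hrK.
    by case: ifP; rewrite ?mulr0 // => _; rewrite mulrA mulrAC.
  by rewrite -big_mkcond big_nat1_eq.
pose T (k : 'I_K.+1) := if (k < K)%N then Y k else T0.
pose tau (k : 'I_K.+1) := V *m dg (w k) *m adj V.
have hT k : psd (T k) by rewrite /T; case: ifP => _; [exact: hY|exact: h1Y].
have hT1 : \sum_k T k = 1%:M.
  rewrite /T big_ord_recr /= ltnn -(big_mkord xpredT (fun k => if (k < K)%N then Y k else T0)).
  rewrite (eq_big_nat _ _ (F2 := Y)) => [|r /andP[_ ->] //].
  by rewrite /T0 addrC subrK.
have htau k : density (tau k).
  split; first by apply: psd_conj; apply: psd_dg.
  rewrite mxtrace_mulC mulmxA (unitaryC hV) mul1mx.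
  rewrite (ge0_re (x := \tr _)) ?re_tr_dg ?w1 //.
  by rewrite -[dg _]mulmx1; apply: tr_psd_ge0; [exact: psd_dg|exact: psd1].
have hPhi := meas_prep_channel hT hT1 htau.
have hout A (hA : psd A) : meas_prep T tau A =
    V *m dg (fun x => u (fun r => ev A (Y r)) x + ev A T0 * om x) *m adj V.
  have e k : \tr (T k *m A) *: tau k = V *m dg (fun x => ev A (T k) * w k x) *m adj V.
    rewrite (tr_ev (hT k) hA) evC /tau scalemxAl scalemxAr; congr (_ *m _ *m _).
    by apply/matrixP => i j; rewrite mxE !dgE -rmorphM; case: eqP; rewrite ?mulr0.
  rewrite /meas_prep; under eq_bigr do rewrite e.
  rewrite -mulmx_suml -mulmx_sumr; congr (_ *m _ *m _).
  apply/matrixP => i j; rewrite summxE dgE; under eq_bigr do rewrite dgE.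
  rewrite -rmorph_sum; congr (_%:C); case: eqP => _; last by rewrite big1.
  rewrite /T big_ord_recr /= ltnn {2}/w ltnn; congr (_ + _).
  rewrite -(wsum (fun r => ev A (Y r))) big_mkord.
  by apply: eq_bigr => r _; rewrite ltn_ord.
exists (meas_prep T tau); split => //; split.
  have e : meas_prep T tau rho - V *m dg p *m adj V =
      V *m dg (fun x => u y x + y' * om x - p x) *m adj V.
    by rewrite /= (hout _ hr) -mulmxBl -mulmxBr dgB.
  rewrite /tdist (tnorm_eigdec (conj hV e)) ler_pdivrMr //.
  have y'0 : 0 <= y' by apply: ev_ge0; [exact: hr|exact: h1Y].
  have uyp x : u y x <= p x.
    rewrite /u; case: ifP => hx; last exact: p0.
    rewrite -[X in _ <= X]mul1r; apply: ler_wpM2r; first exact: p0.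
    by rewrite ler_pdivrMr ?t0 // mul1r; exact: hyt.
  (* The difference sums to zero and its negative part is at most p - u. *)
  apply: (@le_trans _ _ (\sum_x ((u y x + y' * om x - p x) + 2 * (p x - u y x)))).
    apply: ler_sum => x _; have h1 := uyp x; have h2 : 0 <= y' * om x by rewrite mulr_ge0.
    by rewrite ler_norml; move: (y' * om x) h2 => z h2; apply/andP; split; lra.
  rewrite big_split sumrB big_split /= -mulr_sumr om1 mulr1 -mulr_sumr sumrB usum p1.
  rewrite ey' mulrC; move: heps; rewrite -/(y _) -[\sum_(0 <= r < K) ev _ _]/(\sum_(0 <= r < K) y r).
  by move: (\sum_(0 <= r < K) y r) => a; lra.
have -> : V *m dg q *m adj V = meas_prep T tau sigma.
  rewrite (hout _ hs); congr (_ *m _ *m _); apply: eq_dg => x.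
  by rewrite -/h -/h' /om mulrC divfK ?gt_eqF // addrC subrK.
rewrite /tdist subrr (tnorm_eigdec (U := 1%:M) (x := fun=> 0)).
  by rewrite big1 ?mul0r // => x _; rewrite normr0.
split; first by rewrite /unitary adj_id mulmx1.
rewrite (_ : dg _ = 0) ?mulmx0 ?mul0mx //.
by apply/matrixP => i j; rewrite dgE mxE; case: ifP.
Qed.

End MeasurePrepare.

(** * Scales and conversion rates *)

Lemma rate_lt_lam (R : realType) (s lam A z : R) : 0 < s -> 0 < A ->
  A ^+ 2 = 2 * s * lam -> `|z| < A -> z ^+ 2 / (2 * s) < lam.
Proof.
move=> s0 A0 hA h; rewrite ltr_pdivrMr ?mulr_gt0 // mulrC -hA.
by rewrite -(real_normK (num_real z)) ltrXn2r // ?nnegrE ltW.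
Qed.

Lemma rate_gt_lam (R : realType) (s lam A z : R) : 0 < s -> 0 < A ->
  A ^+ 2 = 2 * s * lam -> A < z -> lam < z ^+ 2 / (2 * s).
Proof.
move=> s0 A0 hA h; rewrite ltr_pdivlMr ?mulr_gt0 // mulrC -hA.
by rewrite ltrXn2r // ?nnegrE ltW // (lt_trans A0).
Qed.

Section Scales.
Variables (R : realType) (a : R).
Hypothesis ha : 0 < a < 1.

(* Deviations of the log-likelihood ratio of order Ns n = n (gs n) have
   probabilities that decay exponentially at speed Ls n = (Ns n)^2 / n. *)
Definition Ls (n : nat) : R := n%:R `^ a.
Definition Ns (n : nat) : R := n%:R `^ ((1 + a) / 2).
Definition gs (n : nat) : R := Num.sqrt (n%:R `^ (a - 1)).

Let a0 : 0 < a. Proof. by case/andP: ha. Qed.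
Let a1 : a < 1. Proof. by case/andP: ha. Qed.

Lemma near_gt0 : \forall n \near \oo, 0 < n%:R :> R.
Proof. by apply: filterS (nbhs_infty_ger 1) => n; apply: lt_le_trans. Qed.

Lemma powR_large b (A : R) : 0 < b -> \forall n \near \oo, A <= n%:R `^ b.
Proof.
move=> b0; apply: filterS (nbhs_infty_ger ((`|A| + 1) `^ b^-1)) => n hn.
have h1 : 0 < `|A| + 1 by rewrite ltr_wpDl.
have := ge0_ler_powR (ltW b0) _ _ hn; rewrite !nnegrE powR_ge0 ler0n => /(_ isT isT).
rewrite -powRrM mulVf ?gt_eqF // powRr1 ?(ltW h1) //; apply: le_trans.
by apply: le_trans (ler_norm A) _; rewrite lerDl.
Qed.

Lemma Ls_large (A : R) : \forall n \near \oo, A <= Ls n.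
Proof. exact: powR_large. Qed.

Lemma Ns_large (A : R) : \forall n \near \oo, A <= Ns n.
Proof. by apply: powR_large; move: a0; lra. Qed.

Lemma Ls_gt0 : \forall n \near \oo, 0 < Ls n.
Proof. by apply: filterS near_gt0 => n; exact: powR_gt0. Qed.

Lemma Ns_gt0 : \forall n \near \oo, 0 < Ns n.
Proof. by apply: filterS near_gt0 => n; exact: powR_gt0. Qed.

Lemma gsE n : 0 < n%:R :> R -> gs n = Ls n / Ns n.
Proof.
move=> n0; rewrite /gs -powR12_sqrt ?powR_ge0 // -powRrM /Ls /Ns -powRB ?(gt_eqF n0) ?implybT //.
by congr (_ `^ _); field.
Qed.

Lemma Ns_gs n : 0 < n%:R :> R -> n%:R * gs n = Ns n.
Proof.
move=> n0; rewrite /gs -powR12_sqrt ?powR_ge0 // -powRrM /Ns.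
rewrite -{1}[n%:R]powRr1 ?ltW // -powRD ?(gt_eqF n0) ?implybT //.
by congr (_ `^ _); field.
Qed.

Lemma gs_gt0 n : 0 < n%:R :> R -> 0 < gs n.
Proof. by move=> n0; rewrite /gs sqrtr_gt0 powR_gt0. Qed.

Lemma gs_small e : 0 < e -> \forall n \near \oo, gs n <= e.
Proof.
move=> e0; have b0 : 0 < (1 - a) / 2 by move: a1; lra.
apply: filterS2 near_gt0 (powR_large e^-1 b0) => n n0 h.
rewrite /gs -powR12_sqrt ?powR_ge0 // -powRrM.
have -> : (a - 1) * 2^-1 = - ((1 - a) / 2) by ring.
by rewrite powRN -[X in _ <= X]invrK lef_pV2 ?posrE ?powR_gt0 ?invr_gt0.
Qed.

Lemma LN_small e : 0 < e -> \forall n \near \oo, `|Ls n / Ns n| <= e.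
Proof.
move=> e0; apply: filterS2 near_gt0 (gs_small e0) => n n0 h.
by rewrite -gsE // ger0_norm // ltW // gs_gt0.
Qed.

Lemma Ls_le_Ns A k : 0 < k -> \forall n \near \oo, A * Ls n <= k * Ns n.
Proof.
move=> k0; have e0 : 0 < k / (`|A| + 1) by rewrite divr_gt0 // ltr_wpDl.
apply: filterS3 (LN_small e0) Ns_gt0 Ls_gt0 => n h N0 L0.
rewrite -ler_pdivrMr //; move: h; rewrite ger0_norm ?divr_ge0 ?(ltW N0) ?(ltW L0) //.
rewrite ler_pdivlMr ?ltr_wpDl // => h; apply: le_trans h; rewrite -mulrA mulrC.
apply: ler_wpM2l; first by rewrite divr_ge0 ?ltW.
by apply: le_trans (ler_norm A) _; rewrite lerDl.
Qed.

Lemma ratio_scale (m : nat -> nat) r :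
  (forall e, 0 < e -> \forall n \near \oo, `|(m n)%:R / n%:R - r| <= e) ->
  forall e, 0 < e ->
  \forall n \near \oo, `|(m n)%:R * (Ls n / Ns n) ^+ 2 / Ls n - r| <= e.
Proof.
move=> h e e0; apply: filterS3 (h e e0) near_gt0 Ls_gt0 => n he n0 L0.
suff -> : (m n)%:R * (Ls n / Ns n) ^+ 2 / Ls n = (m n)%:R / n%:R by [].
rewrite -gsE // -mulrA; congr (_ * _).
have N0 : 0 < Ns n by exact: powR_gt0.
have h1 := gsE n0; have h2 := Ns_gs n0.
have g0 := gs_gt0 n0.
have hL : Ls n = n%:R * gs n ^+ 2.
  by rewrite expr2 mulrA h2 h1 mulrCA divff ?mulr1 // gt_eqF.
rewrite hL invfM mulrCA divff ?mulr1 // gt_eqF // exprn_gt0 //.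
Qed.

(** This is n = Ls ^ (1 / a) and ln Ls <= Ls. The exponent is of full order [Ls], but the factor
    will only multiply errors on sigma, where gaps of order [Ns] are available. *)
Lemma poly_exp (C : R) : 0 < C -> exists2 B, 0 <= B &
  \forall n \near \oo, C * n%:R <= expR (B * Ls n).
Proof.
move=> C0; exists (a^-1 + 1); first by rewrite addr_ge0 // invr_ge0 ltW.
apply: filterS2 near_gt0 (Ls_large (ln C)) => n n0 hC.
rewrite mulrDl mul1r expRD mulrC; apply: ler_pM; rewrite ?ler0n ?(ltW C0) //.
  have h : n%:R = expR (a^-1 * ln (Ls n)).
    by rewrite ln_powR mulrA mulVf ?gt_eqF // mul1r lnK.
  rewrite h ler_expR; apply: ler_wpM2l; first by rewrite invr_ge0 ltW.
  have L0 : 0 < Ls n by exact: powR_gt0.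
  by have := expR_ge1Dx (ln (Ls n)); rewrite lnK // => h'; lra.
by rewrite -[X in X <= _]lnK // ler_expR.
Qed.

Definition mseq (D1 D2 c : R) (n : nat) : nat :=
  Num.truncn (n%:R * ((D1 + c * gs n) / D2)).

Section Mseq.
Variables (D1 D2 c : R).
Hypotheses (D10 : 0 < D1) (D20 : 0 < D2).

Lemma mseq_itv : \forall n \near \oo,
  (mseq D1 D2 c n)%:R <= n%:R * ((D1 + c * gs n) / D2) < (mseq D1 D2 c n)%:R + 1.
Proof.
have e0 : 0 < D1 / (`|c| + 1) by rewrite divr_gt0 // ltr_wpDl.
apply: filterS2 near_gt0 (gs_small e0) => n n0 hg.
have h : 0 <= n%:R * ((D1 + c * gs n) / D2).
  rewrite mulr_ge0 ?ler0n // divr_ge0 ?(ltW D20) // -lerBlDl sub0r lerNl.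
  apply: le_trans (ler_norm _) _; rewrite normrN normrM (ger0_norm (ltW (gs_gt0 n0))).
  move: hg; rewrite ler_pdivlMr ?ltr_wpDl // => hg; apply: le_trans hg.
  by rewrite mulrC; apply: ler_wpM2l; [exact: ltW (gs_gt0 n0)|rewrite lerDl].
by have := truncn_itv h; rewrite -natr1.
Qed.

Lemma mseq_ratio e : 0 < e -> \forall n \near \oo,
  `|(mseq D1 D2 c n)%:R / n%:R - D1 / D2| <= e.
Proof.
move=> e0; have e1 : 0 < e / 2 * D2 / (`|c| + 1).
  by rewrite divr_gt0 ?mulr_gt0 ?divr_gt0 // ltr_wpDl.
apply: filterS (near_and mseq_itv (near_and (near_and near_gt0 (gs_small e1))
   (nbhs_infty_ger (e / 2)^-1))) => n [/andP[h1 h2] [[n0 hg] hn]].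
have g0 := gs_gt0 n0; set m := (mseq _ _ _ _)%:R in h1 h2 *.
have h3 : `|c * gs n / D2| <= e / 2.
  rewrite !normrM normfV (gtr0_norm g0) (gtr0_norm D20) ler_pdivrMr //.
  move: hg; rewrite ler_pdivlMr ?ltr_wpDl // => hg; apply: le_trans hg.
  by rewrite mulrC; apply: ler_wpM2l; [exact: ltW g0|rewrite lerDl].
have h4 : n%:R^-1 <= e / 2.
  by rewrite -[X in _ <= X]invrK lef_pV2 ?posrE ?invr_gt0 ?divr_gt0.
have h5 : m / n%:R <= (D1 + c * gs n) / D2 by rewrite ler_pdivrMr // mulrC.
have h6 : (D1 + c * gs n) / D2 <= m / n%:R + n%:R^-1.
  have -> : m / n%:R + n%:R^-1 = (m + 1) / n%:R by rewrite mulrDl mul1r.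
  by rewrite ler_pdivlMr // mulrC ltW.
move: h3 h5 h6; rewrite mulrDl; move: (c * gs n / D2) (m / n%:R) (D1 / D2) h4 => x y z h4.
move: (n%:R^-1) h4 => w h4.
rewrite !ler_norml => /andP[h7 h8] h5 h6; apply/andP; split; lra.
Qed.

(** The rate is such that the output mean exceeds the input mean by [c * Ns n]; rounding down loses
    at most one copy, hence the D2. *)
Lemma mseq_shift : \forall n \near \oo,
  n%:R * D1 + (c * Ns n - D2) <= (mseq D1 D2 c n)%:R * D2 <= n%:R * D1 + c * Ns n.
Proof.
apply: filterS2 near_gt0 mseq_itv => n n0 /andP[h1 h2].
have e : n%:R * ((D1 + c * gs n) / D2) = (n%:R * D1 + c * Ns n) / D2.
  by rewrite -(Ns_gs n0); ring.
rewrite e in h1 h2; rewrite ler_pdivlMr // in h1; rewrite h1 andbT.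
by rewrite ltr_pdivrMr // in h2; lra.
Qed.

Lemma mseq_gt0 : \forall n \near \oo, (0 < mseq D1 D2 c n)%N.
Proof.
have e0 : 0 < D1 / D2 / 2 by rewrite !divr_gt0.
apply: filterS (mseq_ratio e0) => n; case: (mseq _ _ _ _) => // h.
have d0 : 0 < D1 / D2 by rewrite divr_gt0.
by move: h; rewrite mul0r sub0r normrN gtr0_norm // => h; lra.
Qed.

End Mseq.
End Scales.

(** * Tests for tensor powers *)

Section Testing.
Variable R : realType.
Local Notation C := (R[i]).

Definition nsfamily d (rho sigma : 'M[C]_d) := forall k, nsdata (rho ^t k) (sigma ^t k).

Definition good_family d (rho sigma : 'M[C]_d) (d0 : nsdata rho sigma)
    (dm : nsfamily rho sigma) (k0 : R) := forall k,
  [/\ forall u, mgf (dm k) u = mgf d0 u ^+ k, nsmin (dm k) (k%:R * k0) &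
      nsU d0 = nsV d0 -> nsU (dm k) = nsV (dm k)].

Lemma nsfamily_exists d (rho sigma : 'M[C]_d) (d0 : nsdata rho sigma) :
  exists (dm : nsfamily rho sigma) (k0 : nat), good_family d0 dm k0%:R.
Proof.
have [k0 hk] := nsmin_exists d0.
exists (fun k => projT1 (cid (nsdata_pow hk k))), k0 => k.
exact: projT2 (cid (nsdata_pow hk k)).
Qed.

Section Seq.
Variables (a : R) (d : nat) (rho sigma : 'M[C]_d) (d0 : nsdata rho sigma).
Variables (dm : nsfamily rho sigma) (k0 : nat) (m : nat -> nat) (r : R).
Hypotheses (ha : 0 < a < 1) (hdm : good_family d0 dm k0%:R).
Hypotheses (hV : 0 < relV rho sigma) (r0 : 0 < r).
Hypothesis hm : forall e : R, 0 < e -> \forall n \near \oo, `|(m n)%:R / n%:R - r| <= e.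

Local Notation D := (relD rho sigma).
Local Notation L := (Ls a).
Local Notation N := (Ns a).
Local Notation s := (r * relV rho sigma).

Definition nsx n (z : 'I_(d ^ m n) * 'I_(d ^ m n)) : R :=
  (nsy (dm (m n)) z - (m n)%:R * D) / N n.

Lemma s_gt0 : 0 < s. Proof. exact: mulr_gt0. Qed.

Lemma nsx_mdev : mdev (fun n => nsw (dm (m n))) nsx L s.
Proof.
apply: (@mdev_iid _ _ (nsw d0) (nsy d0) D _ _ _
  (fun n => nsy (dm (m n))) m L N r) => //.
- exact: nsw_ge0.
- exact: nsw_sum.
- by rewrite -relD_ns.
- by rewrite (relD_ns d0) -relV_ns.
- by move=> n u; have [h _ _] := hdm (m n); exact: h.
- exact: ratio_scale.
- exact: LN_small.
- exact: Ls_gt0.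
Qed.

Let nsw0 n x : 0 <= nsw (dm (m n)) x.
Proof. exact: nsw_ge0. Qed.

Lemma nsx_upper z eta : 0 <= z -> 0 < eta -> \forall n \near \oo,
  \sum_(x | z <= nsx x) nsw (dm (m n)) x <= expR (- (L n * (z ^+ 2 / (2 * s) - eta))).
Proof. exact: (md_upper nsw0 (Ls_large ha) nsx_mdev s_gt0). Qed.

Lemma nsx_upperN z eta : 0 <= z -> 0 < eta -> \forall n \near \oo,
  \sum_(x | nsx x <= - z) nsw (dm (m n)) x <= expR (- (L n * (z ^+ 2 / (2 * s) - eta))).
Proof. exact: (md_upperN nsw0 (Ls_large ha) nsx_mdev s_gt0). Qed.

Lemma nsx_lower z z1 z2 eta : z1 < z < z2 -> 0 < eta -> \forall n \near \oo,
  expR (- (L n * (z ^+ 2 / (2 * s) + eta))) <=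
  \sum_(x | (z1 < nsx x) && (nsx x < z2)) nsw (dm (m n)) x.
Proof. exact: (md_lower nsw0 (Ls_large ha) nsx_mdev s_gt0). Qed.

Lemma nsx_le n x z : 0 < N n ->
  (@nsx n z <= x) = (nsy (dm (m n)) z <= (m n)%:R * D + N n * x).
Proof. by move=> N0; rewrite /nsx ler_pdivrMr // lerBlDl [x * _]mulrC. Qed.

Lemma nsx_ge n x z : 0 < N n ->
  (x <= @nsx n z) = ((m n)%:R * D + N n * x <= nsy (dm (m n)) z).
Proof. by move=> N0; rewrite /nsx ler_pdivlMr // lerBrDl [x * _]mulrC. Qed.

Lemma sum_le_pred n (E F : pred ('I_(d ^ m n) * 'I_(d ^ m n))) :
  (forall z, E z -> F z) ->
  \sum_(z | E z) nsw (dm (m n)) z <= \sum_(z | F z) nsw (dm (m n)) z.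
Proof.
move=> h; rewrite [X in X <= _]big_mkcond [X in _ <= X]big_mkcond /=.
apply: ler_sum => z _; case: ifP => [/h ->//|_]; case: ifP => // _; exact: nsw_ge0.
Qed.

(** The threshold lies [N n * x] below the mean, so rho is rejected only on a lower tail. A single
    projection is needed, hence the constant [c]. *)
Lemma test_small x eta : 0 <= x -> 0 < eta -> \forall n \near \oo,
  exists Q : 'M[C]_(d ^ m n), [/\ psd Q, psd (1%:M - Q),
    1 - ev (rho ^t m n) Q <= expR (- (L n * (x ^+ 2 / (2 * s) - eta))) &
    ev (sigma ^t m n) Q <= expR (- ((m n)%:R * D - N n * x))].
Proof.
move=> x0 eta0; apply: filterS2 (Ns_gt0 a) (nsx_upperN x0 eta0) => n N0 hn.
pose c (_ : nat) : R := expR ((m n)%:R * D - N n * x).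
have c0 k : 0 < c k by exact: expR_gt0.
have [S [h1 h2 h3 h4]] := nested_tests (dm (m n)) c0.
exists (S 0%N); have [p1 p2] := h1 0%N; split => //; last first.
  by apply: le_trans (h4 0%N) _; rewrite big_nat1 /c expRN.
apply: le_trans hn; rewrite -(nsw_sum (dm (m n))).
rewrite (bigID (fun z => - x <= nsx z)) /= addrC.
apply: (@le_trans _ _ (\sum_(z | ~~ (- x <= nsx z)) nsw (dm (m n)) z)).
  rewrite -addrA gerDl subr_le0; apply: le_trans (h3 0%N).
  by apply: sum_le_pred => z; rewrite nsx_ge // expRK mulrN.
by apply: sum_le_pred => z; rewrite -ltNge; exact: ltW.
Qed.

(** The counterpart for tests that accept rho with small probability: the acceptance is bounded
    below by the mass of a window above the threshold. *)
Lemma test_large x z eta : x < z -> 0 < eta -> \forall n \near \oo,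
  exists Q : 'M[C]_(d ^ m n), [/\ psd Q, psd (1%:M - Q),
    expR (- (L n * (z ^+ 2 / (2 * s) + eta))) <= ev (rho ^t m n) Q &
    ev (sigma ^t m n) Q <= expR (- ((m n)%:R * D + N n * x))].
Proof.
move=> xz eta0; have hz : x < z < z + 1 by rewrite xz ltrDl ltr01.
apply: filterS2 (Ns_gt0 a) (nsx_lower hz eta0) => n N0 hn.
pose c (_ : nat) : R := expR ((m n)%:R * D + N n * x).
have c0 k : 0 < c k by exact: expR_gt0.
have [S [h1 h2 h3 h4]] := nested_tests (dm (m n)) c0.
exists (S 0%N); have [p1 p2] := h1 0%N; split => //; last first.
  by apply: le_trans (h4 0%N) _; rewrite big_nat1 /c expRN.
apply: le_trans hn _; apply: le_trans (h3 0%N).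
by apply: sum_le_pred => y /andP[/ltW + _]; rewrite nsx_ge // expRK.
Qed.

(** This limits tests with small error on rho; it is vacuous once the error exceeds 1/2. *)
Lemma bound_small x z eta : z < x -> 0 < eta -> \forall n \near \oo,
  forall T : 'M[C]_(d ^ m n), psd T -> psd (1%:M - T) ->
  expR (- (L n * (z ^+ 2 / (2 * s) + eta))) / 2 <=
  1 - ev (rho ^t m n) T + expR ((m n)%:R * D + N n * x) * ev (sigma ^t m n) T.
Proof.
move=> zx eta0; have hz : z - 1 < z < x by rewrite zx gtrBl ltr01.
apply: filterS2 (Ns_gt0 a) (nsx_lower hz eta0) => n N0 hn T hT h1T.
have := test_converse (dm (m n)) hT h1T (expR_gt0 ((m n)%:R * D + N n * x)).
apply: le_trans; apply: ler_wpM2r; first by rewrite invr_ge0.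
apply: le_trans hn _; apply: sum_le_pred => y /andP[_ /ltW].
by rewrite nsx_le // expRK.
Qed.

(** Here the acceptance of rho may itself be exponentially small. The factor expR (B * L n) pays for
    the linearly many levels of [test_strong]. *)
Lemma bound_large x z eta : 0 <= z < x -> 0 < eta -> exists2 B, 0 <= B &
  \forall n \near \oo,
  forall T : 'M[C]_(d ^ m n), psd T -> psd (1%:M - T) ->
  ev (rho ^t m n) T <=
  expR (B * L n) * (expR ((m n)%:R * D + N n * x) * ev (sigma ^t m n) T)
  + 2 * expR (- (L n * (z ^+ 2 / (2 * s) - eta))).
Proof.
move=> /andP[z0 zx] eta0.
have C0 : 0 < 2 * ((r + 1) * k0%:R + 1) :> R.
  by rewrite mulr_gt0 // ltr_wpDl // mulr_ge0 ?ler0n // addr_ge0 // ltW.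
have [B B0 hB] := poly_exp ha C0; exists B => //.
apply: filterS (near_and (near_and (Ns_gt0 a) (nsx_upper z0 eta0))
  (near_and (near_and hB (Ns_large ha (x - z)^-1))
     (near_and (hm ltr01) (nbhs_infty_ger (1 : R))))).
move=> n [[N0 hn] [[hBn hNn] [hmn n1]]] T hT h1T.
have [_ hk _] := hdm (m n).
rewrite -natrM in hk.
have n0 : 0 < n%:R :> R by apply: lt_le_trans n1.
have hmr : (m n)%:R <= (r + 1) * n%:R.
  rewrite -ler_pdivrMr //; move: hmn; rewrite ler_norml => /andP[_]; lra.
have := test_strong hT h1T (expR_gt0 ((m n)%:R * D + N n * x)) hk.
move=> /le_trans; apply; apply: lerD.
  rewrite mulrA; apply: ler_wpM2r.
    rewrite mulr_ge0 ?expR_ge0 //; apply: ev_ge0; last exact: hT.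
    have [_ ->] := ns_sigma (dm (m n)).
    by apply: psd_conj; apply: psd_dg; exact: nsr_ge0.
  apply: le_trans hBn; rewrite -mulrA ler_pM2l // -natr1 natrM mulrDl.
  apply: lerD; last by rewrite mul1r.
  by rewrite mulrAC; apply: ler_wpM2r.
rewrite ler_pM2l //; apply: le_trans hn; apply: sum_le_pred => y.
rewrite expRK nsx_ge // => hy; apply: ltW; apply: le_lt_trans hy.
(* The unit lost in the threshold of [test_strong] fits into the gap between z and x. *)
have h1 : 1 <= N n * (x - z).
  by rewrite -ler_pdivrMr ?subr_gt0 // mul1r.
rewrite -addrA lerD2l; move: h1; rewrite mulrBr; lra.
Qed.

End Seq.
End Testing.

(** * Converse *)

Section Converse.
Variable R : realType.
Local Notation C := (R[i]).

Lemma near_expR (a c l lam : R) : 0 < a < 1 -> l < lam ->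
  \forall n \near \oo, c * expR (- (Ls a n * lam)) < expR (- (Ls a n * l)).
Proof.
move=> ha hl; apply: filterS (Ls_large ha (`|c| / (lam - l))) => n.
rewrite ler_pdivrMr ?subr_gt0 // => h.
have -> : expR (- (Ls a n * l)) = expR (Ls a n * (lam - l)) * expR (- (Ls a n * lam)).
  by rewrite -expRD; congr expR; ring.
rewrite ltr_pM2r ?expR_gt0 //; apply: le_lt_trans (ler_norm c) _.
by apply: le_lt_trans h _; have := expR_ge1Dx (Ls a n * (lam - l)); lra.
Qed.

Lemma test_extend_le n (rho sigma : 'M[C]_n) m m' (Q : 'M[C]_(n ^ m)) :
  density rho -> density sigma -> (0 < m <= m')%N -> psd Q -> psd (1%:M - Q) ->
  exists Q' : 'M[C]_(n ^ m'), [/\ psd Q', psd (1%:M - Q'),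
    ev (rho ^t m') Q' = ev (rho ^t m) Q & ev (sigma ^t m') Q' = ev (sigma ^t m) Q].
Proof.
move=> hr hs; case: m Q => [//|m] Q /= hm hQ h1Q.
have -> : m' = ((m' - m.+1) + m).+1 by rewrite -addnS subnK.
exact: test_extend.
Qed.

Lemma convertible_pow_test d1 d2 (rho1 sigma1 : 'M[C]_d1) (rho2 sigma2 : 'M[C]_d2)
    n m m' (Q : 'M[C]_(d2 ^ m)) eps :
  density rho1 -> density sigma1 -> density rho2 -> density sigma2 ->
  (0 < m <= m')%N -> psd Q -> psd (1%:M - Q) ->
  convertible (rho1 ^t n) (sigma1 ^t n) (rho2 ^t m') (sigma2 ^t m') eps 0 ->
  exists E : 'M[C]_(d1 ^ n), [/\ psd E, psd (1%:M - E),
    ev (rho2 ^t m) Q - eps <= ev (rho1 ^t n) E &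
    ev (sigma1 ^t n) E = ev (sigma2 ^t m) Q].
Proof.
move=> r1 s1 r2 s2 hm hQ h1Q hc.
have [Q' [h1 h2 <- <-]] := test_extend_le r2 s2 hm hQ h1Q.
apply: (convertible_test _ _ _ _ _ hc h1 h2).
- by have [] := density_pow n r1.
- by have [] := density_pow n s1.
- exact: density_pow.
- exact: density_pow.
- by have [] := density_pow n r1.
Qed.

Let small_exponent (A X Y K M E : R) :
  A + X + K <= M - Y -> E <= K -> - (M - Y) + (A + X) <= - E.
Proof. lra. Qed.

Let large_exponent (A X Y K M E F : R) :
  A + X + K <= M + Y -> F + E <= K -> - (M + Y) + (F + (A + X)) <= - E.
Proof. lra. Qed.

Let small_contra (x rE rQ e h : R) : 6 * e < x -> rQ - e <= rE ->
  h <= e -> 1 - rQ <= e -> x / 2 <= 1 - rE + h -> False.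
Proof. lra. Qed.

Let large_contra (u h rE rQ e e1 x : R) : 0 < e -> 8 * x < e -> 8 * e1 < e ->
  rQ - u <= rE -> u + e / 2 <= rQ -> h <= e1 -> rE <= h + 2 * x -> False.
Proof. lra. Qed.

Section Pairs.
Variables (a lam : R) (d1 d2 : nat).
Variables (rho1 sigma1 : 'M[C]_d1) (rho2 sigma2 : 'M[C]_d2).
Variables (d01 : nsdata rho1 sigma1) (d02 : nsdata rho2 sigma2) (m : nat -> nat) (r : R).
Hypotheses (ha : 0 < a < 1) (lam0 : 0 < lam).
Hypotheses (hr1 : density rho1) (hs1 : density sigma1).
Hypotheses (hr2 : density rho2) (hs2 : density sigma2).
Hypotheses (hV1 : 0 < relV rho1 sigma1) (hV2 : 0 < relV rho2 sigma2) (r0 : 0 < r).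
Hypothesis hm : forall e : R, 0 < e -> \forall n \near \oo, `|(m n)%:R / n%:R - r| <= e.
Hypothesis hm0 : \forall n \near \oo, (0 < m n)%N.

Local Notation D1 := (relD rho1 sigma1).
Local Notation D2 := (relD rho2 sigma2).
Local Notation L := (Ls a).
Local Notation N := (Ns a).
Local Notation s1 := (relV rho1 sigma1).
Local Notation s2 := (r * relV rho2 sigma2).
Local Notation eps n := (expR (- (L n * lam))).

Lemma id_ratio (e : R) : 0 < e -> \forall n \near \oo, `|n%:R / n%:R - 1| <= e :> R.
Proof.
by move=> e0; apply: filterS (near_gt0 R) => n n0; rewrite divff ?gt_eqF // subrr normr0 ltW.
Qed.

(** The pulled-back test has error at most 2 eps on rho1, one eps from the output test and one from
    the conversion; its weight on sigma1, rescaled by the threshold, is below eps thanks to the gap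
    [k * N n]. These three eps, doubled by the 1/2 in [bound_small], are beaten by a deviation z1 of
    rate below lam. *)
Lemma converse_small (x1 z1 x2 k : R) : z1 < x1 -> z1 ^+ 2 / (2 * s1) < lam ->
  0 <= x2 -> lam < x2 ^+ 2 / (2 * s2) -> 0 < k ->
  (\forall n \near \oo, n%:R * D1 + N n * x1 + k * N n <= (m n)%:R * D2 - N n * x2) ->
  \forall n \near \oo, forall m', (m n <= m')%N ->
    ~ convertible (rho1 ^t n) (sigma1 ^t n) (rho2 ^t m') (sigma2 ^t m') (eps n) 0.
Proof.
move=> zx1 hl1 x20 hl2 k0 hk.
have [dm1 [k1 g1]] := nsfamily_exists d01.
have [dm2 [k2 g2]] := nsfamily_exists d02.
pose e1 := (lam - z1 ^+ 2 / (2 * s1)) / 2.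
pose e2 := x2 ^+ 2 / (2 * s2) - lam.
have e10 : 0 < e1 by rewrite divr_gt0 // subr_gt0.
have e20 : 0 < e2 by rewrite subr_gt0.
have hB := @bound_small R a d1 rho1 sigma1 d01 dm1 k1 id 1 ha g1 hV1 ltr01 id_ratio
  x1 z1 e1 zx1 e10.
have hA := @test_small R a d2 rho2 sigma2 d02 dm2 k2 m r ha g2 hV2 r0 hm x2 e2 x20 e20.
have hl : z1 ^+ 2 / (2 * s1) + e1 < lam by rewrite /e1; lra.
apply: filterS (near_and (near_and hB hA) (near_and (near_and hk hm0)
  (near_and (near_expR 6 ha hl) (near_and (Ls_le_Ns ha lam k0) (Ls_gt0 a))))).
move=> n [[{}hB [Q [hQ h1Q hQr hQs]]] [[{}hk hmn] [hexp [hLN L0]]]] m' hm' hc.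
have hmm : (0 < m n <= m')%N by rewrite hmn.
have [E [hE h1E hEr hEs]] := convertible_pow_test hr1 hs1 hr2 hs2 hmm hQ h1Q hc.
have h1 : expR (n%:R * D1 + N n * x1) * ev (sigma2 ^t m n) Q <= eps n.
  rewrite mulrC; apply: le_trans (ler_wpM2r (expR_ge0 _) hQs) _.
  rewrite -expRD ler_expR; apply: small_exponent hk _.
  by rewrite mulrC.
have h2 : 1 - ev (rho2 ^t m n) Q <= eps n.
  apply: le_trans hQr _; rewrite ler_expR lerN2; apply: ler_wpM2l; first exact: ltW.
  by rewrite /e2 opprB addrCA subrr addr0.
have := hB E hE h1E; rewrite hEs mul1r.
exact: small_contra hexp hEr h1 h2.
Qed.

(** [err] is arbitrary because two regimes share the argument: error 1 - eps, and error eps when A1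
    <= A2. In both, the output test beats the conversion error by eps / 2, so the pulled-back test
    accepts rho1 with probability at least eps / 2, too much for its small weight on sigma1. *)
Lemma converse_large (err : nat -> R) (x1 z1 y k : R) : 0 <= z1 < x1 ->
  lam < z1 ^+ 2 / (2 * s1) -> 0 < k ->
  (\forall n \near \oo, exists Q : 'M[C]_(d2 ^ m n), [/\ psd Q, psd (1%:M - Q),
     err n + eps n / 2 <= ev (rho2 ^t m n) Q &
     ev (sigma2 ^t m n) Q <= expR (- ((m n)%:R * D2 + N n * y))]) ->
  (\forall n \near \oo, n%:R * D1 + N n * x1 + k * N n <= (m n)%:R * D2 + N n * y) ->
  \forall n \near \oo, forall m', (m n <= m')%N ->
    ~ convertible (rho1 ^t n) (sigma1 ^t n) (rho2 ^t m') (sigma2 ^t m') (err n) 0.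
Proof.
move=> hz1 hl1 k0 hQ hk.
have [dm1 [k1 g1]] := nsfamily_exists d01.
pose e1 := (z1 ^+ 2 / (2 * s1) - lam) / 2.
have e10 : 0 < e1 by rewrite divr_gt0 // subr_gt0.
have [B B0 hB] := @bound_large R a d1 rho1 sigma1 d01 dm1 k1 id 1 ha g1 hV1 ltr01 id_ratio
  x1 z1 e1 hz1 e10.
have hl : lam < z1 ^+ 2 / (2 * s1) - e1 by rewrite /e1; lra.
have hl2 : lam < lam + 1 by rewrite ltrDl.
apply: filterS (near_and (near_and hB hQ) (near_and (near_and hk hm0)
  (near_and (near_and (near_expR 8 ha hl) (near_expR 8 ha hl2))
    (near_and (Ls_le_Ns ha (B + (lam + 1)) k0) (Ls_gt0 a))))).
move=> n [[{}hB [Q [{}hQ h1Q hQr hQs]]] [[{}hk hmn] [[hexp hexp2] [hLN L0]]]] m' hm' hc.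
have hmm : (0 < m n <= m')%N by rewrite hmn.
have [E [hE h1E hEr hEs]] := convertible_pow_test hr1 hs1 hr2 hs2 hmm hQ h1Q hc.
have h1 : expR (B * L n) * (expR (n%:R * D1 + N n * x1) * ev (sigma2 ^t m n) Q)
    <= expR (- (L n * (lam + 1))).
  rewrite mulrA -expRD mulrC; apply: le_trans (ler_wpM2r (expR_ge0 _) hQs) _.
  rewrite -expRD ler_expR; apply: large_exponent hk _.
  by rewrite [L n * _]mulrC -mulrDl.
have := hB E hE h1E; rewrite hEs mul1r.
exact: large_contra (expR_gt0 _) hexp hexp2 hEr hQr h1.
Qed.

End Pairs.
End Converse.

(** * Achievability *)

Section Achieve.
Variable R : realType.
Local Notation C := (R[i]).

(** In a common eigenbasis the overlap matrix is the identity, so the Nussbaum-Szkola distribution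
    sits on the diagonal. *)
Lemma pr_diag n (rho sigma : 'M[C]_n) (d : nsdata rho sigma) (E : pred R) :
  nsU d = nsV d -> pr d E = \sum_(x | E (nsy d (x, x))) nsp d x.
Proof.
move=> hUV; rewrite /pr big_mkcond /= [RHS]big_mkcond /=.
have [hU _] := ns_rho d.
rewrite -(pair_bigA _ (fun i j => if E (nsy d (i, j)) then nsw d (i, j) else 0)) /=.
have hw i j : nsw d (i, j) = if j == i then nsp d i else 0.
  rewrite /nsw /nsW -hUV (unitaryC hU) /= mxE; case: eqP => _.
    by rewrite nsq1 mulr1.
  by rewrite nsq0 mulr0.
apply: eq_bigr => i _; rewrite (bigD1 i) //= big1 ?addr0; last first.
  by move=> j hj; rewrite hw (negbTE hj); case: ifP.
by rewrite hw eqxx.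
Qed.

(** The bins are (b r.+1, b r], from the top down. The condition on [1 - pr da] is that of
    [greedy_povm] read through complements: what the r-th test misses is covered by the allowed
    error and the later bins. *)
Lemma convert_thresholds n d (rho sigma : 'M[C]_n) (rho' sigma' : 'M[C]_d)
    (da : nsdata rho sigma) (db : nsdata rho' sigma')
    (K : nat) (w b : nat -> R) (eps : R) :
  density rho -> density sigma -> nsU db = nsV db ->
  (forall r r', (r <= r')%N -> b r' <= b r) ->
  (forall r, (r < K)%N -> 0 < pr db (fun y => (b r.+1 < y) && (y <= b r))) ->
  (forall r, (r < K)%N -> (\sum_(0 <= s < r.+1) expR (- w s)) * expR (b r) <=
     2^-1 * pr db (fun y => (b r.+1 < y) && (y <= b r))) ->
  (forall r, (r < K)%N -> 1 - pr da (fun y => w r <= y) <=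
     eps + pr db (fun y => (b K < y) && (y <= b r.+1))) ->
  1 - pr db (fun y => (b K < y) && (y <= b 0%N)) <= eps ->
  convertible rho sigma rho' sigma' eps 0.
Proof.
move=> hr hs hUV hb ht0 hh h3 h4.
pose y x := nsy db (x, x).
(* Without a match [find] returns the length [K], the same value as for ratios above b 0: both mean
   no bin. *)
pose bin x := if y x <= b 0%N then find (fun r => b r.+1 < y x) (iota 0 K) else K.
have bin_lt x : (bin x < K)%N -> (b (bin x).+1 < y x) && (y x <= b (bin x)).
  rewrite /bin; case: ifP => [h0|_]; last by rewrite ltnn.
  set f := find _ _ => hf.
  have hhas : has (fun r => b r.+1 < y x) (iota 0 K) by rewrite has_find size_iota.
  have := nth_find 0%N hhas; rewrite nth_iota // add0n => -> /=.
  case E: f => [//|g]; have hg : (g < f)%N by rewrite E.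
  have := before_find 0%N hg; rewrite nth_iota ?add0n; last by rewrite (ltn_trans hg).
  by move=> /negbT; rewrite -leNgt.
have bin_gt x r : (r < K)%N -> b K < y x -> y x <= b r -> (r <= bin x < K)%N.
  move=> hrK hK hxr; rewrite /bin (le_trans hxr (hb 0%N r isT)).
  apply/andP; split.
    rewrite leqNgt; apply/negP => hlt.
    have hhas : has (fun r => b r.+1 < y x) (iota 0 K).
      by rewrite has_find size_iota (ltn_trans hlt).
    have := nth_find 0%N hhas; rewrite nth_iota; last by rewrite (ltn_trans hlt).
    by rewrite add0n ltNge (le_trans hxr) // hb.
  have hhas : has (fun r => b r.+1 < y x) (iota 0 K).
    apply/hasP; exists K.-1; first by rewrite mem_iota /= add0n prednK // (leq_ltn_trans _ hrK).
    by rewrite prednK // (leq_ltn_trans _ hrK).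
  by rewrite has_find size_iota in hhas.
have bin_eq x r : (r < K)%N -> b r.+1 < y x -> y x <= b r -> bin x = r.
  move=> hrK h1 h2; have hK : b K < y x by apply: le_lt_trans h1; exact: hb.
  have /andP[h5 h6] := bin_gt x r hrK hK h2.
  apply/eqP; rewrite eqn_leq h5 andbT leqNgt; apply/negP => hlt.
  have /andP[_ h7] := bin_lt x h6.
  by move: h1; rewrite ltNge (le_trans h7) // hb.
pose t r := \sum_(x | bin x == r) nsp db x.
have tE r : (r < K)%N -> t r = pr db (fun y => (b r.+1 < y) && (y <= b r)).
  move=> hrK; rewrite pr_diag //; apply: eq_bigl => x; rewrite -/(y x).
  apply/eqP/andP => [e|[h1 h2]]; last exact: bin_eq.
  by apply/andP; rewrite -e; apply: bin_lt; rewrite e.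
have tge0 r : 0 <= t r by apply: sumr_ge0 => x _; exact: nsp_ge0.
have tsum r : (r < K)%N \/ r = K -> pr db (fun y => (b K < y) && (y <= b r)) <=
    \sum_(r <= s < K) t s.
  move=> hrK; rewrite pr_diag //.
  have -> : \sum_(r <= s < K) t s =
      \sum_x \sum_(r <= s < K) (if s == bin x then nsp db x else 0).
    rewrite exchange_big; apply: eq_bigr => s _ /=; rewrite /t big_mkcond.
    by apply: eq_bigr => x _; rewrite eq_sym.
  rewrite big_mkcond; apply: ler_sum => x _; rewrite -/(y x) -big_mkcond big_nat1_eq.
  case: ifP => [/andP[h1 h2]|_]; last by case: ifP => // _; exact: nsp_ge0.
  case: hrK => hrK; first by rewrite bin_gt.
  by move: h1; rewrite -hrK ltNge h2.
(* The shortfall allowed inside the bins: the error minus the mass that lies in no bin. *)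
pose E := eps - 1 + \sum_(0 <= s < K) t s.
have E0 : 0 <= E.
  have h : pr db (fun y => (b K < y) && (y <= b 0%N)) <= \sum_(0 <= s < K) t s.
    by apply: tsum; case: (K) => [|k]; [right|left].
  by rewrite /E; lra.
pose c r := expR (w r).
have c0 r : 0 < c r by exact: expR_gt0.
have [S [S1 S2 S3 S4]] := nested_tests da c0.
have Spsd r : psd (S r) by have [] := S1 r.
have hgreedy r : (r < K)%N -> \sum_(0 <= s < r.+1) t s <= ev rho (S r) + E.
  move=> hrK; rewrite /E (big_cat_nat (leq0n r.+1) hrK) /=.
  have h5 : pr db (fun y => (b K < y) && (y <= b r.+1)) <= \sum_(r.+1 <= s < K) t s.
    by apply: tsum; move: hrK; rewrite leq_eqVlt => /orP[/eqP|]; [right|left].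
  have h6 := h3 r hrK; have h7 := S3 r; rewrite /c expRK in h7.
  move: h5 h6 h7; move: (pr _ _) (pr _ _) (ev _ _) (\sum_(_ <= _ < _) _) (\sum_(_ <= _ < _) _).
  by move=> *; lra.
have SS r : psd (S r.+1 - S r) by apply: S2.
have [Y [Y1 Y2 Y3 Y4 Y5]] := greedy_povm hr.1 Spsd SS tge0 E0 hgreedy.
have [hV hsig] := ns_sigma db; have [_ hrho] := ns_rho db.
rewrite hUV in hrho.
suff : convertible rho sigma (nsV db *m dg (nsp db) *m adj (nsV db))
    (nsV db *m dg (nsr db) *m adj (nsV db)) eps 0 by rewrite -hrho -hsig.
apply: (convert_bins hr hs hV (nsp_ge0 db) (nsr_ge0 db) (nsp_sum db) (nsr_sum db)
  (Y := Y) (K := K) (bin := bin)).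
- exact: Y1.
- have -> : 1%:M - \sum_(0 <= r < K) Y r =
      (1%:M - S K.-1) + (S K.-1 - \sum_(0 <= r < K) Y r) by rewrite addrA subrK.
  by apply: psdD; [have [] := S1 K.-1|].
- by move=> r hrK; rewrite -/(t r) tE // ht0.
- exact: Y3.
- move=> x hx; rewrite -/(t (bin x)); have /andP[b1 b2] := bin_lt x hx.
  have [p0|p0] := eqVneq (nsp db x) 0.
    by rewrite p0 mulr0 !mulr_ge0 // nsr_ge0.
  have hw : nsw db (x, x) != 0.
    by rewrite /nsw /nsW /= hUV (unitaryC hV) mxE eqxx nsq1 mulr1.
  rewrite (nsw_expR hw) /= -/(y x) mulrA; apply: ler_wpM2r; first exact: nsr_ge0.
  have h5 : ev sigma (Y (bin x)) <= \sum_(0 <= s < (bin x).+1) expR (- w s).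
    apply: le_trans (ev_le hs.1 (Y2 _ hx)) _; apply: le_trans (S4 _) _.
    by apply: ler_sum => s _; rewrite /c expRN.
  rewrite tE //; apply: le_trans (hh _ hx).
  apply: ler_pM; [|exact: expR_ge0|exact: h5|by rewrite ler_expR].
  by apply: ev_ge0; [exact: hs.1|exact: Y1].
- move: Y5; rewrite sumrB /E.
  by move: (\sum_(0 <= s < K) t s) (\sum_(0 <= r < K) ev rho (Y r)) => u1 u2; lra.
Qed.

End Achieve.

(** The number of bins is fixed independently of n, which allows the rates to be compared bin by
    bin. *)
Lemma near_forall_lt (K : nat) (P : nat -> nat -> Prop) :
  (forall r, (r < K)%N -> \forall n \near \oo, P r n) ->
  \forall n \near \oo, forall r, (r < K)%N -> P r n.
Proof.
elim: K => [_|K IH h]; first by apply: nearW.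
have h1 := IH (fun r hr => h r (ltnW hr)).
apply: filterS2 h1 (h K (ltnSn K)) => n h2 h3 r.
by rewrite ltnS leq_eqVlt => /orP[/eqP ->//|/h2].
Qed.

Section Achievability.
Variables (R : realType) (a lam : R) (d1 d2 : nat).
Local Notation C := (R[i]).
Variables (rho1 sigma1 : 'M[C]_d1) (rho2 sigma2 : 'M[C]_d2).
Variables (d01 : nsdata rho1 sigma1) (d02 : nsdata rho2 sigma2).
Variables (dm1 : nsfamily rho1 sigma1) (dm2 : nsfamily rho2 sigma2) (k1 k2 : nat).
Variables (m : nat -> nat) (r0 : R).
Hypotheses (ha : 0 < a < 1) (lam0 : 0 < lam).
Hypotheses (g1 : good_family d01 dm1 k1%:R) (g2 : good_family d02 dm2 k2%:R).
Hypotheses (hr1 : density rho1) (hs1 : density sigma1).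
Hypotheses (hV1 : 0 < relV rho1 sigma1) (hV2 : 0 < relV rho2 sigma2) (r00 : 0 < r0).
Hypothesis hm : forall e : R, 0 < e -> \forall n \near \oo, `|(m n)%:R / n%:R - r0| <= e.
Hypothesis hUV : nsU d02 = nsV d02.

Local Notation D1 := (relD rho1 sigma1).
Local Notation D2 := (relD rho2 sigma2).
Local Notation L := (Ls a).
Local Notation N := (Ns a).
Local Notation s1 := (relV rho1 sigma1).
Local Notation s2 := (r0 * relV rho2 sigma2).
Local Notation eps n := (expR (- (L n * lam))).

Let Pin n (E : pred R) : R := \sum_(z | E (@nsx R a d1 rho1 sigma1 dm1 id n z)) nsw (dm1 n) z.
Let Pout n (E : pred R) : R := \sum_(z | E (@nsx R a d2 rho2 sigma2 dm2 m n z)) nsw (dm2 (m n)) z.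

(** A bin has mass at least expR (- (L n * A r)), with A r one more than the rate of its midpoint.
    This is far above expR (- (k * N n)), so a gap k between the thresholds settles the condition on
    sigma, and only tails on rho remain to be compared. *)
Lemma achieve_thresholds (err : nat -> R) (K : nat) (b w : nat -> R) (k : R) :
  (forall r, b r.+1 < b r) -> (forall r, w r.+1 <= w r) -> 0 < k ->
  (\forall n \near \oo, forall r, (r < K)%N ->
     (m n)%:R * D2 + N n * b r + k * N n <= n%:R * D1 + N n * w r) ->
  (forall r, (r < K)%N -> \forall n \near \oo,
     1 - Pin n (fun x => w r <= x) <=
     err n + Pout n (fun x => (b K < x) && (x <= b r.+1))) ->
  (\forall n \near \oo, 1 - Pout n (fun x => (b K < x) && (x <= b 0%N)) <= err n) ->
  \forall n \near \oo,
    convertible (rho1 ^t n) (sigma1 ^t n) (rho2 ^t m n) (sigma2 ^t m n) (err n) 0.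
Proof.
move=> hb hw k0 hk h3 h4.
pose z r := (b r.+1 + b r) / 2.
have hz r : b r.+1 < z r < b r by have := hb r; rewrite /z => h; apply/andP; split; lra.
pose A r := z r ^+ 2 / (2 * s2) + 1.
have hlow r : (r < K)%N -> \forall n \near \oo, expR (- (L n * A r)) <=
    Pout n (fun x => (b r.+1 < x) && (x < b r)).
  by move=> _; exact: (nsx_lower ha g2 hV2 r00 hm (hz r) ltr01).
have hN r : (r < K)%N -> \forall n \near \oo,
    (A r + 1) * L n <= k * N n /\ 2 * K%:R * expR (- (L n * (A r + 1))) < expR (- (L n * A r)).
  by move=> _; apply: near_and (Ls_le_Ns ha _ k0) (near_expR _ ha _); rewrite ltrDl.
apply: filterS (near_and (near_and hk (near_forall_lt h3)) (near_and (near_and h4 (Ns_gt0 a))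
  (near_and (near_forall_lt hlow) (near_forall_lt hN)))).
move=> n [[{}hk {}h3] [[{}h4 N0] [{}hlow {}hN]]].
have bmono r r' : (r <= r')%N -> b r' <= b r.
  elim: r' => [|r' IH]; first by rewrite leqn0 => /eqP ->.
  by rewrite leq_eqVlt => /orP[/eqP ->//|/IH]; apply: le_trans; exact: ltW.
have wmono r r' : (r <= r')%N -> w r' <= w r.
  elim: r' => [|r' IH]; first by rewrite leqn0 => /eqP ->.
  by rewrite leq_eqVlt => /orP[/eqP ->//|/IH]; apply: le_trans.
pose bn r := (m n)%:R * D2 + N n * b r.
pose wn r := n%:R * D1 + N n * w r.
have eP u v : pr (dm2 (m n)) (fun y => (bn u < y) && (y <= bn v)) =
    Pout n (fun x => (b u < x) && (x <= b v)).
  apply: eq_bigl => x /=; rewrite ltNge [b u < _]ltNge.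
  by rewrite !(nsx_le dm2 _ x N0).
have ePin r : pr (dm1 n) (fun y => wn r <= y) = Pin n (fun x => w r <= x).
  by apply: eq_bigl => x /=; rewrite (@nsx_ge R a d1 rho1 sigma1 dm1 id n _ x N0).
have tlow r : (r < K)%N -> expR (- (L n * A r)) <=
    Pout n (fun x => (b r.+1 < x) && (x <= b r)).
  move=> hrK; apply: le_trans (hlow r hrK) _; apply: sum_le_pred => x.
  by move=> /andP[-> /ltW ->].
have [_ _ hUVm] := g2 (m n).
apply: (@convert_thresholds R _ _ _ _ _ _ (dm1 n) (dm2 (m n)) K wn bn).
- exact: density_pow.
- exact: density_pow.
- exact: hUVm.
- by move=> r r' hrr; rewrite /bn lerD2l ler_pM2l // bmono.
- by move=> r hrK; rewrite eP; apply: lt_le_trans (tlow r hrK); exact: expR_gt0.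
- move=> r hrK; rewrite eP.
  apply: (@le_trans _ _ (2^-1 * expR (- (L n * A r)))); last first.
    by rewrite ler_pM2l // tlow.
  have [hN1 hN2] := hN r hrK.
  apply: (@le_trans _ _ (K%:R * expR (- (L n * (A r + 1))))); last by lra.
  apply: (@le_trans _ _ (K%:R * expR (- wn r) * expR (bn r))).
    apply: ler_wpM2r; first exact: expR_ge0.
    apply: (@le_trans _ _ (\sum_(0 <= s < r.+1) expR (- wn r))).
      rewrite !big_mkord; apply: ler_sum => s _; rewrite ler_expR lerN2 /wn lerD2l.
      by rewrite ler_pM2l // wmono // -ltnS.
    rewrite sumr_const_nat subn0 -[X in X <= _]mulr_natl; apply: ler_wpM2r; first exact: expR_ge0.
    by rewrite ler_nat.
  rewrite -mulrA -expRD; apply: ler_wpM2l; rewrite ?ler0n // ler_expR.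
  have := hk r hrK; rewrite -/(bn r) -/(wn r); move: hN1; rewrite mulrC.
  by move: (k * N n) (L n * _) (bn r) (wn r) => u1 u2 u3 u4; lra.
- by move=> r hrK; rewrite ePin eP; exact: h3.
- by rewrite eP.
Qed.

Variables (A1 A2 : R).
Hypotheses (A10 : 0 < A1) (A20 : 0 < A2).
Hypotheses (hA1 : A1 ^+ 2 = 2 * s1 * lam) (hA2 : A2 ^+ 2 = 2 * s2 * lam).

Let s2_gt0 : 0 < s2. Proof. exact: mulr_gt0. Qed.

Let PinC n E : 1 - Pin n E = Pin n (fun x => ~~ E x).
Proof.
rewrite -(nsw_sum (dm1 n)) (bigID (fun z => E (@nsx R a d1 rho1 sigma1 dm1 id n z))) /=.
by rewrite addrAC subrr add0r.
Qed.

Let PoutC n E : 1 - Pout n E = Pout n (fun x => ~~ E x).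
Proof.
rewrite -(nsw_sum (dm2 (m n))) (bigID (fun z => E (@nsx R a d2 rho2 sigma2 dm2 m n z))) /=.
by rewrite addrAC subrr add0r.
Qed.

Let Pin_sub n (E F : pred R) : (forall x, E x -> F x) -> Pin n E <= Pin n F.
Proof. by move=> h; apply: (@sum_le_pred _ _ _ _ dm1 id n) => z; exact: h. Qed.

Let Pout_sub n (E F : pred R) : (forall x, E x -> F x) -> Pout n E <= Pout n F.
Proof. by move=> h; apply: (@sum_le_pred _ _ _ _ dm2 m n) => z; exact: h. Qed.

Let Pout_subU n (E F G : pred R) : (forall x, E x -> F x || G x) ->
  Pout n E <= Pout n F + Pout n G.
Proof.
move=> h; rewrite /Pout [X in X <= _]big_mkcond [X in _ <= X + _]big_mkcond.
rewrite [X in _ <= _ + X]big_mkcond -big_split /=; apply: ler_sum => z _.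
have := nsw_ge0 (dm2 (m n)) z; move: (nsx _ _ _) (nsw _ _) => x v v0.
case: ifP => [/h|_]; first by case: (F x) => /=; case: (G x) => //= _; lra.
by case: (F x); case: (G x); lra.
Qed.

Let Pin_lower z z1 z2 l : z1 < z < z2 -> z ^+ 2 / (2 * s1) < l ->
  \forall n \near \oo, expR (- (L n * l)) <= Pin n (fun x => (z1 < x) && (x < z2)).
Proof.
move=> hz hl; have e0 : 0 < l - z ^+ 2 / (2 * s1) by rewrite subr_gt0.
have := nsx_lower ha g1 hV1 ltr01 (@id_ratio R) hz e0; rewrite mul1r.
by apply: filterS => n; rewrite addrC subrK.
Qed.

Let Pout_lower z z1 z2 l : z1 < z < z2 -> z ^+ 2 / (2 * s2) < l ->
  \forall n \near \oo, expR (- (L n * l)) <= Pout n (fun x => (z1 < x) && (x < z2)).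
Proof.
move=> hz hl; have e0 : 0 < l - z ^+ 2 / (2 * s2) by rewrite subr_gt0.
have := nsx_lower ha g2 hV2 r00 hm hz e0.
by apply: filterS => n; rewrite addrC subrK.
Qed.

Let Pin_upperN z l : 0 <= z -> l < z ^+ 2 / (2 * s1) ->
  \forall n \near \oo, Pin n (fun x => x <= - z) <= expR (- (L n * l)).
Proof.
move=> hz hl; have e0 : 0 < z ^+ 2 / (2 * s1) - l by rewrite subr_gt0.
have := nsx_upperN ha g1 hV1 ltr01 (@id_ratio R) hz e0; rewrite mul1r.
by apply: filterS => n; rewrite opprB addrCA subrr addr0.
Qed.

Let Pout_upperN z l : 0 <= z -> l < z ^+ 2 / (2 * s2) ->
  \forall n \near \oo, Pout n (fun x => x <= - z) <= expR (- (L n * l)).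
Proof.
move=> hz hl; have e0 : 0 < z ^+ 2 / (2 * s2) - l by rewrite subr_gt0.
have := nsx_upperN ha g2 hV2 r00 hm hz e0.
by apply: filterS => n; rewrite opprB addrCA subrr addr0.
Qed.

Let Pout_upper z l : 0 <= z -> l < z ^+ 2 / (2 * s2) ->
  \forall n \near \oo, Pout n (fun x => z <= x) <= expR (- (L n * l)).
Proof.
move=> hz hl; have e0 : 0 < z ^+ 2 / (2 * s2) - l by rewrite subr_gt0.
have := nsx_upper ha g2 hV2 r00 hm hz e0.
by apply: filterS => n; rewrite opprB addrCA subrr addr0.
Qed.

Let rate1_lt z : `|z| < A1 -> z ^+ 2 / (2 * s1) < lam.
Proof. exact: rate_lt_lam. Qed.
Let rate2_lt z : `|z| < A2 -> z ^+ 2 / (2 * s2) < lam.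
Proof. exact: rate_lt_lam. Qed.
Let rate1_gt z : A1 < z -> lam < z ^+ 2 / (2 * s1).
Proof. exact: rate_gt_lam. Qed.
Let rate2_gt z : A2 < z -> lam < z ^+ 2 / (2 * s2).
Proof. exact: rate_gt_lam. Qed.
Let rate2E y : y ^+ 2 / (2 * s2) = (y * (A1 / A2)) ^+ 2 / (2 * s1).
Proof.
rewrite exprMn expr_div_n hA1 hA2; field.
by rewrite !gt_eqF.
Qed.
Let rate_lt x y : 0 <= x -> x < y * (A1 / A2) -> x ^+ 2 / (2 * s1) < y ^+ 2 / (2 * s2).
Proof.
move=> x0 h; by rewrite rate2E ltr_pM2r ?invr_gt0 ?mulr_gt0 // ltrXn2r.
Qed.
Let rate_gt x y : 0 <= y -> y * (A1 / A2) < x -> y ^+ 2 / (2 * s2) < x ^+ 2 / (2 * s1).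
Proof.
move=> y0 h; have y1 : 0 <= y * (A1 / A2) by rewrite mulr_ge0 // divr_ge0 // ltW.
by rewrite rate2E ltr_pM2r ?invr_gt0 ?mulr_gt0 // ltrXn2r.
Qed.

(** Only mass eps has to be converted, so a single bin is enough: it ends at - A2 + dl, which makes
    it more likely than eps, and it is filled from input deviations above A1 - dl. *)
Lemma achieve_large e : 0 < e ->
  (\forall n \near \oo, (m n)%:R * D2 <= n%:R * D1 + (A1 + A2 - e) * N n) ->
  \forall n \near \oo, convertible (rho1 ^t n) (sigma1 ^t n)
    (rho2 ^t m n) (sigma2 ^t m n) (1 - eps n) 0.
Proof.
move=> e0 hsh.
pose dl := Num.min (Num.min 1 (e / 4)) (Num.min (A1 / 2) (A2 / 2)).
have dl0 : 0 < dl by rewrite !lt_min ltr01 !divr_gt0.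
have [t1 t2 t3 t4] : [/\ dl <= 1, dl <= e / 4, dl <= A1 / 2 & dl <= A2 / 2].
  by rewrite /dl; split; rewrite !ge_min lexx ?orbT.
pose b (r : nat) : R := - A2 + dl - r%:R.
pose w (r : nat) : R := A1 - dl.
have e20 : 0 < e / 2 by rewrite divr_gt0.
apply: (@achieve_thresholds (fun n => 1 - eps n) 1 b w (e / 2)) => //.
- by move=> r; rewrite /b -natr1; lra.
- apply: filterS2 hsh (Ns_gt0 a) => n hn N0 [|//] _; rewrite /b /w subr0.
  rewrite -addrA; apply: le_trans (lerD hn (lexx _)) _; rewrite -addrA lerD2l -subr_ge0.
  rewrite (_ : _ - _ = N n * (e / 2 - 2 * dl)); last by field.
  by rewrite mulr_ge0 ?(ltW N0) //; lra.
- move=> [|//] _.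
  have hz : A1 - dl < A1 - dl / 2 < A1 by apply/andP; split; lra.
  have hr : (A1 - dl / 2) ^+ 2 / (2 * s1) < lam.
    by apply: rate1_lt; rewrite ger0_norm; lra.
  apply: filterS (Pin_lower hz hr) => n hn.
  have h1 : Pin n (fun x => (A1 - dl < x) && (x < A1)) <= Pin n (fun x => w 0%N <= x).
    by apply: Pin_sub => x /andP[/ltW].
  have h2 : 0 <= Pout n (fun x => (b 1%N < x) && (x <= b 1%N)).
    by apply: sumr_ge0 => z _; exact: nsw_ge0.
  move: h1 h2 hn; move: (Pin _ _) (Pin _ _) (Pout _ _) (eps n) => u1 u2 u3 u4; lra.
- have hz : b 1%N < - A2 + dl / 2 < b 0%N by rewrite /b; apply/andP; split; lra.
  have hr : (- A2 + dl / 2) ^+ 2 / (2 * s2) < lam.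
    by apply: rate2_lt; rewrite ltr0_norm; lra.
  apply: filterS (Pout_lower hz hr) => n hn.
  have h1 : Pout n (fun x => (b 1%N < x) && (x < b 0%N)) <=
            Pout n (fun x => (b 1%N < x) && (x <= b 0%N)).
    by apply: Pout_sub => x /andP[-> /ltW].
  move: h1 hn; move: (Pout _ _) (Pout _ _) (eps n) => u1 u2 u3; lra.
Qed.

(** The output threshold b r.+1 and the input threshold w r differ by - |A1 - A2| up to order e.
    Quantile matching then makes the input below w r rarer than the output below b r.+1, up to an
    error eps. *)
Lemma achieve_small e : 0 < e ->
  (\forall n \near \oo, (m n)%:R * D2 <= n%:R * D1 + (- `|A1 - A2| - e) * N n) ->
  \forall n \near \oo, convertible (rho1 ^t n) (sigma1 ^t n)
    (rho2 ^t m n) (sigma2 ^t m n) (eps n) 0.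
Proof.
move=> e0 hsh.
set kap := `|A1 - A2| in hsh; have kap0 : 0 <= kap by exact: normr_ge0.
pose q := A1 / A2; have q0 : 0 < q by rewrite divr_gt0.
have q20 : 0 < q + 2 by lra.
(* The bins reach dl beyond A2 on both sides, where tails are rarer than eps; the extra offset kap *
   dl / A2 must stay below e / 4. *)
pose dl := e * A2 / (4 * (kap + 1)).
have dl0 : 0 < dl by rewrite divr_gt0 // mulr_gt0 // ltr_wpDl.
have hdl : kap * (dl / A2) <= e / 4.
  have -> : kap * (dl / A2) = e / 4 * (kap / (kap + 1)).
    by rewrite /dl; field; rewrite !gt_eqF // ltr_wpDl.
  rewrite -[X in _ <= X]mulr1; apply: ler_wpM2l; first by rewrite divr_ge0 // ltW.
  by rewrite ler_pdivrMr ?ltr_wpDl // mul1r lerDl.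
(* Chosen so that the width h of a bin satisfies h * (q + 2) <= e / 4. *)
pose K := (Num.truncn (8 * (A2 + dl) * (q + 2) / e)).+1.
pose h := 2 * (A2 + dl) / K%:R.
have K0 : 0 < K%:R :> R by rewrite ltr0n.
have h0 : 0 < h by rewrite divr_gt0 // mulr_gt0 // addr_gt0.
have hh : h * (q + 2) <= e / 4.
  have := truncnS_gt (8 * (A2 + dl) * (q + 2) / e); rewrite -/K ltr_pdivrMr // => hK.
  rewrite /h mulrAC ler_pdivrMr //; lra.
have hq : 0 <= h * q by rewrite mulr_ge0 // ltW.
have [hh1 hh2] : h * q <= e / 4 /\ 2 * h <= e / 4 by split; lra.
pose b (r : nat) : R := A2 + dl - r%:R * h.
pose w (r : nat) : R := - kap - e + b r + h.
have bS r : b r = b r.+1 + h by rewrite /b -natr1; ring.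
have bK : b K = - (A2 + dl) by rewrite /b /h; field; rewrite gt_eqF.
have bmono r r' : (r <= r')%N -> b r' <= b r.
  by move=> hr; rewrite /b lerD2l lerN2; apply: ler_wpM2r; [exact: ltW|rewrite ler_nat].
have key r : (r < K)%N -> w r <= b r.+1 * q - e / 2.
  move=> hr; have h1 : b K <= b r.+1 by exact: bmono.
  have h2 : b r.+1 <= A2 + dl.
    by rewrite /b gerDl oppr_le0 mulr_ge0 // ltW.
  have h3 : `|b r.+1| <= A2 + dl by rewrite ler_norml -bK h1.
  have h4 : `|b r.+1 * q - b r.+1| <= kap + e / 4.
    have -> : b r.+1 * q - b r.+1 = (A1 - A2) * (b r.+1 / A2).
      by rewrite /q; field; rewrite gt_eqF.
    rewrite normrM -/kap normrM normfV (gtr0_norm A20).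
    apply: (@le_trans _ _ (kap * ((A2 + dl) / A2))).
      by apply: ler_wpM2l => //; apply: ler_wpM2r; rewrite // invr_ge0 ltW.
    by rewrite mulrDl divff ?gt_eqF // mulrDr mulr1 lerD2l.
  move: h4; rewrite ler_norml => /andP[h5 _]; rewrite /w bS; lra.
have hAd : A2 < A2 + dl by rewrite ltrDl.
have lowK : \forall n \near \oo, Pout n (fun x => x <= b K) <= eps n / 2.
  have hr := rate2_gt hAd; pose l := (lam + (A2 + dl) ^+ 2 / (2 * s2)) / 2.
  have [l1 l2] : lam < l /\ l < (A2 + dl) ^+ 2 / (2 * s2) by split; rewrite midf_lt.
  have z0 : 0 <= A2 + dl by rewrite ltW // addr_gt0.
  rewrite bK; apply: filterS2 (Pout_upperN z0 l2) (near_expR 2 ha l1) => n.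
  by move: (Pout _ _) (eps n) (expR _) => u1 u2 u3; lra.
apply: (@achieve_thresholds (fun n => eps n) K b w h) => //.
- by move=> r; rewrite (bS r); lra.
- by move=> r; rewrite /w (bS r); lra.
- apply: filterS hsh => n hn r _; rewrite /w.
  rewrite -addrA; apply: le_trans (lerD hn (lexx _)) _.
  by rewrite -addrA lerD2l le_eqVlt; apply/predU1l; ring.
- move=> r hr; have kr := key r hr; set be := b r.+1 in kr *.
  have [be0|be0] := leP be 0.
    have hbq : be * q <= 0 by rewrite mulr_le0_ge0 // ltW.
    have w0 : 0 <= - w r by lra.
    have hPw n : 1 - Pin n (fun x => w r <= x) <= Pin n (fun x => x <= - - w r).
      by rewrite PinC opprK; apply: Pin_sub => x; rewrite -ltNge => /ltW.
    (* After the last bin nothing is left to compensate, so the lower input tail must itself be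
       below eps. Earlier, the next bin outweighs it, the midpoint of that bin having a smaller
       rate. *)
    move: hr; rewrite leq_eqVlt => /orP[/eqP hrK|hrK].
      have hA : A1 < - w r.
        have : be * q = - ((A2 + dl) * q) by rewrite /be hrK bK mulNr.
        have : A1 <= (A2 + dl) * q by rewrite mulrDl /q mulrCA divff ?gt_eqF // mulr1 lerDl mulr_ge0 // ltW.
        lra.
      apply: filterS (Pin_upperN w0 (rate1_gt hA)) => n hn.
      have h2 : 0 <= Pout n (fun x => (b K < x) && (x <= be)).
        by apply: sumr_ge0 => z _; exact: nsw_ge0.
      apply: le_trans (hPw n) _; apply: le_trans hn _.
      by rewrite lerDl.
    pose z := be - h / 2.
    have hz : b r.+2 < z < be.
      rewrite /z /be (bS r.+1); move: h0; move: (b _) (h); move=> x y y0.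
      by apply/andP; split; lra.
    have z0 : 0 <= - z by rewrite oppr_ge0 lerBlDr (le_trans be0) // add0r divr_ge0 // ltW.
    have hzw : - z * q < - w r.
      have -> : - z * q = - (be * q) + h * q / 2 by rewrite /z; ring.
      lra.
    have hrate := rate_gt z0 hzw; rewrite sqrrN in hrate.
    pose l := (z ^+ 2 / (2 * s2) + (- w r) ^+ 2 / (2 * s1)) / 2.
    have [l1 l2] : z ^+ 2 / (2 * s2) < l /\ l < (- w r) ^+ 2 / (2 * s1).
      by split; rewrite midf_lt.
    apply: filterS2 (Pin_upperN w0 l2) (Pout_lower hz l1) => n hn1 hn2.
    apply: le_trans (hPw n) _; apply: le_trans hn1 _; apply: le_trans hn2 _.
    apply: (@le_trans _ _ (Pout n (fun x => (b K < x) && (x <= be)))).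
      apply: Pout_sub => x /andP[h1 /ltW ->]; rewrite andbT.
      by apply: le_lt_trans h1; exact: bmono.
    by rewrite lerDr expR_ge0.
  (* For a positive threshold the complements are compared: the input above w r must outweigh the
     output above be, while eps covers the output below b K. The maximum with 0 stays on the branch
     where the rate increases. *)
  have hbq : 0 < be * q by rewrite mulr_gt0.
  pose z1 := Num.max (w r) 0.
  have z10 : 0 <= z1 by rewrite /z1 le_max lexx orbT.
  have z1w : w r <= z1 by rewrite /z1 le_max lexx.
  have z1b : z1 < be * q by rewrite /z1 gt_max hbq andbT; lra.
  pose z := (z1 + be * q) / 2.
  have hz : z1 < z < be * q by rewrite !midf_lt.
  have zb : z < be * (A1 / A2) by case/andP: hz.
  have z0 : 0 <= z by rewrite divr_ge0 // addr_ge0 // ltW.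
  have hrate := rate_lt z0 zb.
  pose l := (z ^+ 2 / (2 * s1) + be ^+ 2 / (2 * s2)) / 2.
  have [l1 l2] : z ^+ 2 / (2 * s1) < l /\ l < be ^+ 2 / (2 * s2).
    by split; rewrite midf_lt.
  apply: filterS3 (Pin_lower hz l1) (Pout_upper (ltW be0) l2) lowK => n hn1 hn2 hn3.
  have h1 : Pin n (fun x => (z1 < x) && (x < be * q)) <= Pin n (fun x => w r <= x).
    by apply: Pin_sub => x /andP[/ltW + _]; exact: le_trans.
  have h2 := PoutC n (fun x => (b K < x) && (x <= be)).
  have h3 : Pout n (fun x => ~~ ((b K < x) && (x <= be))) <=
     Pout n (fun x => x <= b K) + Pout n (fun x => be <= x).
    apply: Pout_subU => x; rewrite negb_and -leNgt -ltNge.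
    by case/orP => [->//|/ltW ->]; rewrite orbT.
  have h4 := expR_ge0 (- (L n * lam)).
  move: h1 h2 h3 hn1 hn2 hn3 h4.
  move: (Pin _ _) (Pin _ _) (Pout _ _) (Pout _ _) (Pout _ _) (Pout _ _) (eps n) (expR _).
  by move=> *; lra.
- have l1 := rate2_gt hAd; pose l := (lam + (A2 + dl) ^+ 2 / (2 * s2)) / 2.
  have [l2 l3] : lam < l /\ l < (A2 + dl) ^+ 2 / (2 * s2) by split; rewrite midf_lt.
  have z0 : 0 <= A2 + dl by rewrite ltW // addr_gt0.
  apply: filterS3 (Pout_upper z0 l3) (near_expR 2 ha l2) lowK => n hn1 hn2 hn3.
  rewrite PoutC.
  have b0 : b 0%N = A2 + dl by rewrite /b mul0r subr0.
  have h3 : Pout n (fun x => ~~ ((b K < x) && (x <= b 0%N))) <=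
     Pout n (fun x => x <= b K) + Pout n (fun x => A2 + dl <= x).
    apply: Pout_subU => x; rewrite negb_and -leNgt -ltNge b0.
    by case/orP => [->//|/ltW ->]; rewrite orbT.
  apply: le_trans h3 _; move: hn1 hn2 hn3.
  by move: (Pout _ _) (Pout _ _) (eps n) (expR _) => u1 u2 u3 u4; lra.
Qed.

End Achievability.

(** * The second-order expansion *)

Section ConverseRates.
Variables (R : realType) (a lam : R) (d1 d2 : nat).
Local Notation C := (R[i]).
Variables (rho1 sigma1 : 'M[C]_d1) (rho2 sigma2 : 'M[C]_d2).
Variables (d01 : nsdata rho1 sigma1) (d02 : nsdata rho2 sigma2).
Variables (m : nat -> nat) (r0 : R).
Hypotheses (ha : 0 < a < 1) (lam0 : 0 < lam).
Hypotheses (hr1 : density rho1) (hs1 : density sigma1).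
Hypotheses (hr2 : density rho2) (hs2 : density sigma2).
Hypotheses (hV1 : 0 < relV rho1 sigma1) (hV2 : 0 < relV rho2 sigma2) (r00 : 0 < r0).
Hypothesis hm : forall e : R, 0 < e -> \forall n \near \oo, `|(m n)%:R / n%:R - r0| <= e.
Hypothesis hm0 : \forall n \near \oo, (0 < m n)%N.

Local Notation D1 := (relD rho1 sigma1).
Local Notation D2 := (relD rho2 sigma2).
Local Notation L := (Ls a).
Local Notation N := (Ns a).
Local Notation s1 := (relV rho1 sigma1).
Local Notation s2 := (r0 * relV rho2 sigma2).
Local Notation eps n := (expR (- (L n * lam))).

Variables (A1 A2 : R).
Hypotheses (A10 : 0 < A1) (A20 : 0 < A2).
Hypotheses (hA1 : A1 ^+ 2 = 2 * s1 * lam) (hA2 : A2 ^+ 2 = 2 * s2 * lam).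

Let s2_gt0 : 0 < s2. Proof. exact: mulr_gt0. Qed.

Let no_conversion (err : nat -> R) := \forall n \near \oo, forall m', (m n <= m')%N ->
  ~ convertible (rho1 ^t n) (sigma1 ^t n) (rho2 ^t m') (sigma2 ^t m') (err n) 0.

Let shift c := \forall n \near \oo, n%:R * D1 + c * N n <= (m n)%:R * D2.

Let shiftP c x y k : shift c -> x + k <= c + y ->
  \forall n \near \oo, n%:R * D1 + N n * x + k * N n <= (m n)%:R * D2 + N n * y.
Proof.
move=> h hc; apply: filterS2 h (Ns_gt0 a) => n hn N0.
rewrite -addrA [k * _]mulrC -mulrDr.
apply: le_trans (lerD (lexx _) (ler_wpM2l (ltW N0) hc)) _.
by rewrite mulrDr addrA [N n * c]mulrC lerD2r.
Qed.

(** Lower tails are compared: the output test at - A2 - dl has error below eps, no input test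
    achieves this at - A1 + dl, and these thresholds differ by A1 - A2 up to small terms. *)
Lemma no_conversion_small_le (e : R) : 0 < e -> A2 <= A1 -> shift (- `|A1 - A2| + e) ->
  no_conversion (fun n => eps n).
Proof.
move=> e0 hA; rewrite ger0_norm ?subr_ge0 // => hsh.
pose dl := Num.min (e / 4) A1.
have dl0 : 0 < dl by rewrite lt_min A10 divr_gt0.
have [t1 t2] : dl <= e / 4 /\ dl <= A1 by rewrite /dl; split; rewrite ge_min lexx ?orbT.
have hz : - A1 + dl / 2 < - A1 + dl by lra.
have r1 : (- A1 + dl / 2) ^+ 2 / (2 * s1) < lam.
  by apply: (rate_lt_lam hV1 A10 hA1); rewrite ltr0_norm; lra.
have r2 : lam < (A2 + dl) ^+ 2 / (2 * s2).
  by apply: (rate_gt_lam s2_gt0 A20 hA2); rewrite ltrDl.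
have z2 : 0 <= A2 + dl by rewrite ltW // addr_gt0.
have k0 : 0 < e / 2 by rewrite divr_gt0.
apply: (converse_small d01 d02 ha hr1 hs1 hr2 hs2 hV1 hV2 r00 hm hm0 hz r1 z2 r2 k0).
have hc : - A1 + dl + e / 2 <= - (A1 - A2) + e + - (A2 + dl) by lra.
by apply: filterS (shiftP hsh hc) => n; rewrite mulrN.
Qed.

(** Up to dl, [- c] is the threshold of the output test in units of [N]: c = - A2 for error eps when
    A1 <= A2, and c = A2 for error 1 - eps. *)
Let large_params (c e : R) : 0 < e -> shift (A1 + c + e) -> forall (err : nat -> R) dl,
  0 < dl -> dl <= e / 4 ->
  (\forall n \near \oo, exists Q : 'M[C]_(d2 ^ m n), [/\ psd Q, psd (1%:M - Q),
     err n + eps n / 2 <= ev (rho2 ^t m n) Q &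
     ev (sigma2 ^t m n) Q <= expR (- ((m n)%:R * D2 + N n * (- c - dl)))]) ->
  no_conversion err.
Proof.
move=> e0 hsh err dl dl0 t1 hQ.
have hz : 0 <= A1 + dl / 2 < A1 + dl by apply/andP; split; move: A10; lra.
have r1 : lam < (A1 + dl / 2) ^+ 2 / (2 * s1).
  by apply: (rate_gt_lam hV1 A10 hA1); rewrite ltrDl divr_gt0.
have k0 : 0 < e / 2 by rewrite divr_gt0.
apply: (converse_large d01 ha hr1 hs1 hr2 hs2 hV1 hm0 hz r1 k0 hQ).
by apply: shiftP hsh _; lra.
Qed.

(** Lower tails would only give + |A1 - A2| here. Instead, an output test just below A2 accepts with
    probability above 2 eps; after the conversion more than eps is left, which no input test reaches
    beyond A1. *)
Lemma no_conversion_small_ge (e : R) : 0 < e -> A1 <= A2 -> shift (- `|A1 - A2| + e) ->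
  no_conversion (fun n => eps n).
Proof.
move=> e0 hA; rewrite ler0_norm ?subr_le0 // opprK => hsh.
have [dm2 [k2 g2]] := nsfamily_exists d02.
pose dl := Num.min (e / 4) A2.
have dl0 : 0 < dl by rewrite lt_min A20 divr_gt0.
have [t1 t2] : dl <= e / 4 /\ dl <= A2 by rewrite /dl; split; rewrite ge_min lexx ?orbT.
apply: (large_params e0 hsh dl0 t1).
have hz : A2 - dl < A2 - dl / 2 by lra.
have r2 : (A2 - dl / 2) ^+ 2 / (2 * s2) < lam.
  by apply: (rate_lt_lam s2_gt0 A20 hA2); rewrite ger0_norm; lra.
pose eta := (lam - (A2 - dl / 2) ^+ 2 / (2 * s2)) / 2.
have eta0 : 0 < eta by rewrite divr_gt0 // subr_gt0.
have hl : (A2 - dl / 2) ^+ 2 / (2 * s2) + eta < lam by rewrite /eta; lra.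
apply: filterS2 (test_large ha g2 hV2 r00 hm hz eta0) (near_expR 2 ha hl).
move=> n [Q [hQ h1Q h1 h2]] h3; exists Q; split; [exact: hQ|exact: h1Q| |].
  by apply: le_trans h1; have := expR_gt0 (- (L n * lam)); move: h3;
    move: (eps n) (expR _) => u1 u2; lra.
by rewrite opprK.
Qed.

(** The output test below - A2 fails with probability at most eps / 2, so an acceptance of eps / 2
    survives the error 1 - eps; this limits the input threshold to A1. *)
Lemma no_conversion_large (e : R) : 0 < e -> shift (A1 + A2 + e) ->
  no_conversion (fun n => 1 - eps n).
Proof.
move=> e0 hsh.
have [dm2 [k2 g2]] := nsfamily_exists d02.
have dl0 : 0 < e / 4 by rewrite divr_gt0.
apply: (large_params e0 hsh dl0 (lexx _)).
have hz : 0 <= A2 + e / 4 by rewrite ltW // addr_gt0.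
have r2 : lam < (A2 + e / 4) ^+ 2 / (2 * s2).
  by apply: (rate_gt_lam s2_gt0 A20 hA2); rewrite ltrDl.
pose eta := ((A2 + e / 4) ^+ 2 / (2 * s2) - lam) / 2.
have eta0 : 0 < eta by rewrite divr_gt0 // subr_gt0.
have hl : lam < (A2 + e / 4) ^+ 2 / (2 * s2) - eta by rewrite /eta; lra.
apply: filterS2 (test_small ha g2 hV2 r00 hm hz eta0) (near_expR 2 ha hl).
move=> n [Q [hQ h1Q h1 h2]] h3; exists Q; split; [exact: hQ|exact: h1Q| |].
  move: h1 h3; move: (eps n) (expR _) (ev _ _) => u1 u2 u3; lra.
by rewrite -opprD mulrN.
Qed.

End ConverseRates.

(** * From conversions to bounds on the supremum [Rstar] *)

Section RstarBounds.
Variables (R : realType) (d1 d2 : nat).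
Local Notation C := (R[i]).
Variables (rho1 sigma1 : 'M[C]_d1) (rho2 sigma2 : 'M[C]_d2).

Let rates n eps := [set r : R | exists k : nat, r = k%:R / n%:R /\
  convertible (rho1 ^t n) (sigma1 ^t n) (rho2 ^t k) (sigma2 ^t k) eps 0].

(** The set of rates may be empty, with supremum 0, whence [0 <= B]. Its boundedness is returned as
    well, because [Rstar_ge] relies on it. *)
Lemma Rstar_le n eps (m : nat) (B : R) : 0 < n%:R :> R -> 0 <= B -> m%:R / n%:R <= B ->
  (forall k, (m <= k)%N ->
    ~ convertible (rho1 ^t n) (sigma1 ^t n) (rho2 ^t k) (sigma2 ^t k) eps 0) ->
  Rstar rho1 sigma1 rho2 sigma2 n eps <= B /\ has_ubound (rates n eps).
Proof.
move=> n0 B0 hB hno.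
have hub : ubound (rates n eps) B.
  move=> _ [k [-> hk]]; apply: le_trans hB.
  rewrite ler_pM2r ?invr_gt0 // ler_nat leqNgt; apply/negP => hlt.
  exact: (hno k (ltnW hlt)).
split; last by exists B.
rewrite /Rstar -/(rates n eps).
have [hne|hempty] := pselect (rates n eps !=set0); first exact: ge_sup.
by move/set0P/negP/negPn/eqP: hempty => ->; rewrite sup0.
Qed.

Lemma Rstar_ge n eps (m : nat) : has_ubound (rates n eps) ->
  convertible (rho1 ^t n) (sigma1 ^t n) (rho2 ^t m) (sigma2 ^t m) eps 0 ->
  m%:R / n%:R <= Rstar rho1 sigma1 rho2 sigma2 n eps.
Proof.
move=> hub hc; apply: ub_le_sup => //.
by exists m.
Qed.

End RstarBounds.

Section Sandwich.
Variables (R : realType) (a : R) (d1 d2 : nat).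
Local Notation C := (R[i]).
Variables (rho1 sigma1 : 'M[C]_d1) (rho2 sigma2 : 'M[C]_d2).
Hypothesis ha : 0 < a < 1.
Variables (D1 D2 : R).
Hypotheses (D10 : 0 < D1) (D20 : 0 < D2).

Lemma mseq_shift_ge (c e : R) : 0 < e -> \forall n \near \oo,
  n%:R * D1 + (c + e * D2 / 2) * Ns a n <= (mseq a D1 D2 (c + e * D2) n)%:R * D2.
Proof.
move=> e0; have k0 : 0 < e * D2 / 2 by rewrite divr_gt0 // mulr_gt0.
apply: filterS2 (mseq_shift ha (c + e * D2) D10 D20) (Ns_large ha (D2 / (e * D2 / 2))).
move=> n /andP[h1 _]; rewrite ler_pdivrMr // => h2.
apply: le_trans h1; rewrite lerD2l; move: h2; move: (Ns a n) => N; lra.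
Qed.

Lemma mseq_shift_le (c e : R) : \forall n \near \oo,
  (mseq a D1 D2 (c - e / 2 * D2) n)%:R * D2 <= n%:R * D1 + (c - e / 2 * D2) * Ns a n.
Proof. by apply: filterS (mseq_shift ha (c - e / 2 * D2) D10 D20) => n /andP[]. Qed.

Lemma Rstar_upper (err : nat -> R) (c e : R) : 0 < e ->
  (\forall n \near \oo, forall k, (mseq a D1 D2 (c + e * D2) n <= k)%N ->
    ~ convertible (rho1 ^t n) (sigma1 ^t n) (rho2 ^t k) (sigma2 ^t k) (err n) 0) ->
  \forall n \near \oo,
    Rstar rho1 sigma1 rho2 sigma2 n (err n) <= (D1 + c * gs a n) / D2 + e * gs a n /\
    has_ubound [set r : R | exists k : nat, r = k%:R / n%:R /\
      convertible (rho1 ^t n) (sigma1 ^t n) (rho2 ^t k) (sigma2 ^t k) (err n) 0].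
Proof.
move=> e0 h.
apply: filterS3 h (near_gt0 R) (mseq_itv ha (c + e * D2) D10 D20) => n h n0 /andP[h1 _].
have hB : (mseq a D1 D2 (c + e * D2) n)%:R / n%:R <= (D1 + c * gs a n) / D2 + e * gs a n.
  rewrite ler_pdivrMr // [leRHS]mulrC; apply: le_trans h1 _.
  rewrite le_eqVlt; apply/predU1l; by field; rewrite gt_eqF.
apply: (Rstar_le n0 _ hB h).
by apply: le_trans hB; rewrite divr_ge0 // ler0n.
Qed.

(** Half of e goes into the rate of [mseq]; the other half pays for the rounding, which costs less
    than 1 / n and is dominated by [gs] because [Ns] tends to infinity. *)
Lemma Rstar_lower (err : nat -> R) (c e : R) : 0 < e ->
  (\forall n \near \oo, has_ubound [set r : R | exists k : nat, r = k%:R / n%:R /\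
      convertible (rho1 ^t n) (sigma1 ^t n) (rho2 ^t k) (sigma2 ^t k) (err n) 0]) ->
  (\forall n \near \oo, convertible (rho1 ^t n) (sigma1 ^t n)
      (rho2 ^t (mseq a D1 D2 (c - e / 2 * D2) n))
      (sigma2 ^t (mseq a D1 D2 (c - e / 2 * D2) n)) (err n) 0) ->
  \forall n \near \oo,
    (D1 + c * gs a n) / D2 - e * gs a n <= Rstar rho1 sigma1 rho2 sigma2 n (err n).
Proof.
move=> e0 hub hc.
apply: filterS (near_and (near_and hub hc) (near_and (near_gt0 R)
  (near_and (mseq_itv ha (c - e / 2 * D2) D10 D20) (Ns_large ha (e / 2)^-1)))).
move=> n [[{}hub {}hc] [n0 [/andP[_ h1] h2]]].
apply: le_trans (Rstar_ge hub hc).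
rewrite ler_pdivlMr //.
have h3 : 1 <= e / 2 * Ns a n by rewrite -ler_pdivrMl ?mulr1 // divr_gt0.
rewrite -(Ns_gs a n0) in h3.
have e1 : n%:R * ((D1 + (c - e / 2 * D2) * gs a n) / D2) =
   ((D1 + c * gs a n) / D2 - e * gs a n) * n%:R + e / 2 * (n%:R * gs a n).
  by field; rewrite gt_eqF.
rewrite e1 in h1; move: h1 h3.
by move: (_ * n%:R) (e / 2 * _) => u1 u2; lra.
Qed.

End Sandwich.

Lemma sqrt_ratio_mul (R : realType) (lam V1 V2 D1 D2 : R) :
  0 < lam -> 0 < V1 -> 0 < V2 -> 0 < D1 -> 0 < D2 ->
  (Num.sqrt (V1 / D1 / (V2 / D2)))^-1 * Num.sqrt (2 * lam * V1) =
  Num.sqrt (2 * (D1 / D2 * V2) * lam).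
Proof.
move=> lam0 v1 v2 h1 h2.
have x0 : 0 <= V1 / D1 / (V2 / D2) by rewrite ltW // divr_gt0 // divr_gt0.
rewrite -sqrtrV // -sqrtrM ?invr_ge0 //; congr Num.sqrt.
by field; rewrite !gt_eqF.
Qed.

Theorem theorem3 (R : realType) (d1 d2 : nat)
  (rho1 sigma1 : 'M[R[i]]_d1) (rho2 sigma2 : 'M[R[i]]_d2) (a lam : R) :
  density rho1 -> density sigma1 -> density rho2 -> density sigma2 ->
  (forall v : 'cV[R[i]]_d1, sigma1 *m v = 0 -> rho1 *m v = 0) ->
  (forall v : 'cV[R[i]]_d2, sigma2 *m v = 0 -> rho2 *m v = 0) ->
  0 < relV rho1 sigma1 -> 0 < relV rho2 sigma2 ->
  0 < a < 1 -> 0 < lam ->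
  let eps (n : nat) := expR (- (lam * n%:R `^ a)) in
  let xi := (relV rho1 sigma1 / relD rho1 sigma1) /
            (relV rho2 sigma2 / relD rho2 sigma2) in
  let s (n : nat) := Num.sqrt (2 * lam * relV rho1 sigma1 * n%:R `^ (a - 1)) in
  let low (n : nat) :=
    (relD rho1 sigma1 - `|1 - (Num.sqrt xi)^-1| * s n) / relD rho2 sigma2 in
  let up (n : nat) :=
    (relD rho1 sigma1 + (1 + (Num.sqrt xi)^-1) * s n) / relD rho2 sigma2 in
  let g (n : nat) := Num.sqrt (n%:R `^ (a - 1)) in
  (* general case: upper bounds up to o(sqrt(n^(a-1))) *)
  ((forall e : R, 0 < e -> \forall n \near \oo,
      Rstar rho1 sigma1 rho2 sigma2 n (eps n) <= low n + e * g n) /\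
   (forall e : R, 0 < e -> \forall n \near \oo,
      Rstar rho1 sigma1 rho2 sigma2 n (1 - eps n) <= up n + e * g n)) /\
  (* commuting case: equalities up to o(sqrt(n^(a-1))) *)
  (rho2 *m sigma2 = sigma2 *m rho2 ->
   (forall e : R, 0 < e -> \forall n \near \oo,
      `|Rstar rho1 sigma1 rho2 sigma2 n (eps n) - low n| <= e * g n) /\
   (forall e : R, 0 < e -> \forall n \near \oo,
      `|Rstar rho1 sigma1 rho2 sigma2 n (1 - eps n) - up n| <= e * g n)).
Proof.
move=> hr1 hs1 hr2 hs2 supp1 supp2 hV1 hV2 ha lam0.
have [d01] := nsdata_exists hr1 hs1 supp1; have [d02] := nsdata_exists hr2 hs2 supp2.
have D10 := relD_gt0 d01 hV1; have D20 := relD_gt0 d02 hV2.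
set D1 := relD rho1 sigma1 in D10 *; set D2 := relD rho2 sigma2 in D20 *.
set V1 := relV rho1 sigma1 in hV1 *; set V2 := relV rho2 sigma2 in hV2 *.
move=> eps xi s low up g.
have r0 : 0 < D1 / D2 by rewrite divr_gt0.
pose A1 := Num.sqrt (2 * lam * V1); pose A2 := Num.sqrt (2 * (D1 / D2 * V2) * lam).
have A10 : 0 < A1 by rewrite sqrtr_gt0 !mulr_gt0.
have r2 : 0 < 2 * (D1 / D2 * V2) * lam by do 3!rewrite mulr_gt0 //.
have A20 : 0 < A2 by rewrite sqrtr_gt0.
have hA1 : A1 ^+ 2 = 2 * V1 * lam.
  by rewrite sqr_sqrtr; [rewrite mulrAC|rewrite ltW // !mulr_gt0].
have hA2 : A2 ^+ 2 = 2 * (D1 / D2 * V2) * lam.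
  by rewrite sqr_sqrtr // ltW.
have xi0 : 0 < xi by rewrite /xi divr_gt0 // divr_gt0.
(* The output variance at the rate D1 / D2 is D1 / D2 * V2; this is how xi enters, and it turns |1 -
   xi^(-1/2)| A1 into |A1 - A2|. *)
have hxi : (Num.sqrt xi)^-1 * A1 = A2 by exact: sqrt_ratio_mul.
have sE n : s n = A1 * gs a n.
  by rewrite /s sqrtrM // ltW // !mulr_gt0.
have lowE n : low n = (D1 + (- `|A1 - A2|) * gs a n) / D2.
  rewrite /low sE mulrA mulNr; congr ((_ - _ * _) / _).
  by rewrite -hxi -{2}[A1]mul1r -mulrBl normrM (gtr0_norm A10).
have upE n : up n = (D1 + (A1 + A2) * gs a n) / D2.
  rewrite /up sE mulrA; congr ((_ + _ * _) / _).
  by rewrite mulrDl mul1r hxi.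
have epsE n : eps n = expR (- (Ls a n * lam)) by rewrite /eps mulrC.
have e2 (e : R) : 0 < e -> 0 < e * D2 / 2 by move=> e0; rewrite divr_gt0 // mulr_gt0.
have U1 (e : R) : 0 < e -> \forall n \near \oo,
    Rstar rho1 sigma1 rho2 sigma2 n (eps n) <= low n + e * g n /\
    has_ubound [set r : R | exists k : nat, r = k%:R / n%:R /\
      convertible (rho1 ^t n) (sigma1 ^t n) (rho2 ^t k) (sigma2 ^t k) (eps n) 0].
  move=> e0; have hsh := mseq_shift_ge ha D10 D20 (- `|A1 - A2|) e0.
  have hm := @mseq_ratio R a ha D1 D2 (- `|A1 - A2| + e * D2) D10 D20.
  have hm0 := mseq_gt0 ha (- `|A1 - A2| + e * D2) D10 D20.
  suff hno : \forall n \near \oo, forall k,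
      (mseq a D1 D2 (- `|A1 - A2| + e * D2)%R n <= k)%N ->
      ~ convertible (rho1 ^t n) (sigma1 ^t n) (rho2 ^t k) (sigma2 ^t k)
          (expR (- (Ls a n * lam))) 0.
    apply: filterS (Rstar_upper ha D10 D20 e0 hno) => n.
    by rewrite lowE epsE.
  have /orP[hA|hA] := le_total A2 A1.
    exact (no_conversion_small_le d01 d02 ha hr1 hs1 hr2 hs2 hV1 hV2 r0 hm hm0
      A10 A20 hA1 hA2 (e2 e e0) hA hsh).
  exact (no_conversion_small_ge d01 d02 ha hr1 hs1 hr2 hs2 hV1 hV2 r0 hm hm0
    A10 A20 hA1 hA2 (e2 e e0) hA hsh).
have U2 (e : R) : 0 < e -> \forall n \near \oo,
    Rstar rho1 sigma1 rho2 sigma2 n (1 - eps n) <= up n + e * g n /\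
    has_ubound [set r : R | exists k : nat, r = k%:R / n%:R /\
      convertible (rho1 ^t n) (sigma1 ^t n) (rho2 ^t k) (sigma2 ^t k) (1 - eps n) 0].
  move=> e0; have hsh := mseq_shift_ge ha D10 D20 (A1 + A2) e0.
  have hm := @mseq_ratio R a ha D1 D2 (A1 + A2 + e * D2) D10 D20.
  have hm0 := mseq_gt0 ha (A1 + A2 + e * D2) D10 D20.
  have hno := no_conversion_large d01 d02 ha hr1 hs1 hr2 hs2 hV1 hV2 r0 hm hm0
    A10 A20 hA1 hA2 (e2 e e0) hsh.
  apply: filterS (Rstar_upper ha D10 D20 e0 hno) => n.
  by rewrite upE epsE.
split; first by split=> e /[dup] e0 /[dup] /U1 h1 /U2 h2;
  [apply: filterS h1 => n []|apply: filterS h2 => n []].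
(* For achievability the eigenbases of the output pair are chosen equal. *)
move=> hcomm; have [dc hdc] := nsdata_comm hr2 hs2 supp2 hcomm.
have [dm1 [k1 g1]] := nsfamily_exists d01; have [dm2 [k2 g2]] := nsfamily_exists dc.
have e3 (e : R) : 0 < e -> 0 < e / 2 * D2 by move=> e0; rewrite mulr_gt0 // divr_gt0.
split=> e e0.
  have hm := @mseq_ratio R a ha D1 D2 (- `|A1 - A2| - e / 2 * D2) D10 D20.
  have hub : \forall n \near \oo, has_ubound [set r : R | exists k : nat, r = k%:R / n%:R /\
      convertible (rho1 ^t n) (sigma1 ^t n) (rho2 ^t k) (sigma2 ^t k)
        (expR (- (Ls a n * lam))) 0].
    by apply: filterS (U1 e e0) => n [_]; rewrite epsE.
  have hc := achieve_small ha lam0 g1 g2 hr1 hs1 hV1 hV2 r0 hm hdc A10 A20 hA1 hA2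
    (e3 e e0) (mseq_shift_le ha D10 D20 _ e).
  apply: filterS2 (U1 e e0) (Rstar_lower ha D10 D20 e0 hub hc) => n [h1 _].
  rewrite -lowE -epsE => h2; rewrite ler_norml; apply/andP; split; rewrite -/(gs a n) in h1 h2 *.
    by rewrite lerBrDl.
  by rewrite lerBlDl.
have hm := @mseq_ratio R a ha D1 D2 (A1 + A2 - e / 2 * D2) D10 D20.
have hub : \forall n \near \oo, has_ubound [set r : R | exists k : nat, r = k%:R / n%:R /\
    convertible (rho1 ^t n) (sigma1 ^t n) (rho2 ^t k) (sigma2 ^t k)
      (1 - expR (- (Ls a n * lam))) 0].
  by apply: filterS (U2 e e0) => n [_]; rewrite epsE.
have hc := achieve_large ha g1 g2 hr1 hs1 hV1 hV2 r0 hm hdc A10 A20 hA1 hA2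
  (e3 e e0) (mseq_shift_le ha D10 D20 _ e).
apply: filterS2 (U2 e e0) (Rstar_lower ha D10 D20 e0 hub hc) => n [h1 _].
rewrite -upE -epsE => h2; rewrite ler_norml; apply/andP; split; rewrite -/(gs a n) in h1 h2 *.
  by rewrite lerBrDl.
by rewrite lerBlDl.
Qed.
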